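(* Let $\varphi$ be an aperiodic primitive substitution on a finite alphabet $\mathcal{A}=\{1,\dots,d\}$ with tiling space $\mathcal{T}_\varphi$, let $l$ be its asymptotic cycle rank, and let $A_1$ be the integer matrix of size $(d-p+1)\times(d-p+1)$ constructed in the context from the transition matrix $A$ of $\varphi$ and the $p$ connected components of the transition complex $S$ of $\varphi$. Then the first integral Čech cohomology group of $\mathcal{T}_\varphi$ satisfies $$\check{H}^1(\mathcal{T}_\varphi)\;\simeq\;\varinjlim A_1\oplus\mathbb{Z}^l .$$
   Context: **Substitutions.** A substitution on $\mathcal{A}=\{1,\dots,d\}$ is a map $\varphi:\mathcal{A}\to\mathcal{A}^*$ into finite nonempty words, extended to words by concatenation. Its transition matrix is $A=(a_{ij})$, where $a_{ij}$ is the number of occurrences of $i$ in $\varphi(j)$. $\varphi$ is primitive if for all sufficiently large $n$ every $\varphi^n(i)$ contains every letter $j$. A (finite or bi-infinite) word is allowed if each of its finite factors is a factor of some $\varphi^n(i)$, $i\in\mathcal{A}$, $n\in\mathbb{N}$; $\mathcal{L}$ is the set of finite allowed words. An allowed bi-infinite word $w=\dots w_{-1}.w_0w_1\dots$ is $\varphi$-periodic if $\varphi^m(w)=\dots\varphi^m(w_{-1}).\varphi^m(w_0)\dots=w$ for some $m\geq 1$. A primitive $\varphi$ is aperiodic if at least one (equivalently, each) $\varphi$-periodic bi-infinite word is not periodic under the shift. **Tiling space.** Let $\lambda$ be the Perron–Frobenius eigenvalue of $A$ and $(\omega_1,\dots,\omega_d)$ a positive left eigenvector for it. The prototiles are $P_i=[0,\omega_i]$,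 labelled by $i$ (so $P_i$ and $P_j$ are distinct for $i\neq j$ even if $\omega_i=\omega_j$). A tiling is a collection $T=\{T_i\}_{i\in\mathbb{Z}}$ of labelled translates of prototiles with union $\mathbb{R}$ such that $T_i\cap T_{i+1}$ is a singleton for each $i$, indexed left to right so that $0\in T_0\setminus T_1$. Its word $\underline{w}(T)=\dots w_{-1}w_0w_1\dots$ has $w_i=j$ iff $T_i$ is a translate of $P_j$. $\mathcal{T}_\varphi$ is the set of tilings whose word is allowed. Topology: $T,T'$ are close if, for some $\epsilon$ near $0$, $T$ and $T'+\epsilon$ are identical in a large neighborhood of $0$; this is compact and metrizable. **Transition complex.** Fix $\epsilon=\min_{a}\omega_a/(2\lambda)>0$. For $a\in\mathcal{A}$ let $e_a=[\epsilon,\omega_a-\epsilon]\times\{a\}$ and for each two-letter word $ab\in\mathcal{L}$ let $e_{ab}=[-\epsilon,\epsilon]\times\{ab\}$. Let $K=[(\bigcup_a e_a)\cup(\bigcup_{ab\in\mathcal{L}}e_{ab})]/\sim$, where $\sim$ is generated by $(\omega_a-\epsilon,a)\sim(-\epsilon,ab)$ and $(\epsilon,b)\sim(\epsilon,ab)$ for all $ab\in\mathcal{L}$. Let $S\subseteq K$ be the image of $\bigcup_{ab\in\mathcal{L}}e_{ab}$, a finite graph. **Asymptotic cycle rank.** Let $g|_S:S\to S$ be the map sending $e_{ab}$ onto $e_{cd}$ by $[(x,ab)]\mapsto[(x,cd)]$, where $c$ is the last letter of $\varphi(a)$ and $d$ is the first letter of $\varphi(b)$. Let $ER=\bigcap_{n\ge0}(g|_S)^n(S)$,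 a subgraph of $S$. The asymptotic cycle rank $l$ of $\varphi$ is the number of independent $1$-cycles in $ER$, i.e. the rank of $H^1(ER;\mathbb{Z})$. **The matrix $A_1$.** Let $f_i$ be the $i$-th standard basis (column) vector of $\mathbb{R}^d$ and let $C_1,\dots,C_p$ be the connected components of $S$. For $i=1,\dots,p-1$ let $w_i=\sum f_j-\sum f_m$, where the first sum is over those $j\in\mathcal{A}$ for which $e_j$ terminates in $C_i$ (i.e. $[(\omega_j-\epsilon,j)]\in C_i$) and the second is over those $m\in\mathcal{A}$ for which $e_m$ originates in $C_i$ (i.e. $[(\epsilon,m)]\in C_i$). The set $\{w_1,\dots,w_{p-1}\}$ extends to a basis $\{w_1,\dots,w_d\}$ of $\mathbb{Z}^d$; fix any such extension and let $P$ be the matrix with columns $w_1,\dots,w_d$. Then $P^{-1}A^tP$ has the block form $\begin{pmatrix}E&F\\0&A_1\end{pmatrix}$ with $A_1$ of size $(d-p+1)\times(d-p+1)$; this defines $A_1$. **Direct limits.** For a square $n\times n$ integer matrix $M$, $\varinjlim M$ is the direct limit of $\mathbb{Z}^n\xrightarrow{M}\mathbb{Z}^n\xrightarrow{M}\cdots$ ($M$ acting on column vectors). *)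

(* Defs.v *)
From HB Require Import structures.
From mathcomp Require Import all_boot all_order all_algebra generic_quotient.
From mathcomp Require Import ring_quotient ring lra complex.
From mathcomp Require Import all_classical all_reals all_analysis.
Import Order.TTheory GRing.Theory Num.Theory.
Import numFieldNormedType.Exports.

Set Implicit Arguments.
Unset Strict Implicit.
Unset Printing Implicit Defensive.

Local Open Scope classical_set_scope.
Local Open Scope ring_scope.

Definition group_isomorphic (G H : zmodType) : Prop :=
  exists f : {additive G -> H}, bijective f.

Record directed_system := DirectedSystem {
  ds_index : choiceType;
  ds_le : ds_index -> ds_index -> Prop;
  ds_point : ds_index;
  ds_refl : forall i, ds_le i i;
  ds_trans : forall i j k, ds_le i j -> ds_le j k -> ds_le i k;
  ds_directed : forall i j, exists k, ds_le i k /\ ds_le j k;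
  ds_group : ds_index -> zmodType;
  ds_map : forall i j, ds_le i j -> {additive ds_group i -> ds_group j};
  ds_map_id : forall i (h : ds_le i i) x, ds_map h x = x;
  ds_map_comp : forall i j k (hij : ds_le i j) (hjk : ds_le j k)
    (hik : ds_le i k) x, ds_map hjk (ds_map hij x) = ds_map hik x
}.

Section DirectLimit.
Variable D : directed_system.

Local Notation elt := {i : ds_index D & ds_group i}.

Definition dirlim_rel (x y : elt) : Prop :=
  exists k (hx : ds_le (tag x) k) (hy : ds_le (tag y) k),
    ds_map hx (tagged x) = ds_map hy (tagged y).

Definition dirlim_relb (x y : elt) : bool := `[< dirlim_rel x y >].

Lemma dirlim_relbP : equiv_class_of dirlim_relb.
Proof.
split.
- by move=> x; apply/asboolP; exists (tag x), (ds_refl _), (ds_refl _).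
- by move=> x y; apply/asboolP/asboolP => -[k [hx [hy e]]]; exists k, hy, hx.
- move=> y x z /asboolP[k [hx [hy e]]] /asboolP[l [hy' [hz e']]].
  apply/asboolP; have [m [km lm]] := ds_directed k l.
  exists m, (ds_trans hx km), (ds_trans hz lm).
  rewrite -(ds_map_comp hx km) e (ds_map_comp _ _ (ds_trans hy km)).
  by rewrite -(ds_map_comp hz lm) -e' (ds_map_comp _ _ (ds_trans hy km)).
Qed.

Canonical dirlim_equiv := EquivRelPack dirlim_relbP.

Definition dirlim := {eq_quot dirlim_equiv}%qT.
HB.instance Definition _ := Choice.on dirlim.
HB.instance Definition _ := EqQuotient.on dirlim.

Definition dirlim_inj (i : ds_index D) (x : ds_group i) : dirlim :=
  (\pi_dirlim (Tagged (@ds_group D) x))%qT.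

Lemma dirlim_injE i j (x : ds_group i) (y : ds_group j) :
  dirlim_inj x = dirlim_inj y <->
  exists k (hx : ds_le i k) (hy : ds_le j k), ds_map hx x = ds_map hy y.
Proof.
split=> [/eqP|h]; first by rewrite /dirlim_inj eqmodE => /asboolP.
by apply/eqP; rewrite /dirlim_inj eqmodE; apply/asboolP.
Qed.

Lemma dirlim_inj_map i j (h : ds_le i j) (x : ds_group i) :
  dirlim_inj (ds_map h x) = dirlim_inj x.
Proof.
by apply/dirlim_injE; exists j, (ds_refl j), h; rewrite ds_map_id.
Qed.

Lemma dirlim_surj (x : dirlim) : exists i (y : ds_group i), x = dirlim_inj y.
Proof.
exists (tag (repr x)), (tagged (repr x)).
by rewrite /dirlim_inj -[LHS]reprK; case: (repr x).
Qed.

Lemma dirlim_surj2 (x y : dirlim) :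
  exists i (x' y' : ds_group i), x = dirlim_inj x' /\ y = dirlim_inj y'.
Proof.
have [i [x' ->]] := dirlim_surj x; have [j [y' ->]] := dirlim_surj y.
have [k [ik jk]] := ds_directed i j.
by exists k, (ds_map ik x'), (ds_map jk y'); rewrite !dirlim_inj_map.
Qed.

Definition dirlim_zero : dirlim := dirlim_inj (0 : ds_group (ds_point D)).

Definition dirlim_opp (x : dirlim) : dirlim :=
  dirlim_inj (- tagged (repr x)).

Definition dirlim_add (x y : dirlim) : dirlim :=
  let k := cid (ds_directed (tag (repr x)) (tag (repr y))) in
  dirlim_inj (ds_map (projT2 k).1 (tagged (repr x))
              + ds_map (projT2 k).2 (tagged (repr y))).

Lemma dirlim_repr (x : dirlim) : dirlim_inj (tagged (repr x)) = x.
Proof. by rewrite /dirlim_inj -[RHS]reprK; case: (repr x). Qed.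

Lemma dirlim_inj0 i : dirlim_inj (0 : ds_group i) = dirlim_zero.
Proof.
apply/dirlim_injE; have [k [ik jk]] := ds_directed i (ds_point D).
by exists k, ik, jk; rewrite !raddf0.
Qed.

Lemma dirlim_injN i (x : ds_group i) :
  dirlim_inj (- x) = dirlim_opp (dirlim_inj x).
Proof.
rewrite /dirlim_opp; apply/dirlim_injE.
have /dirlim_injE[k [h1 [h2 e]]] := dirlim_repr (dirlim_inj x).
by exists k, h2, h1; rewrite !raddfN -e.
Qed.

Lemma dirlim_injD i (x y : ds_group i) :
  dirlim_inj (x + y) = dirlim_add (dirlim_inj x) (dirlim_inj y).
Proof.
rewrite /dirlim_add; case: cid => k [/= h1 h2].
set x' := tagged _; set y' := tagged _.
have /dirlim_injE[l [l1 [l2 ex]]] := dirlim_repr (dirlim_inj x).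
have /dirlim_injE[m [m1 [m2 ey]]] := dirlim_repr (dirlim_inj y).
have [n [ln mn]] := ds_directed l m; have [q [nq kq]] := ds_directed n k.
have lq := ds_trans ln nq; have mq := ds_trans mn nq.
have iq := ds_trans l2 lq.
apply/dirlim_injE; exists q, iq, kq; rewrite !raddfD; congr (_ + _).
- by rewrite -(ds_map_comp l2 lq) -ex !(ds_map_comp _ _ (ds_trans l1 lq)).
- rewrite -(ds_map_comp m2 mq) -ey.
  by rewrite !(ds_map_comp _ _ (ds_trans m1 mq)).
Qed.

Lemma dirlim_addA : associative dirlim_add.
Proof.
move=> x y z; have [i [x' [y' [-> ->]]]] := dirlim_surj2 x y.
have [j [z' ->]] := dirlim_surj z; have [k [ik jk]] := ds_directed i j.
rewrite -(dirlim_inj_map ik x') -(dirlim_inj_map ik y') -(dirlim_inj_map jk z').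
by rewrite -!dirlim_injD addrA.
Qed.

Lemma dirlim_addC : commutative dirlim_add.
Proof.
move=> x y; have [i [x' [y' [-> ->]]]] := dirlim_surj2 x y.
by rewrite -!dirlim_injD addrC.
Qed.

Lemma dirlim_add0 : left_id dirlim_zero dirlim_add.
Proof.
move=> x; have [i [x' ->]] := dirlim_surj x.
by rewrite -(dirlim_inj0 i) -dirlim_injD add0r.
Qed.

Lemma dirlim_addN : left_inverse dirlim_zero dirlim_opp dirlim_add.
Proof.
move=> x; have [i [x' ->]] := dirlim_surj x.
by rewrite -dirlim_injN -dirlim_injD addNr dirlim_inj0.
Qed.

HB.instance Definition _ := GRing.isZmodule.Build dirlim
  dirlim_addA dirlim_addC dirlim_add0 dirlim_addN.

End DirectLimit.

Section MatrixSystem.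
Variables (n : nat) (M : 'M[int]_n).

Definition mx_step (k : nat) (x : 'cV[int]_n) : 'cV[int]_n :=
  iter k (mulmx M) x.

Lemma mx_step_is_zmod_morphism k : zmod_morphism (mx_step k).
Proof. by move=> x y; elim: k => //= k ->; rewrite mulmxBr. Qed.

HB.instance Definition _ k := GRing.isZmodMorphism.Build _ _ (mx_step k)
  (mx_step_is_zmod_morphism k).

Definition mx_system : directed_system.
Proof.
refine (@DirectedSystem nat (fun i j => (i <= j)%N) 0%N leqnn _ _
  (fun _ => 'cV[int]_n) (fun i j _ => mx_step (j - i)) _ _).
- by move=> i j k; apply: leq_trans.
- by move=> i j; exists (maxn i j); rewrite leq_maxl leq_maxr.
- by move=> i _ x; rewrite subnn.
- move=> i j k ij jk _ x; rewrite /= /mx_step -iterD.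
  by rewrite addnBA // subnK.
Defined.

Definition mx_dirlim : zmodType := dirlim mx_system.

End MatrixSystem.

Section CechCover.
Variable X : topologicalType.

Record open_cover := OpenCover {
  cover_mem : set (set X);
  cover_open : forall u, cover_mem u -> open u;
  cover_total : \bigcup_(u in cover_mem) u = [set: X]
}.

HB.instance Definition _ := gen_eqMixin open_cover.
HB.instance Definition _ := gen_choiceMixin open_cover.

(* Ordered simplicial cochains of the nerve, whose n-simplices are the (n+1)- *)
(* tuples of members of the cover with a common point. Cochains are total     *)
(* functions, but every condition below only looks at simplices: a 1-cochain  *)
(* vanishing on all 1-simplices is a coboundary, so values elsewhere do not   *)
(* matter in the quotient.                                                    *)
Definition cochain0 : zmodType := set X -> int.
Definition cochain1 : zmodType := set X -> set X -> int.

Definition is_cocycle (U : open_cover) (c : cochain1) : Prop :=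
  forall u v w, cover_mem U u -> cover_mem U v -> cover_mem U w ->
    (u `&` v `&` w) !=set0 -> c v w - c u w + c u v = 0.

Definition is_coboundary (U : open_cover) (c : cochain1) : Prop :=
  exists b : cochain0, forall u v, cover_mem U u -> cover_mem U v ->
    (u `&` v) !=set0 -> c u v = b v - b u.

Definition cocycle_pred (U : open_cover) : {pred cochain1} :=
  fun c => `[< is_cocycle U c >].

Lemma cocycle_zmod_closed U : zmod_closed (cocycle_pred U).
Proof.
split=> [|c c' /asboolP hc /asboolP hc']; apply/asboolP => u v w hu hv hw ne.
  by [].
have e := hc _ _ _ hu hv hw ne; have e' := hc' _ _ _ hu hv hw ne.
transitivity ((c v w - c u w + c u v) - (c' v w - c' u w + c' u v)).
  by rewrite !fctE; ring.
by rewrite e e' subr0.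
Qed.

HB.instance Definition _ U := GRing.isZmodClosed.Build cochain1 (cocycle_pred U)
  (cocycle_zmod_closed U).

Record cocycle (U : open_cover) := Cocycle {
  cocycle_val : cochain1;
  cocycleP : cocycle_val \in cocycle_pred U
}.

HB.instance Definition _ U := [isSub for @cocycle_val U].
HB.instance Definition _ U := [Choice of cocycle U by <:].
HB.instance Definition _ U := [SubChoice_isSubZmodule of cocycle U by <:].

Definition coboundary_pred (U : open_cover) : {pred cocycle U} :=
  fun c => `[< is_coboundary U (val c) >].
Arguments coboundary_pred : clear implicits.

Lemma coboundary_zmod_closed U : zmod_closed (coboundary_pred U).
Proof.
split=> [|c c' /asboolP[b hb] /asboolP[b' hb']]; apply/asboolP.
  by exists 0 => u v _ _ _; rewrite raddf0 subrr.
exists (b - b') => u v hu hv ne.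
transitivity (val c u v - val c' u v); first by rewrite raddfB.
by rewrite hb // hb' // !fctE; ring.
Qed.

HB.instance Definition _ U := GRing.isZmodClosed.Build (cocycle U)
  (coboundary_pred U) (coboundary_zmod_closed U).

Definition nerve_H1 (U : open_cover) : zmodType :=
  Quotient.quot (coboundary_pred U).

Definition refines (U V : open_cover) : Prop :=
  forall v, cover_mem V v -> exists u, cover_mem U u /\ v `<=` u.

(* Some member of U containing v, chosen globally; by [nerve_H1_mapE] the     *)
(* choice does not affect the map induced on cohomology.                      *)
Definition refinement_map (U : open_cover) (v : set X) : set X :=
  xget v [set u | cover_mem U u /\ v `<=` u].

Lemma refinement_mapP U V v : refines U V -> cover_mem V v ->
  cover_mem U (refinement_map U v) /\ v `<=` refinement_map U v.
Proof.
move=> h hv; rewrite /refinement_map; case: xgetP => [u _ [] //|no].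
by have [u hu] := h v hv; case: (no u).
Qed.

Lemma pullback_cocycle U V (h : refines U V) (c : cocycle U) :
  (fun u v => val c (refinement_map U u) (refinement_map U v) : int)
    \in cocycle_pred V.
Proof.
apply/asboolP => u v w hu hv hw [x [[xu xv] xw]].
have [ru su] := refinement_mapP h hu; have [rv sv] := refinement_mapP h hv.
have [rw sw] := refinement_mapP h hw.
have /asboolP hc := cocycleP c.
apply: hc => //; exists x.
by split; [split; [apply: su | apply: sv] | apply: sw].
Qed.

Definition pullback U V (h : refines U V) (c : cocycle U) : cocycle V :=
  Cocycle (pullback_cocycle h c).

Definition nerve_H1_map U V (h : refines U V) (x : nerve_H1 U) : nerve_H1 V :=
  (\pi_(nerve_H1 V) (pullback h (repr x)))%qT.

Lemma nerve_H1_eq U (c c' : cocycle U) :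
  ((\pi_(nerve_H1 U) c = \pi_(nerve_H1 U) c')%qT <->
   is_coboundary U (val (c - c'))).
Proof.
have e := Quotient.idealrBE (coboundary_pred U) c c'.
split=> [/eqP|h]; first by rewrite -e => /asboolP.
by apply/eqP; rewrite -e; apply/asboolP.
Qed.

Lemma nerve_H1_mapE U V (h : refines U V) (c : cocycle U) (c' : cocycle V)
    (r : set X -> set X) :
  (forall v, cover_mem V v -> cover_mem U (r v) /\ v `<=` r v) ->
  (forall u v, cover_mem V u -> cover_mem V v -> (u `&` v) !=set0 ->
     val c' u v = val c (r u) (r v)) ->
  nerve_H1_map h (\pi_(nerve_H1 U) c)%qT = (\pi_(nerve_H1 V) c')%qT.
Proof.
move=> hr hc'; apply/nerve_H1_eq.
set d := repr _.
have /nerve_H1_eq[b hb] : (\pi_(nerve_H1 U) d = \pi_(nerve_H1 U) c)%qT.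
  exact: reprK.
pose s := refinement_map U.
exists (fun v => b (s v) + val c (r v) (s v)) => u v hu hv uv.
rewrite raddfB /= !fctE hc' //.
have [su ssu] := refinement_mapP h hu; have [sv ssv] := refinement_mapP h hv.
have [ru sru] := hr _ hu; have [rv srv] := hr _ hv.
have [x [xu xv]] := uv.
have /= := hb _ _ su sv (ex_intro _ x (conj (ssu _ xu) (ssv _ xv))).
rewrite /= !fctE => e.
have /asboolP hc := cocycleP c.
have e1 := hc _ _ _ ru rv sv
  (ex_intro _ x (conj (conj (sru _ xu) (srv _ xv)) (ssv _ xv))).
have e2 := hc _ _ _ ru su sv
  (ex_intro _ x (conj (conj (sru _ xu) (ssu _ xu)) (ssv _ xv))).
rewrite -/s in e su sv e1 e2 *.
by rewrite /= in e1 e2; lra.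
Qed.

Lemma nerve_H1_map_pi U V (h : refines U V) (c : cocycle U) :
  nerve_H1_map h (\pi_(nerve_H1 U) c)%qT
    = (\pi_(nerve_H1 V) (pullback h c))%qT.
Proof.
apply: (@nerve_H1_mapE _ _ _ _ _ (refinement_map U)) => // v.
exact: refinement_mapP.
Qed.

Lemma nerve_H1_map_is_zmod_morphism U V (h : refines U V) :
  zmod_morphism (nerve_H1_map h).
Proof.
move=> x y; rewrite -[x]reprK -[y]reprK.
rewrite -[X in nerve_H1_map h X]raddfB !nerve_H1_map_pi -[RHS]raddfB.
by congr (\pi_(_) _)%qT; apply: val_inj.
Qed.

HB.instance Definition _ U V (h : refines U V) :=
  GRing.isZmodMorphism.Build _ _ (nerve_H1_map h)
    (nerve_H1_map_is_zmod_morphism h).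

Lemma nerve_H1_map_id U (h : refines U U) (x : nerve_H1 U) :
  nerve_H1_map h x = x.
Proof.
rewrite -[x]reprK; apply: (@nerve_H1_mapE _ _ h _ _ id) => // v hv.
by split.
Qed.

Lemma nerve_H1_map_comp U V W (UV : refines U V) (VW : refines V W)
    (UW : refines U W) (x : nerve_H1 U) :
  nerve_H1_map VW (nerve_H1_map UV x) = nerve_H1_map UW x.
Proof.
rewrite -[x]reprK (nerve_H1_map_pi UV) (nerve_H1_map_pi VW); apply/esym.
apply: (@nerve_H1_mapE _ _ _ _ _ (refinement_map U \o refinement_map V)) => //.
move=> w hw.
have [hv wv] := refinement_mapP VW hw.
have [hu vu] := refinement_mapP UV hv.
by split=> //; apply: subset_trans vu.
Qed.

Lemma trivial_cover_total : \bigcup_(u in [set [set: X]]) u = [set: X].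
Proof. by rewrite bigcup_set1. Qed.

Definition trivial_cover : open_cover.
Proof.
refine (@OpenCover [set [set: X]] _ trivial_cover_total).
by move=> _ ->; exact: openT.
Defined.

Lemma refines_directed U V : exists W, refines U W /\ refines V W.
Proof.
pose m := [set w | exists u v,
  [/\ cover_mem U u, cover_mem V v & w = u `&` v]].
have mo w : m w -> open w.
  move=> [u [v [hu hv ->]]].
  by apply: openI; [exact: cover_open hu | exact: cover_open hv].
have mt : \bigcup_(w in m) w = [set: X].
  apply/seteqP; split=> // x _.
  have [u hu xu] : (\bigcup_(u in cover_mem U) u) x by rewrite cover_total.
  have [v hv xv] : (\bigcup_(v in cover_mem V) v) x by rewrite cover_total.
  by exists (u `&` v) => //; exists u, v.
exists (OpenCover mo mt).
by split=> _ [u [v [hu hv ->]]]; [exists u | exists v]; split => // x [].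
Qed.

Definition cech_system : directed_system.
Proof.
refine (@DirectedSystem open_cover refines trivial_cover _ _ refines_directed
  nerve_H1 (fun U V h => nerve_H1_map h) _ _).
- by move=> U u hu; exists u; split.
- move=> U V W UV VW w /VW[v [hv wv]]; have [u [hu vu]] := UV _ hv.
  by exists u; split=> //; apply: subset_trans vu.
- exact: nerve_H1_map_id.
- exact: nerve_H1_map_comp.
Defined.

Definition cech_H1 : zmodType := dirlim cech_system.

End CechCover.

Record substitution (d : nat) := Substitution {
  subst_word :> 'I_d -> seq 'I_d;
  subst_nonempty : forall i, subst_word i != [::]
}.

Section Substitutions.
Variables (d : nat) (phi : substitution d).

Local Notation word := (seq 'I_d).

Definition subst_ext (w : word) : word := flatten [seq phi i | i <- w].

Definition subst_iter (n : nat) (i : 'I_d) : word := iter n subst_ext [:: i].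

Definition subst_mx : 'M[int]_d := \matrix_(i, j) (count_mem i (phi j))%:Z.

Definition primitive : Prop :=
  exists N : nat, forall n : nat, (N <= n)%N ->
    forall i j : 'I_d, j \in subst_iter n i.

Definition allowed (w : word) : Prop :=
  forall u : word, infix u w -> exists n i, infix u (subst_iter n i).

(* The factor w_k ... w_(k+n-1). *)
Definition word_factor (w : int -> 'I_d) (k : int) (n : nat) : word :=
  mkseq (fun j => w (k + j%:Z)) n.

Definition allowed_biinf (w : int -> 'I_d) : Prop :=
  forall k n, allowed (word_factor w k n).

(* w' = psi(w) for a substitution psi, with psi(w_0) starting at position 0   *)
(* of w'. The words psi(i) being nonempty, this determines w'.                *)
Definition biinf_image (psi : 'I_d -> word) (w w' : int -> 'I_d) : Prop :=
  forall n : nat,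
    let r := flatten (map psi (word_factor w 0 n)) in
    let l := flatten (map psi (word_factor w (- n%:Z) n)) in
    word_factor w' 0 (size r) = r /\ word_factor w' (- (size l)%:Z) (size l) = l.

Definition subst_periodic (w : int -> 'I_d) : Prop :=
  allowed_biinf w /\
  exists m : nat, (1 <= m)%N /\ biinf_image (subst_iter m) w w.

Definition shift_periodic (w : int -> 'I_d) : Prop :=
  exists k : int, k != 0 /\ forall n, w (n + k) = w n.

Definition aperiodic : Prop :=
  exists w, subst_periodic w /\ ~ shift_periodic w.

(* A combinatorial model of S: [inl a] is the endpoint (omega_a - eps, a) at  *)
(* which e_a terminates, [inr b] the endpoint (eps, b) at which e_b           *)
(* originates, and each allowed word ab gives an edge from [inl a] to [inr b].*)
Definition S_vertex : finType := ('I_d + 'I_d)%type.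

Definition S_edges : {set 'I_d * 'I_d} :=
  [set e | `[< allowed [:: e.1; e.2] >]]%SET.

Definition S_vertices : {set S_vertex} :=
  ([set inl e.1 | e in S_edges] :|: [set inr e.2 | e in S_edges])%SET.

Definition S_adj : rel S_vertex := fun u v =>
  match u, v with
  | inl a, inr b | inr b, inl a => (a, b) \in S_edges
  | _, _ => false
  end.

Definition S_components : {set {set S_vertex}} :=
  equivalence_partition (connect S_adj) S_vertices.

Definition S_map (e : 'I_d * 'I_d) : 'I_d * 'I_d :=
  (last e.1 (phi e.1), head e.2 (phi e.2)).

Definition ER_edges : {set 'I_d * 'I_d} :=
  [set e | `[< forall n : nat,
     e \in iter n (fun E : {set 'I_d * 'I_d} => S_map @: E)%SET S_edges >]]%SET.

(* The boundary map of the graph with edge set E, acting on row vectors. *)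
Definition boundary_mx (E : {set 'I_d * 'I_d}) : 'M[rat]_(#|E|, d + d) :=
  \matrix_(k < #|E|)
    row_mx (- delta_mx 0 (enum_val k).1) (delta_mx 0 (enum_val k).2).

(* The integral cycles form the free group of integral points of this kernel, *)
(* so its rank over Q is the rank of H_1, and of H^1, of the graph.           *)
Definition cycle_rank : nat := \rank (kermx (boundary_mx ER_edges)).

Section A1.
Variables (p : nat) (C : 'I_p -> {set S_vertex}) (P : 'M[int]_d).

Definition component_enum : Prop :=
  injective C /\ S_components = [set C i | i : 'I_p]%SET.

Definition component_vec (i : 'I_p) : 'cV[int]_d :=
  \col_j ((inl j \in C i)%:R - (inr j \in C i)%:R).

Definition basis_extension : Prop :=
  [/\ (p.-1 <= d)%N, P \in unitmx &
      forall (i : 'I_p) (k : 'I_d), (i < p.-1)%N -> i = k :> nat ->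
        col k P = component_vec i].

Lemma A1_index_subproof (i : 'I_(d - p.-1)) : (p.-1 + i < d)%N.
Proof. by rewrite -ltn_subRL. Qed.

Definition A1_index (i : 'I_(d - p.-1)) : 'I_d :=
  Ordinal (A1_index_subproof i).

(* The lower right block of P^-1 A^t P. Its size d - p + 1 is d - p.-1, as p  *)
(* is positive whenever S has an edge.                                        *)
Definition A1_mx : 'M[int]_(d - p.-1) :=
  mxsub A1_index A1_index (invmx P *m subst_mx^T *m P).

End A1.

End Substitutions.

(* For a primitive A exactly one lambda satisfies this. *)
Definition perron_eigenvalue (R : realType) (d : nat) (A : 'M[int]_d)
    (lambda : R) : Prop :=
  [/\ 0 < lambda, eigenvalue (map_mx intr A : 'M[R]_d) lambda &
      forall mu : R[i], eigenvalue (map_mx intr A : 'M[R[i]]_d) mu ->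
        mu <> (lambda%:C)%C -> `|mu| < (lambda%:C)%C].

Section Tilings.
Variables (R : realType) (d : nat) (phi : substitution d) (omega : 'rV[R]_d).

Definition tile (x : R) (a : 'I_d) : set R := `[x, x + omega 0 a].

(* The tile T_i is the translate by [tile_pos i] of the prototile labelled    *)
(* [tile_label i].                                                            *)
Record tiling := Tiling {
  tile_pos : int -> R;
  tile_label : int -> 'I_d;
  tile_pos_incr : {homo tile_pos : i j / i < j};
  tile_cover :
    \bigcup_(i : int) tile (tile_pos i) (tile_label i) = [set: R];
  tile_meet : forall i : int, exists x : R,
    tile (tile_pos i) (tile_label i)
      `&` tile (tile_pos (i + 1)) (tile_label (i + 1)) = [set x];
  tile_origin :
    (tile (tile_pos 0) (tile_label 0) `\` tile (tile_pos 1) (tile_label 1)) 0;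
  tile_allowed : allowed_biinf phi tile_label
}.

(* Translating a tiling shifts its indexing, so tilings are compared as       *)
(* unindexed collections of labelled tiles.                                   *)
Definition tile_set (T : tiling) : set (R * 'I_d) :=
  range (fun i : int => (tile_pos T i, tile_label T i)).

Definition translate (eps : R) (T : set (R * 'I_d)) : set (R * 'I_d) :=
  [set (y.1 + eps, y.2) | y in T].

Definition tiling_patch (r : R) (T : set (R * 'I_d)) : set (R * 'I_d) :=
  [set y | T y /\ (tile y.1 y.2 `&` `[- r, r]) !=set0].

Definition tiling_close (delta : R) (T T' : tiling) : Prop :=
  exists eps : R, `|eps| < delta /\
    tiling_patch delta^-1 (tile_set T)
      = tiling_patch delta^-1 (translate eps (tile_set T')).

(* The sets of T' that are delta-close to T form a neighbourhood base at T.   *)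
Definition tiling_open (U : set tiling) : Prop :=
  forall T, U T -> exists delta : R, 0 < delta /\
    forall T', tiling_close delta T T' -> U T'.

Lemma tiling_patchW (r s : R) (T T' : set (R * 'I_d)) :
  r <= s -> tiling_patch s T = tiling_patch s T' ->
  tiling_patch r T = tiling_patch r T'.
Proof.
move=> rs e.
have sub (Q : set (R * 'I_d)) :
    tiling_patch r Q = tiling_patch r (tiling_patch s Q).
  apply/seteqP; split=> y [].
    move=> Qy [x [xt]] /=; rewrite !in_itv /= => /andP[h1 h2]; split.
      split=> //; exists x; split=> //=; rewrite in_itv /=.
      by rewrite (le_trans _ h1) ?lerN2 // (le_trans h2).
    by exists x; split=> //=; rewrite in_itv /= h1 h2.
  by move=> [Qy _] ne; split.
by rewrite sub e -sub.
Qed.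

Lemma tiling_closeW (delta delta' : R) (T T' : tiling) : 0 < delta ->
  delta <= delta' -> tiling_close delta T T' -> tiling_close delta' T T'.
Proof.
move=> d0 dd [eps [he e]]; exists eps; split; first exact: lt_le_trans dd.
apply: tiling_patchW e.
by rewrite lef_pV2 // posrE // (lt_le_trans d0).
Qed.

Lemma tiling_openT : tiling_open setT.
Proof. by move=> T _; exists 1; split. Qed.

Lemma tiling_openI : setI_closed tiling_open.
Proof.
move=> U V oU oV T [/oU[d1 [d1_gt0 h1]] /oV[d2 [d2_gt0 h2]]].
exists (Num.min d1 d2); split; first by rewrite lt_min d1_gt0.
have m0 : 0 < Num.min d1 d2 by rewrite lt_min d1_gt0.
move=> T' hT'; split; [apply: h1 | apply: h2];
  by apply: tiling_closeW hT' => //; rewrite ge_min lexx ?orbT.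
Qed.

Lemma tiling_open_bigU (I : Type) (f : I -> set tiling) :
  (forall i, tiling_open (f i)) -> tiling_open (\bigcup_i f i).
Proof.
move=> of_ T [i _ /of_[e [e0 h]]]; exists e; split=> // T' /h fT'.
by exists i.
Qed.

HB.instance Definition _ := gen_eqMixin tiling.
HB.instance Definition _ := gen_choiceMixin tiling.
HB.instance Definition _ := isOpenTopological.Build tiling
  tiling_openT tiling_openI tiling_open_bigU.

End Tilings.

(* Main.v *)
Require Import Defs.
From HB Require Import structures.
From mathcomp Require Import all_boot all_order all_algebra complex.
From mathcomp Require Import all_classical all_reals all_analysis.
From mathcomp Require Import generic_quotient ring_quotient zify ring lra.
Import Order.TTheory GRing.Theory Num.Theory.
Import numFieldNormedType.Exports.

(* The tiling space is the suspension of the subshift X of allowed biinfinite *)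
(* words, so a first Cech class is determined by its holonomies along the     *)
(* tiles, and the first Cech group is the group of coinvariants of the shift  *)
(* on C(X, Z).  Summing f over the letters of phi(x_0) defines an             *)
(* endomorphism of the coinvariants, which is bijective because phi is        *)
(* recognizable: every allowed word is in a unique way, depending             *)
(* continuously on it, a shift of the image of an allowed word.  After enough *)
(* iterations every f depends only on x_{-1} x_0, that is, becomes a cellular *)
(* 1-cochain of the complex K, and a cochain of K that is a coboundary on X   *)
(* becomes a coboundary on K.  So the coinvariants are the direct limit of    *)
(* H^1(K), which is an extension of lim H^1(S) = H^1(ER) = Z^l by the limit   *)
(* of Z^d modulo the span of the w_i, that is, by lim A_1; it splits because  *)
(* Z^l is free.                                                               *)

Set Implicit Arguments.
Unset Strict Implicit.
Unset Printing Implicit Defensive.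
Local Open Scope classical_set_scope.
Local Open Scope ring_scope.

(** From Cech classes to functions: the tiling space is the quotient of X x R identifying (x, s)
    with (shift x, s - omega of x_0). A cocycle of a cover acquires a primitive on the strip X x
    [0, M] ([trivializes_ex]), and the jump of this primitive between the lifts (x, omega of x_0)
    and (shift x, 0) of one tiling is a locally constant function f, its holonomy. The class and the
    class of f modulo B o shift - B determine each other, and every f occurs: [holonomy_ex],
    [holonomy_coboundary], [coboundary_holonomy], [cech_rel_ex_small].

    Recognizability: tile lengths turn phi into a dilation by lambda > 1. Since allowed words
    contain no long powers ([no_long_powers]), tilings have no small local translational periods
    ([no_short_periods]), and a pigeonhole argument on iterated preimages turns a failure of
    injectivity into such a period ([state_wsub_inj]). The resulting continuous desubstitution
    inverts tower sums on coinvariants ([tower_inj], [tower_surj]).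

    From functions to matrices: tower sums carry every function to a cochain of K
    ([exists_pair_cochain]) and every coboundary on X between cochains to one on K
    ([cell_coboundary]). On the pair part they act by pullback along [S_map], an iterate of which
    retracts S onto ER, where [graph_splitting] provides Z^l. On the letter part they act by A^t,
    and modulo [vertex_cut] by A_1.

    All these correspondences depend on choices. They are therefore kept as relations compatible
    with subtraction; their composite is total on both sides with trivial kernels, so it is the
    graph of an isomorphism by the lemma below. *)

Lemma group_isomorphic_of_relation (G H : zmodType) (r : G -> H -> Prop) :
  (forall x x' y y', r x y -> r x' y' -> r (x - x') (y - y')) ->
  (forall x, exists y, r x y) -> (forall y, exists x, r x y) ->
  (forall y, r 0 y -> y = 0) -> (forall x, r x 0 -> x = 0) ->
  group_isomorphic G H.
Proof.
move=> rB rl rr r0l r0r.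
have r0 : r 0 0 by have [y h] := rl 0; have := rB _ _ _ _ h h; rewrite !subrr.
have runiq x y y' : r x y -> r x y' -> y = y'.
  by move=> h /(rB _ _ _ _ h); rewrite subrr => /r0l/subr0_eq.
have rinj x x' y : r x y -> r x' y -> x = x'.
  by move=> h /(rB _ _ _ _ h); rewrite subrr => /r0r/subr0_eq.
pose f x := xget 0 [set y | r x y].
have fP x : r x (f x) by rewrite /f; case: xgetP => // no; have [y /no] := rl x.
pose g y := xget 0 [set x | r x y].
have gP y : r (g y) y by rewrite /g; case: xgetP => // no; have [x /no] := rr y.
have fB : zmod_morphism f.
  by move=> x x'; apply: runiq (fP _) _; apply: rB.
pose F := GRing.isZmodMorphism.Build _ _ f fB.
pose f' : {additive G -> H} := HB.pack f F.
exists f'; exists g => x.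
- exact: rinj (gP _) (fP x).
- exact: runiq (fP _) (gP x).
Qed.

(** * Signed cumulative sums over the integers *)

Lemma int_step_ind (Q : int -> Prop) : Q 0 ->
  (forall i, Q i -> Q (i + 1)) -> (forall i, Q (i + 1) -> Q i) ->
  forall i, Q i.
Proof.
move=> h0 hS hP; case=> n.
  by elim: n => // n ih; rewrite -addn1 PoszD; apply: hS.
elim: n => [|n ih]; apply: hP; first by rewrite (_ : Negz 0 + 1 = 0).
by rewrite (_ : Negz n.+1 + 1 = Negz n) //; lia.
Qed.

Section Cumulative.
Variable V : zmodType.
Implicit Type w : int -> V.

(** A discrete integral from 0 to [i], with the usual sign below 0; [cum_unique] characterizes it.
    Block positions, tile positions and Birkhoff sums are all instances. *)
Definition cum w (i : int) : V :=
  match i with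
  | Posz n => \sum_(j < n) w j%:Z
  | Negz n => - \sum_(j < n.+1) w (- (j.+1)%:Z)
  end.

Lemma cum0 w : cum w 0 = 0.
Proof. by rewrite /= big_ord0. Qed.

Lemma cumS w i : cum w (i + 1) = cum w i + w i.
Proof.
case: i => n; first by rewrite -PoszD addn1 /= big_ord_recr.
case: n => [|n].
  by rewrite (_ : Negz 0 + 1 = 0) ?cum0 //= big_ord1 addNr.
rewrite (_ : Negz n.+1 + 1 = Negz n); last by lia.
by rewrite /= [in RHS]big_ord_recr /= opprD NegzE subrK.
Qed.

Lemma cum_unique w (F : int -> V) :
  F 0 = 0 -> (forall i, F (i + 1) = F i + w i) -> F =1 cum w.
Proof.
move=> F0 FS; apply: int_step_ind => [|i ih|i]; first by rewrite cum0.
  by rewrite FS cumS ih.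
by rewrite FS cumS => /addIr.
Qed.

Lemma cum_telescope (F : int -> V) i :
  cum (fun j => F (j + 1) - F j) i = F i - F 0.
Proof.
apply/esym; move: i; apply: cum_unique => [|i]; first by rewrite subrr.
by rewrite [RHS]addrC addrA subrK.
Qed.

Lemma cum_shift w k i : cum (fun j => w (j + k)) i = cum w (i + k) - cum w k.
Proof.
apply/esym; move: i; apply: (cum_unique (F := fun i => _ - _)) => [|i].
  by rewrite add0r subrr.
by rewrite addrAC cumS addrAC.
Qed.

Lemma cumB w w' i : cum (fun j => w j - w' j) i = cum w i - cum w' i.
Proof.
apply/esym; move: i; apply: (cum_unique (F := fun i => _ - _)) => [|i].
  by rewrite !cum0 subrr.
by rewrite !cumS opprD addrACA.
Qed.

Lemma eq_cum_on w w' a b i : a <= 0 <= b ->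
  (forall j, a <= j < b -> w j = w' j) -> a <= i <= b -> cum w i = cum w' i.
Proof.
move=> /andP[a0 b0] e; case: i => n hi /=; last congr (- _);
  by apply: eq_bigr => j _; apply: e; have := ltn_ord j; lia.
Qed.

Lemma eq_cum w w' i : w =1 w' -> cum w i = cum w' i.
Proof. by move=> /funext ->. Qed.

End Cumulative.

Section OrderedCumulative.
Variable V : realDomainType.
Implicit Type w : int -> V.

Lemma cum_ltr w : (forall i, 0 < w i) -> {mono cum w : i j / i < j}.
Proof.
move=> w0; apply: leW_mono; apply: le_mono => i j ij.
have [n ->] : exists n : nat, j = i + n.+1%:Z by exists `|j - i|.-1%N; lia.
elim: n => [|n ih]; first by rewrite cumS ltrDl.
apply: lt_trans ih _.
by rewrite (_ : i + n.+2%:Z = (i + n.+1%:Z) + 1) ?cumS ?ltrDl //; lia.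
Qed.

Lemma cum_ler w : (forall i, 0 < w i) -> {mono cum w : i j / i <= j}.
Proof. by move=> w0 i j; rewrite !leNgt cum_ltr. Qed.

Lemma cum_inj w : (forall i, 0 < w i) -> injective (cum w).
Proof. by move=> w0 i j e; apply/eqP; rewrite eq_le -!(cum_ler w0) e lexx. Qed.

Lemma cum_lower w e i (n : nat) : (forall j, e <= w j) ->
  e *+ n <= cum w (i + n%:Z) - cum w i.
Proof.
move=> we; elim: n => [|n ih]; first by rewrite addr0 subrr.
rewrite (_ : i + n.+1%:Z = i + n%:Z + 1); last by lia.
by rewrite cumS mulrSr addrAC lerD.
Qed.

Lemma cum_upper w e i (n : nat) : (forall j, w j <= e) ->
  cum w (i + n%:Z) - cum w i <= e *+ n.
Proof.
move=> we; elim: n => [|n ih]; first by rewrite addr0 subrr.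
rewrite (_ : i + n.+1%:Z = i + n%:Z + 1); last by lia.
by rewrite cumS mulrSr addrAC lerD.
Qed.

Lemma cum_locate w e v : 0 < e -> (forall j, e <= w j) ->
  (forall z, exists n, z < e *+ n) ->
  exists i, cum w i <= v < cum w (i + 1).
Proof.
move=> e0 we arch.
have lo n : cum w (- n%:Z) <= - (e *+ n).
  by have := cum_lower (- n%:Z) n we; rewrite addNr cum0 sub0r lerNr.
have hi n : e *+ n <= cum w n%:Z.
  by have := cum_lower 0 n we; rewrite add0r cum0 subr0.
have [n1 h1] := arch v; have [n2 h2] := arch (- v).
have : cum w (- n2%:Z) <= v.
  by apply: le_trans (lo _) _; rewrite lerNl ltW.
have : exists m : nat, v < cum w (- n2%:Z + m%:Z).
  exists (n1 + n2)%N; rewrite (_ : _ + _ = n1%:Z); last by lia.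
  exact: lt_le_trans (hi _).
move: (- n2%:Z) => a [m]; elim: m a => [|m ih] a hm ha.
  by move: hm; rewrite addr0 ltNge ha.
have [hv|hv] := ltP v (cum w (a + 1)); first by exists a; rewrite ha hv.
apply: (ih (a + 1)) => //.
by rewrite (_ : _ + _ = a + m.+1%:Z) //; lia.
Qed.

Lemma cum_locate_unique w v i j : (forall j, 0 < w j) ->
  cum w i <= v < cum w (i + 1) -> cum w j <= v < cum w (j + 1) -> i = j.
Proof.
move=> w0 /andP[i1 i2] /andP[j1 j2].
have := le_lt_trans i1 j2; have := le_lt_trans j1 i2.
by rewrite !cum_ltr //; lia.
Qed.

End OrderedCumulative.

Lemma int_archi (z : int) : exists n, z < 1 *+ n.
Proof. by exists `|z|.+1%N; rewrite -[1 *+ _]/(_%:R) natz; lia. Qed.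

Lemma real_archi (R : realType) (e z : R) : 0 < e -> exists n, z < e *+ n.
Proof.
move=> e0; exists (Num.bound `|z / e|).
rewrite -[X in X *+ _]mulr1 -mulrnAr mulrC -ltr_pdivrMr //.
by apply: le_lt_trans (ler_norm _) _; apply: archi_boundP.
Qed.

Lemma int_lt_addP (i j : int) : i < j -> exists2 q : nat, (0 < q)%N & j = i + q%:Z.
Proof. by exists `|(j - i)%R|%N; lia. Qed.

(** * Bi-infinite words and substitutions *)

Section Words.
Variable d : nat.
Implicit Types (psi : substitution d) (x y : int -> 'I_d).

Definition wshift (k : int) x : int -> 'I_d := fun i => x (i + k).

Lemma wshiftD k l x : wshift k (wshift l x) = wshift (k + l) x.
Proof. by apply/funext => i; rewrite /wshift addrA. Qed.

Lemma wshift0 x : wshift 0 x = x.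
Proof. by apply/funext => i; rewrite /wshift addr0. Qed.

Lemma size_word_factor x k n : size (word_factor x k n) = n.
Proof. by rewrite size_mkseq. Qed.

Lemma word_factor_cat x k n m :
  word_factor x k (n + m) = word_factor x k n ++ word_factor x (k + n%:Z) m.
Proof.
rewrite /word_factor /mkseq iotaD map_cat; congr (_ ++ _).
rewrite add0n -[X in iota X]addn0 iotaDl -map_comp.
by apply: eq_map => j /=; rewrite PoszD addrA.
Qed.

Lemma nth_word_factor a x k n j : (j < n)%N ->
  nth a (word_factor x k n) j = x (k + j%:Z).
Proof. by move=> jn; rewrite nth_mkseq. Qed.

Lemma eq_word_factor x y k l n :
  (forall j : nat, (j < n)%N -> x (k + j%:Z) = y (l + j%:Z)) ->
  word_factor x k n = word_factor y l n.
Proof.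
move=> e; case: n e => // n e; apply: (@eq_from_nth _ (x 0)).
  by rewrite !size_word_factor.
by move=> j; rewrite size_word_factor => jn; rewrite !nth_word_factor ?e.
Qed.

Lemma word_factor_eq x y k l n : word_factor x k n = word_factor y l n ->
  forall j : nat, (j < n)%N -> x (k + j%:Z) = y (l + j%:Z).
Proof.
by move=> e j jn; rewrite -!(nth_word_factor (x 0) _ _ jn) e.
Qed.

Lemma word_factor_infix x k l n m : k <= l -> l + m%:Z <= k + n%:Z ->
  infix (word_factor x l m) (word_factor x k n).
Proof.
move=> kl lm; have [a ea] : exists a : nat, l = k + a%:Z.
  by exists `|l - k|%N; lia.
have [b eb] : exists b, n = (a + (m + b))%N by exists (n - a - m)%N; lia.
by apply/infixP; rewrite eb ea !word_factor_cat; do 2 eexists.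
Qed.

Lemma infix_word_factor x u k n : infix u (word_factor x k n) ->
  exists l, [/\ k <= l, l + (size u)%:Z <= k + n%:Z &
    u = word_factor x l (size u)].
Proof.
case/infixP => s1 [s2 e]; exists (k + (size s1)%:Z).
have en : n = (size s1 + (size u + size s2))%N.
  by rewrite -(size_word_factor x k n) e !size_cat.
split; [by lia | by lia |].
move: e; rewrite en !word_factor_cat => e.
have := congr1 (fun w => take (size u) (drop (size s1) w)) e.
rewrite !drop_size_cat ?size_word_factor // take_size_cat //.
by rewrite take_size_cat ?size_word_factor.
Qed.

(** Where the block of letter [i] starts in the image of [x], the block of letter 0 starting at
    0. *)
Definition wpos psi x : int -> int := cum (fun i => (size (psi (x i)))%:Z).

Lemma size_subst_gt0 psi i : (0 < size (psi i))%N.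
Proof. by rewrite lt0n size_eq0 subst_nonempty. Qed.

Lemma wpos0 psi x : wpos psi x 0 = 0. Proof. exact: cum0. Qed.

Lemma wposS psi x i : wpos psi x (i + 1) = wpos psi x i + (size (psi (x i)))%:Z.
Proof. exact: cumS. Qed.

Lemma wpos1 psi x : wpos psi x 1 = (size (psi (x 0)))%:Z.
Proof. by rewrite -[1]add0r wposS wpos0 add0r. Qed.

Lemma wpos_lt psi x : {mono wpos psi x : i j / i < j}.
Proof. by apply: cum_ltr => i; rewrite ltz_nat size_subst_gt0. Qed.

Lemma wpos_le psi x : {mono wpos psi x : i j / i <= j}.
Proof. by apply: cum_ler => i; rewrite ltz_nat size_subst_gt0. Qed.

Lemma wpos_grow psi x i (n : nat) : wpos psi x i + n%:Z <= wpos psi x (i + n%:Z).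
Proof.
have := @cum_lower _ (fun i => (size (psi (x i)))%:Z) 1 i n.
rewrite -[1 *+ n]/(_%:R) natz -/(wpos psi x) => h.
have {h} := h (fun j => size_subst_gt0 psi (x j)); lia.
Qed.

Lemma wpos_shift psi x k i : wpos psi (wshift k x) i = wpos psi x (i + k) - wpos psi x k.
Proof. exact: cum_shift. Qed.

Lemma wpos_locate psi x j : exists i k,
  (k < size (psi (x i)))%N /\ j = wpos psi x i + k%:Z.
Proof.
have [i /andP[h1 h2]] := @cum_locate _ (fun i => (size (psi (x i)))%:Z) 1 j
  ltr01 (fun j => size_subst_gt0 psi (x j)) int_archi.
rewrite -/(wpos psi x) wposS in h1 h2.
by exists i, `|(j - wpos psi x i)%R|%N; split; lia.
Qed.

(** The bi-infinite image of [x]. The block [i] covering position [j] always exists ([wpos_locate]),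
    so the default of [xget] is not reached. *)
Definition wsub psi x : int -> 'I_d := fun j =>
  let i := xget 0 [set i | wpos psi x i <= j < wpos psi x (i + 1)] in
  nth (x i) (psi (x i)) `|j - wpos psi x i|%N.

Lemma wsubE psi x a i k : (k < size (psi (x i)))%N ->
  wsub psi x (wpos psi x i + k%:Z) = nth a (psi (x i)) k.
Proof.
move=> hk; rewrite /wsub; case: xgetP => [i' _ /= /andP[h1 h2]|/(_ i)].
  have ei : i' = i.
    have := le_lt_trans h1 (_ : _ < wpos psi x (i + 1)).
    rewrite wposS; move: h2; rewrite wposS => h2 /(_ ltac:(lia)) h3.
    have h4 : wpos psi x i < wpos psi x (i' + 1) by rewrite wposS; lia.
    have h5 : wpos psi x i' < wpos psi x (i + 1) by rewrite wposS; lia.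
    by move: h4 h5; rewrite !wpos_lt; lia.
  rewrite ei (_ : `|_|%N = k); last by lia.
  exact: set_nth_default.
by case; rewrite /= wposS; lia.
Qed.

Lemma wsub_block psi x i :
  word_factor (wsub psi x) (wpos psi x i) (size (psi (x i))) = psi (x i).
Proof.
apply: (@eq_from_nth _ (x i)); first by rewrite size_word_factor.
by move=> k; rewrite size_word_factor => hk; rewrite nth_word_factor // (wsubE (x i)).
Qed.

Lemma wsub_unique psi x y :
  (forall i, word_factor y (wpos psi x i) (size (psi (x i))) = psi (x i)) ->
  y = wsub psi x.
Proof.
move=> h; apply/funext => j; have [i [k [hk ->]]] := wpos_locate psi x j.
by rewrite (wsubE (x i)) // -[in RHS]h nth_word_factor.
Qed.

Lemma wsub_shift psi x k : wsub psi (wshift k x) = wshift (wpos psi x k) (wsub psi x).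
Proof.
apply/esym/wsub_unique => i; rewrite -[RHS](wsub_block psi x (i + k)).
apply: eq_word_factor => j _; rewrite /wshift wpos_shift; congr wsub; ring.
Qed.

Lemma wsub_word_factor psi x i n : let w := word_factor x i n in
  (size (subst_ext psi w))%:Z = wpos psi x (i + n%:Z) - wpos psi x i /\
  word_factor (wsub psi x) (wpos psi x i) (size (subst_ext psi w))
    = subst_ext psi w.
Proof.
elim: n => [|n [ih1 ih2]] /=; first by rewrite addr0 subrr.
rewrite -addn1 word_factor_cat /subst_ext map_cat flatten_cat /= cats0 addr0.
rewrite size_cat -/(subst_ext _ _); split.
  by rewrite !PoszD ih1 addrA wposS; ring.
rewrite word_factor_cat ih2 ih1; congr (_ ++ _).
by rewrite addrC subrK wsub_block.
Qed.

Lemma subst_iter_gt0 psi n i : (0 < size (subst_iter psi n i))%N.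
Proof.
rewrite /subst_iter; elim: n => // n; rewrite iterS.
case: (iter _ _ _) => //= a w _.
by rewrite /subst_ext /= size_cat ltn_addr ?size_subst_gt0.
Qed.

Lemma subst_iter_neq0 psi n i : subst_iter psi n i != [::].
Proof. by rewrite -size_eq0 -lt0n subst_iter_gt0. Qed.

Definition spow psi n : substitution d := Substitution (subst_iter_neq0 psi n).

Lemma wpos_spow0 psi x i : wpos (spow psi 0) x i = i.
Proof.
by apply/esym; move: i; apply: cum_unique => //.
Qed.

Lemma spow_sub psi n x : wsub (spow psi n) x = iter n (wsub psi) x /\
  forall i, wpos (spow psi n.+1) x i = wpos psi (wsub (spow psi n) x) (wpos (spow psi n) x i).
Proof.
have hp m i : wpos (spow psi m.+1) x i
    = wpos psi (wsub (spow psi m) x) (wpos (spow psi m) x i).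
  apply/esym; move: i; apply: cum_unique => [|i]; first by rewrite !wpos0.
  rewrite wposS /=.
  have [h _] := wsub_word_factor psi (wsub (spow psi m) x) (wpos (spow psi m) x i)
    (size (spow psi m (x i))).
  by rewrite wsub_block in h; rewrite h [RHS]addrC subrK.
split=> //; elim: n => [|n ih].
  apply/esym/wsub_unique => i /=; rewrite wpos_spow0 /word_factor /=.
  by rewrite /mkseq /= addr0.
rewrite iterS -ih; apply/esym/wsub_unique => i; rewrite hp /=.
have [_] := wsub_word_factor psi (wsub (spow psi n) x) (wpos (spow psi n) x i)
    (size (spow psi n (x i))).
by rewrite wsub_block.
Qed.

Lemma wsub_spow psi n x : wsub (spow psi n) x = iter n (wsub psi) x.
Proof. by have [] := spow_sub psi n x. Qed.

Definition agree_on (a b : int) x y := forall i, a <= i < b -> x i = y i.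

Lemma agree_wpos psi a b x y : a <= 0 <= b -> agree_on a b x y ->
  forall i, a <= i <= b -> wpos psi x i = wpos psi y i.
Proof.
by move=> ab e i; apply: eq_cum_on ab _ => j /e ->.
Qed.

Lemma agree_wsub psi a b x y : a <= 0 <= b -> agree_on a b x y ->
  agree_on (wpos psi x a) (wpos psi x b) (wsub psi x) (wsub psi y).
Proof.
move=> ab e j; have [i [k [hk ->]]] := wpos_locate psi x j => /andP[h1 h2].
have hi : a <= i < b.
  have : wpos psi x a < wpos psi x (i + 1) by rewrite wposS; lia.
  have : wpos psi x i < wpos psi x b by lia.
  by rewrite !wpos_lt; lia.
rewrite (wsubE (x 0)) // (agree_wpos psi ab e); last by lia.
by rewrite (wsubE (x 0)) -e.
Qed.

End Words.

(** * Compactness of the space of bi-infinite words *)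

Section Compactness.
Variable T : finType.

Definition frequently (Q : nat -> Prop) : Prop := forall M, exists2 N, (M <= N)%N & Q N.

Lemma frequently_and_eq (Q : nat -> Prop) (g : nat -> T) : frequently Q ->
  exists a, frequently (fun N => Q N /\ g N = a).
Proof.
move=> fQ; apply: contrapT => no.
have {}no a : exists M, forall N, (M <= N)%N -> Q N -> g N <> a.
  apply: contrapT => h; apply: no; exists a => M; apply: contrapT => h'.
  apply: h; exists M => N MN QN e; apply: h'; by exists N.
have [M hM] := choice no.
have [N hN QN] := fQ (\max_a M a)%N.
by apply: (hM (g N) N) => //; apply: leq_trans hN; apply: leq_bigmax.
Qed.

(** Successive refinement: [st n] holds for infinitely many indices and fixes the first [n] values
    on them; the next value is one taken infinitely often among these. *)
Lemma frequently_prefix (z : nat -> nat -> T) : exists y : nat -> T,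
  forall n, frequently (fun N => forall j, (j < n)%N -> z N j = y j).
Proof.
have step (s : {Q : nat -> Prop | frequently Q}) n :
    {a | frequently (fun N => sval s N /\ z N n = a)}.
  by apply: cid; apply: frequently_and_eq; exact: svalP.
have fT : frequently (fun _ => True) by move=> M; exists M.
pose st := fix st n : {Q : nat -> Prop | frequently Q} :=
  if n is m.+1 then
    exist frequently (fun N => sval (st m) N /\ z N m = sval (step (st m) m))
      (svalP (step (st m) m))
  else exist frequently (fun _ => True) fT.
exists (fun n => sval (step (st n) n)) => n.
have h : forall N, sval (st n) N ->
    forall j, (j < n)%N -> z N j = sval (step (st j) j).
  elim: n => // n ih N [/ih {}ih e] j; rewrite ltnS leq_eqVlt.
  by case/orP => [/eqP ->|/ih].
by move=> M; have [N MN /h hN] := svalP (st n) M; exists N.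
Qed.

End Compactness.

Lemma frequently_window (T : finType) (z : nat -> int -> T) : exists y : int -> T,
  forall n, frequently (fun N => forall i, - n%:Z <= i < n%:Z -> z N i = y i).
Proof.
have [y hy] := frequently_prefix (fun N j => (z N j%:Z, z N (Negz j))).
exists (fun i => match i with Posz n => (y n).1 | Negz n => (y n).2 end).
move=> n M; have [N MN h] := hy n M; exists N => // -[j|j] hj.
  by rewrite -h //; lia.
by rewrite -h //; lia.
Qed.

(** * Allowed words and their desubstitution *)

Section Allowed.
Variables (d : nat) (phi : substitution d).
Implicit Types (x y : int -> 'I_d).

Lemma allowedP w : allowed phi w <-> exists n i, infix w (subst_iter phi n i).
Proof.
split=> [h|[n [i h]] u uw]; first exact/h/infix_refl.
by exists n, i; apply: infix_trans h.
Qed.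

Lemma allowed_infix u w : infix u w -> allowed phi w -> allowed phi u.
Proof. by move=> uw h v vu; apply: h; apply: infix_trans uw. Qed.

Lemma subst_ext_cat u v : subst_ext phi (u ++ v) = subst_ext phi u ++ subst_ext phi v.
Proof. by rewrite /subst_ext map_cat flatten_cat. Qed.

Lemma infix_subst_ext u w : infix u w -> infix (subst_ext phi u) (subst_ext phi w).
Proof.
case/infixP => s [t ->]; apply/infixP; exists (subst_ext phi s), (subst_ext phi t).
by rewrite !subst_ext_cat.
Qed.

Lemma iter_subst_ext_infix n u w :
  infix u w -> infix (iter n (subst_ext phi) u) (iter n (subst_ext phi) w).
Proof. by move=> h; elim: n => //= n; apply: infix_subst_ext. Qed.

Lemma infix_subst_iter n k i c : i \in subst_iter phi k c ->
  infix (subst_iter phi n i) (subst_iter phi (n + k) c).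
Proof.
move=> hi; rewrite /subst_iter iterD; apply: iter_subst_ext_infix.
move: hi; rewrite /subst_iter; case/splitPr => s t.
by apply/infixP; exists s, t.
Qed.

Lemma allowed_subst_ext w : allowed phi w -> allowed phi (subst_ext phi w).
Proof.
move=> /allowedP [n [i h]]; apply/allowedP; exists n.+1, i.
exact: infix_subst_ext.
Qed.

Lemma allowed_shift k x : allowed_biinf phi x -> allowed_biinf phi (wshift k x).
Proof.
move=> h l n; rewrite (_ : word_factor _ _ _ = word_factor x (l + k) n) //.
by apply: eq_word_factor => j _; rewrite /wshift; congr x; lia.
Qed.

Lemma allowed_wsub x : allowed_biinf phi x -> allowed_biinf phi (wsub phi x).
Proof.
move=> h l n; have [i [k [hk ->]]] := wpos_locate phi x l.
have [hs hw] := wsub_word_factor phi x i n.+1.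
apply: allowed_infix (allowed_subst_ext (h i n.+1)).
rewrite -hw; apply: word_factor_infix; first by lia.
rewrite hs.
have := wpos_grow phi x (i + 1) n; rewrite wposS.
by rewrite (_ : i + n.+1%:Z = i + 1 + n%:Z); lia.
Qed.

Lemma allowed_spow n x :
  allowed_biinf phi x -> allowed_biinf phi (wsub (spow phi n) x).
Proof. by move=> h; rewrite wsub_spow; elim: n => //= n; apply: allowed_wsub. Qed.

Lemma allowed_closed y : (forall n : nat, exists2 x, allowed_biinf phi x &
    agree_on (- n%:Z) n%:Z x y) -> allowed_biinf phi y.
Proof.
move=> h k n; have [x hx e] := h (`|k| + n)%N.
suff -> : word_factor y k n = word_factor x k n by [].
by apply: eq_word_factor => j jn; rewrite e //; lia.
Qed.

Lemma size_subst_bounded : exists K, forall a, (size (phi a) <= K)%N.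
Proof.
by exists (\max_a size (phi a))%N => a; apply: leq_bigmax.
Qed.

(** A window of [x] lies in phi(w) for some allowed finite w. Blocks have length at most [K], so
    about N / K letters of w are available on each side of the centre. *)
Lemma finite_desubstitution x (N : nat) K : (forall a, (size (phi a) <= K)%N) ->
  allowed_biinf phi x ->
  exists y (k : nat), [/\ (k < size (phi (y 0)))%N,
    agree_on (- N%:Z) N%:Z x (wshift k%:Z (wsub phi y)) &
    forall n : nat, (K * n.+1 <= N)%N -> allowed phi (word_factor y (- n%:Z) (n + n))].
Proof.
move=> hK hx.
have [n [c]] := hx (- N.+1%:Z) (N.+1 + N.+1)%N _ (infix_refl _).
(* A single letter is too short to contain the window, so the window lies in the image of a previous
   iterate. *)
case: n => [/size_infix|n]; first by rewrite size_word_factor /=; lia.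
rewrite -[subst_iter _ _ _]/(subst_ext phi (subst_iter phi n c)).
set w := subst_iter phi n c => hu.
have hw : allowed phi w by apply/allowedP; exists n, c; exact: infix_refl.
(* A bi-infinite extension of [w], of which only the entries 0 <= i < size w matter. *)
pose z (i : int) := nth c w `|i|%N.
have ew : w = word_factor z 0 (size w).
  apply: (@eq_from_nth _ c); first by rewrite size_word_factor.
  by move=> j hj; rewrite nth_word_factor // add0r /z.
have [hs hf] := wsub_word_factor phi z 0 (size w).
rewrite -ew wpos0 add0r subr0 in hs hf.
rewrite -hf in hu; have [l [l0 l1]] := infix_word_factor hu.
rewrite size_word_factor in l1 * => /word_factor_eq e.
have [i [k [hk eik]]] := wpos_locate phi z (l + N.+1%:Z).
have hup a m : wpos phi z (a + m%:Z) - wpos phi z a <= (K * m)%:Z.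
  have := @cum_upper _ (fun i => (size (phi (z i)))%:Z) K%:Z a m.
  by rewrite -mulr_natr natz => h; apply: h => j; rewrite lez_nat.
exists (wshift i z), k; split.
- by rewrite /wshift add0r.
- move=> j hj; rewrite wsub_shift wshiftD /wshift.
  have := e `|(j + N.+1%:Z)%R|%N ltac:(lia).
  rewrite (_ : - _ + _ = j); last by lia.
  by move=> ->; congr wsub; lia.
- move=> m hm; apply: allowed_infix hw.
  rewrite (_ : word_factor _ _ _ = word_factor z (i - m%:Z) (m + m)); last first.
    by apply: eq_word_factor => j _; rewrite /wshift; congr z; lia.
  rewrite ew; apply: word_factor_infix.
    rewrite -(wpos_le phi z) wpos0.
    have := hup (i - m%:Z) m; rewrite subrK.
    have := hK (z i); lia.
  rewrite add0r -(wpos_le phi z) -hs.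
  have := hup i m; have := hK (z i).
  by rewrite (_ : i - m%:Z + (m + m)%:Z = i + m%:Z); lia.
Qed.

(** Take a limit of finite desubstitutions of growing windows; the offsets are bounded, so they too
    can be made constant along the limit. *)
Lemma desubstitution x : allowed_biinf phi x ->
  exists y (k : nat), [/\ allowed_biinf phi y, (k < size (phi (y 0)))%N &
    x = wshift k%:Z (wsub phi y)].
Proof.
move=> hx; have [K hK] := size_subst_bounded.
have := fun N => finite_desubstitution N hK hx.
move=> /choice[ys /choice[ks h]].
have hk N : (ks N < K.+1)%N.
  by have [hN _ _] := h N; apply: leq_trans hN _; apply/ltnW; rewrite ltnS.
have [z hz] := frequently_window (fun N i => (ys N i, Ordinal (hk N))).
pose y i := (z i).1; pose k : nat := (z 0).2; exists y, k.
have hz' (n : nat) M : exists N, [/\ (M <= N)%N, ks N = k &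
    agree_on (- n.+1%:Z) n.+1%:Z (ys N) y].
  have [N MN e] := hz n.+1 M; exists N; split=> //.
    by rewrite /k -(e 0) //; lia.
  by move=> i hi; rewrite /y -e.
split.
- move=> l n; have [N [MN _ e]] := hz' (`|l| + n)%N (K * (`|l| + n).+1)%N.
  have [_ _ ha] := h N; have {}ha := ha _ MN.
  apply: allowed_infix ha.
  rewrite (_ : word_factor y l n = word_factor (ys N) l n); last first.
    by apply: eq_word_factor => j jn; rewrite e //; lia.
  by apply: word_factor_infix; lia.
- have [N [_ <- e]] := hz' 0%N 0%N; have [hN _ _] := h N.
  by rewrite -e.
- apply/funext => j; pose n := (`|j| + K.+1)%N.
  have [N [MN ek e]] := hz' n n; have [hN hx' _] := h N.
  rewrite hx'; last by rewrite /n in MN; lia.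
  rewrite /wshift ek.
  have h0 : - n.+1%:Z <= 0 <= n.+1%:Z by lia.
  rewrite (agree_wsub h0 e) //.
  have hk' : (k < K.+1)%N by rewrite -ek.
  have := wpos_grow phi (ys N) 0 n.+1; rewrite wpos0 !add0r.
  have := wpos_grow phi (ys N) (- n.+1%:Z) n.+1; rewrite addNr wpos0.
  by rewrite /n; lia.
Qed.

Lemma desubstitution_spow n x : allowed_biinf phi x ->
  exists y k, allowed_biinf phi y /\ x = wshift k (wsub (spow phi n) y).
Proof.
elim: n x => [|n ih] x hx.
  by exists x, 0; rewrite wsub_spow wshift0.
have [y [k [hy ->]]] := ih _ hx.
have [y' [k' [hy' _ ->]]] := desubstitution hy.
exists y'; rewrite wsub_shift wshiftD; eexists; split=> //.
by rewrite !wsub_spow iterSr.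
Qed.

End Allowed.

(** * Tile lengths, growth of iterates and absence of long powers *)

Lemma finite_bounds (R : realType) (T : finType) (f : T -> R) :
  (forall a, 0 < f a) ->
  exists m M, [/\ 0 < m, 0 < M, forall a, m <= f a & forall a, f a <= M].
Proof.
move=> f0; exists (\big[Order.min/1]_a f a), (\big[Order.max/1]_a f a); split.
- by elim/big_ind: _ => // x y x0 y0; rewrite lt_min x0.
- by elim/big_ind: _ => // x y x0 y0; rewrite lt_max x0.
- by move=> a; apply: bigmin_le_cond.
- by move=> a; apply: le_bigmax_cond.
Qed.

Section Primitive.
Variables (R : realType) (d : nat) (phi : substitution d) (om : 'I_d -> R) (lam : R).
Hypotheses (phi_primitive : primitive phi) (phi_aperiodic : aperiodic phi).
Hypothesis om_gt0 : forall a, 0 < om a.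
Hypothesis om_eigen : forall a, \sum_(b <- phi a) om b = lam * om a.
Implicit Types (x y z : int -> 'I_d).

Definition tpos x : int -> R := cum (fun i => om (x i)).

Lemma tpos0 x : tpos x 0 = 0. Proof. exact: cum0. Qed.

Lemma tposS x i : tpos x (i + 1) = tpos x i + om (x i).
Proof. exact: cumS. Qed.

Lemma tpos_lt x : {mono tpos x : i j / i < j}.
Proof. by apply: cum_ltr. Qed.

Lemma tpos_le x : {mono tpos x : i j / i <= j}.
Proof. by apply: cum_ler. Qed.

Lemma tpos_shift x k i : tpos (wshift k x) i = tpos x (i + k) - tpos x k.
Proof. exact: cum_shift. Qed.

Lemma tpos_word_factor x k n :
  tpos x (k + n%:Z) - tpos x k = \sum_(b <- word_factor x k n) om b.
Proof.
elim: n => [|n ih]; first by rewrite big_nil addr0 subrr.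
rewrite -addn1 word_factor_cat big_cat /= -ih big_seq1 PoszD addrA tposS addr0.
by rewrite addrAC.
Qed.

Lemma sum_subst_ext w : \sum_(b <- subst_ext phi w) om b = lam * \sum_(b <- w) om b.
Proof.
elim: w => [|a w ih]; first by rewrite !big_nil mulr0.
by rewrite /subst_ext /= big_cat /= ih om_eigen big_cons mulrDr.
Qed.

Lemma sum_subst_iter n a : \sum_(b <- subst_iter phi n a) om b = lam ^+ n * om a.
Proof.
elim: n => [|n ih]; first by rewrite big_seq1 mul1r.
by rewrite [subst_iter _ _ _]/(subst_ext _ _) sum_subst_ext ih exprS mulrA.
Qed.

Lemma tpos_sub x i : tpos (wsub phi x) (wpos phi x i) = lam * tpos x i.
Proof.
transitivity (cum (fun i => lam * om (x i)) i).
  move: i; apply: (cum_unique (F := fun i => tpos (wsub phi x) (wpos phi x i))).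
    by rewrite wpos0 tpos0.
  move=> j; rewrite wposS; apply/eqP; rewrite -subr_eq0 opprD addrA subr_eq0; apply/eqP.
  by rewrite tpos_word_factor wsub_block om_eigen.
apply/esym; move: i; apply: (cum_unique (F := fun i => lam * tpos x i)) => [|j].
  by rewrite tpos0 mulr0.
by rewrite tposS mulrDr.
Qed.

Lemma lam_gt0 : 0 < lam.
Proof.
have [w _] := phi_aperiodic; have := om_eigen (w 0).
have := subst_nonempty phi (w 0); case: (phi (w 0)) => // a s _.
rewrite big_cons => e.
have s0 : 0 <= \sum_(b <- s) om b by apply: sumr_ge0 => b _; apply: ltW.
have : 0 < lam * om (w 0) by rewrite -e; apply: ltr_wpDr.
by rewrite pmulr_lgt0.
Qed.

Lemma sum_om_ge s : 0 <= \sum_(b <- s) om b.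
Proof. by apply: sumr_ge0 => b _; apply: ltW. Qed.

(** An aperiodic word has two distinct adjacent letters, so for large n the word phi^n(a) contains
    [a] and some other letter, whence lam^n om(a) > om(a). *)
Lemma lam_gt1 : 1 < lam.
Proof.
have [w [_ hw]] := phi_aperiodic.
have [i hi] : exists i, w (i + 1) <> w i.
  apply: contrapT => no; apply: hw; exists 1; split=> // n.
  by apply: contrapT => h; apply: no; exists n.
have [N hN] := phi_primitive; set n := N.+1.
have h1 := hN n (leqnSn N) (w i) (w i); have h2 := hN n (leqnSn N) (w i) (w (i + 1)).
have : om (w i) < lam ^+ n * om (w i).
  rewrite -sum_subst_iter (perm_big _ (perm_to_rem h1)) big_cons ltrDl.
  have h3 : w (i + 1) \in rem (w i) (subst_iter phi n (w i)).
    by have := mem_rem; rewrite (perm_mem (perm_to_rem h1)) inE in h2;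
      case/orP: h2 => // /eqP.
  rewrite (perm_big _ (perm_to_rem h3)) big_cons.
  exact: ltr_wpDr (sum_om_ge _) (om_gt0 _).
rewrite -{1}[om _]mul1r ltr_pM2r //; rewrite ltNge; apply: contraNT; rewrite -leNgt.
by move=> h; apply: exprn_ile1 => //; apply: ltW lam_gt0.
Qed.

Lemma size_subst_iter_bounds m M n a : (forall b, m <= om b) -> (forall b, om b <= M) ->
  m *+ size (subst_iter phi n a) <= lam ^+ n * om a <= M *+ size (subst_iter phi n a).
Proof.
move=> hm hM; rewrite -sum_subst_iter; elim: (subst_iter _ _ _) => [|b s ih].
  by rewrite big_nil /= !mulr0n lexx.
by case/andP: ih => h1 h2; rewrite big_cons /= !mulrS !lerD.
Qed.

(** Up to the bounds on [om], the length of phi^n(a) is comparable to lam^n, which grows at least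
    linearly by Bernoulli's inequality. *)
Lemma subst_iter_grows k : exists N, forall n a, (N <= n)%N ->
  (k <= size (subst_iter phi n a))%N.
Proof.
have [m [M [m0 M0 hm hM]]] := finite_bounds om_gt0.
have [N hN] : exists N, (M / m) *+ k < lam ^+ N.
  pose t := lam - 1; have t0 : 0 < t by rewrite subr_gt0 lam_gt1.
  have [N hN] := real_archi ((M / m) *+ k) t0; exists N.
  apply: lt_le_trans hN _.
  rewrite (_ : lam = 1 + t); last by rewrite addrC subrK.
  elim: N => [|N ih]; first by rewrite mulr0n expr0.
  rewrite mulrS exprS mulrDl mul1r addrC lerD //.
  by rewrite ler_peMr ?exprn_ege1 ?lerDl ?(ltW t0).
exists N => n a Nn; have /andP[_ h] := size_subst_iter_bounds n a hm hM.
have : M *+ k < M *+ size (subst_iter phi n a).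
  apply: lt_le_trans h.
  apply: lt_le_trans (_ : lam ^+ N * m <= _).
    by rewrite -ltr_pdivrMr // mulrnAl.
  apply: ler_pM => //; first by rewrite exprn_ge0 // ltW // lam_gt0.
    exact: ltW.
  by rewrite ler_eXn2l // lam_gt1.
by move=> h'; rewrite leqNgt; apply/negP => /ltnW h''; move: h'; rewrite ltNge ler_pMn2l ?h''.
Qed.

Lemma allowed_pairs_in_iter : exists n0, forall n c (e : 'I_d * 'I_d), (n0 <= n)%N ->
  e \in S_edges phi -> infix [:: e.1; e.2] (subst_iter phi n c).
Proof.
have [N hN] := phi_primitive.
have /choice[f hf] : forall e : 'I_d * 'I_d, exists ni, e \in S_edges phi ->
    infix [:: e.1; e.2] (subst_iter phi ni.1 ni.2).
  move=> e; case: (boolP (e \in S_edges phi)) => he; last by exists (0%N, e.1).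
  by move: he; rewrite inE => /asboolP/allowedP[n [i h]]; exists (n, i).
exists (\max_e (f e).1 + N)%N => n c e hn he.
apply: infix_trans (hf e he) _.
have h1 : ((f e).1 <= \max_e (f e).1)%N by apply: leq_bigmax.
rewrite -(@subnKC (f e).1 n); last by lia.
by apply: infix_subst_iter; apply: hN; lia.
Qed.

(** The window starts inside a block of phi^n of length at most [B], and the following block still
    fits in it. *)
Lemma block_in_window n x i B : allowed_biinf phi x ->
  (forall a, (size (subst_iter phi n a) <= B)%N) ->
  exists c, infix (subst_iter phi n c) (word_factor x i (B + B)).
Proof.
move=> hx hB; have [y [k [hy ex]]] := desubstitution_spow n hx.
have [a [j [hj e]]] := wpos_locate (spow phi n) y (i + k).
exists (y (a + 1)).
rewrite -[subst_iter _ _ _]/(spow phi n (y (a + 1))) -(wsub_block (spow phi n) y (a + 1)).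
rewrite (_ : word_factor x _ _ = word_factor (wsub (spow phi n) y) (i + k) (B + B)); last first.
  by rewrite ex; apply: eq_word_factor => t _; rewrite /wshift; congr wsub; lia.
apply: word_factor_infix; rewrite wposS e; first by lia.
have := hB (y a); have := hB (y (a + 1)).
rewrite -/(spow phi n (y a)) -/(spow phi n (y (a + 1))) /=; lia.
Qed.

Lemma exists_allowed_pair e : e \in S_edges phi ->
  exists x, [/\ allowed_biinf phi x, x (- 1) = e.1 & x 0 = e.2].
Proof.
move=> he; have [n hn] := allowed_pairs_in_iter.
have [w [[hw _] _]] := phi_aperiodic.
have hw' := allowed_spow (n := n) hw.
have := hn n (w 0) e (leqnn n) he.
rewrite -[subst_iter _ _ _]/(spow phi n (w 0)) -(wsub_block (spow phi n) w 0).
move=> /infix_word_factor[l [_ _ /= [e1 e2]]].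
exists (wshift (l + 1) (wsub (spow phi n) w)); split; first exact: allowed_shift.
  by rewrite e1 /wshift; congr wsub; lia.
by rewrite e2 /wshift; congr wsub; lia.
Qed.

Lemma exists_allowed_letter a : exists x, allowed_biinf phi x /\ x 0 = a.
Proof.
have [N hN] := phi_primitive; have [w [[hw _] _]] := phi_aperiodic.
have hw' := allowed_spow (n := N) hw; have := hN N (leqnn N) (w 0) a.
rewrite -[subst_iter _ _ _]/(spow phi N (w 0)) -(wsub_block (spow phi N) w 0).
move=> /(nthP a)[l]; rewrite size_word_factor => hl; rewrite nth_word_factor // => <-.
exists (wshift (0 + l%:Z) (wsub (spow phi N) w)); split; first exact: allowed_shift.
by rewrite /wshift wpos0 add0r.
Qed.

(** The factor uses at least one letter of the block where it starts, and the next block has room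
    for the other m letters. *)
Lemma factor_in_pair_block n z t m : allowed_biinf phi z ->
  (forall a, m <= size (subst_iter phi n a))%N ->
  exists2 e, e \in S_edges phi &
    infix (word_factor z t m.+1) (iter n (subst_ext phi) [:: e.1; e.2]).
Proof.
move=> hz good_n; have [z' [k [hz' ez]]] := desubstitution_spow n hz.
have [a [j [hj e]]] := wpos_locate (spow phi n) z' (t + k).
exists (z' a, z' (a + 1)).
  rewrite inE; apply/asboolP; have := hz' a 2; rewrite /word_factor /mkseq /=.
  by rewrite addr0.
have [hs hf] := wsub_word_factor (spow phi n) z' a 2.
have ee : subst_ext (spow phi n) (word_factor z' a 2)
    = iter n (subst_ext phi) [:: z' a; z' (a + 1)].
  rewrite /subst_ext /word_factor /mkseq /= addr0 cats0 /subst_iter.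
  have ic q u v : iter q (subst_ext phi) (u ++ v)
      = iter q (subst_ext phi) u ++ iter q (subst_ext phi) v.
    by elim: q => //= q ->; rewrite subst_ext_cat.
  by rewrite -ic.
rewrite -ee -hf (_ : word_factor z t _ = word_factor (wsub (spow phi n) z') (t + k) m.+1).
  apply: word_factor_infix; first by lia.
  rewrite hs (_ : a + 2%:Z = a + 1 + 1); last by lia.
  rewrite !wposS e; have := good_n (z' (a + 1)).
  by rewrite -[subst_iter _ _ _]/(spow phi n (z' (a + 1))); move: hj; clear; lia.
by rewrite ez; apply: eq_word_factor => q _; rewrite /wshift; congr wsub; rewrite addrAC.
Qed.

(* A long power u^K contained in an allowed word, with K large compared with  *)
(* the ratios of tile lengths, contains every allowed word of length |u| + 1, *)
(* so that all allowed bi-infinite words have period |u|.                     *)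
Lemma no_long_powers : exists K : nat, forall x (m : nat) i, allowed_biinf phi x ->
  (0 < m)%N -> (forall j : nat, (j < K * m)%N -> x (i + j%:Z + m%:Z) = x (i + j%:Z)) ->
  False.
Proof.
have [n0 hn0] := allowed_pairs_in_iter.
have [om_m [om_M [m0 M0 hm hM]]] := finite_bounds om_gt0.
have [l0 l1] := (lam_gt0, lam_gt1).
(* C m will bound the blocks of phi^(n + n0), with [C] independent of m; since K > 2 C, a power of
   exponent K has room for two such lengths, hence for a full block. *)
pose C := lam ^+ n0 * (1 + lam * om_M / om_m) * om_M / om_m.
have C0 : 0 <= C.
  rewrite /C; do ?[apply: mulr_ge0 || apply: addr_ge0 || apply: exprn_ge0];
    rewrite ?invr_ge0 ?ltW //.
have [K hK] := real_archi (2 * C) (@ltr01 R).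
exists K => x m i hx mgt0 hper.
pose good n := [forall a, m <= size (subst_iter phi n a)]%N.
have exgood : exists n, good n.
  by have [N hN] := subst_iter_grows m; exists N; apply/forallP => a; apply: hN.
(* Minimality of [n] keeps lam^n of order m: some block of phi^(n - 1) is shorter than m. The
   summand 1 in the next bound covers n = 0. *)
case: (ex_minnP exgood) => n /forallP good_n min_n.
have lamn : lam ^+ n <= (1 + lam * om_M / om_m) *+ m.
  case: n => [|n] in good_n min_n *.
    rewrite expr0; apply: le_trans (_ : 1 *+ m <= _); first by rewrite ler1n.
    rewrite lerMn2r lerDl; apply/orP; right.
    by rewrite divr_ge0 ?mulr_ge0 // ltW.
  have : ~~ good n by apply/negP => /min_n; rewrite ltnn.
  rewrite negb_forall => /existsP[a]; rewrite -ltnNge => ha.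
  have /andP[_ h] := size_subst_iter_bounds n a hm hM.
  apply: le_trans (_ : (lam * om_M / om_m) *+ m <= _); last first.
    by rewrite lerMn2r lerDr ler01 orbT.
  rewrite exprS -!mulrA -!mulrnAr; apply: ler_wpM2l; first exact: ltW.
  rewrite mulrnAr -mulrnAl ler_pdivlMr //.
  apply: le_trans (_ : lam ^+ n * om a <= _).
    by rewrite ler_wpM2l // exprn_ge0 // ltW.
  by apply: le_trans h _; rewrite ler_pMn2l // ltnW.
pose B := (\max_a size (subst_iter phi (n + n0) a))%N.
have hB : (B + B <= K * m)%N.
  have B1 a : (size (subst_iter phi (n + n0) a))%:R <= C *+ m.
    have /andP[h _] := size_subst_iter_bounds (n + n0) a hm hM.
    rewrite -mulr_natr mulrC in h.
    have {}h : (size (subst_iter phi (n + n0) a))%:R <= lam ^+ (n + n0) * om a / om_m.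
      by rewrite ler_pdivlMr.
    apply: le_trans h _; rewrite exprD.
    rewrite (_ : C *+ m = (lam ^+ n0 * ((1 + lam * om_M / om_m) *+ m)) * (om_M / om_m)).
      rewrite (mulrC (lam ^+ n)) -mulrA -(mulrA _ _ (om a / om_m)) -(mulrA (lam ^+ n0)).
      apply: ler_wpM2l; first by rewrite exprn_ge0 // ltW.
      apply: ler_pM => //; first by rewrite exprn_ge0 // ltW.
        by rewrite divr_ge0 // ltW.
      by rewrite ler_wpM2r // invr_ge0 ltW.
    by rewrite -[C *+ m]mulr_natr -[(1 + _) *+ m]mulr_natr /C; ring.
  have B2 : B%:R <= C *+ m.
    rewrite /B; elim/big_ind: _ => [|u v hu hv|a _]; first by rewrite mulrn_wge0.
      by rewrite /maxn; case: ifP.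
    exact: B1.
  rewrite -(ler_nat R) natrD natrM.
  apply: le_trans (_ : 2 * C * m%:R <= _).
    by rewrite -mulrA mulr_natr mulr2n mulrDl !mul1r lerD.
  by rewrite ler_wpM2r // ltW.
have [c hc] := block_in_window i hx (fun a => leq_bigmax (F := fun a => size (subst_iter phi (n + n0) a)) a).
rewrite -/B in hc.
(* Any factor of length m + 1 of any allowed word lies in phi^n of an allowed pair, hence in phi^(n
   + n0)(c), hence in the periodic window of [x]. *)
have per z t : allowed_biinf phi z -> z (t + m%:Z) = z t.
  move=> hz; have [e he h1] := factor_in_pair_block t hz good_n.
  have h2 := hn0 n0 c _ (leqnn n0) he.
  have {}h2 := iter_subst_ext_infix phi n h2.
  rewrite -iterD -[iter _ _ [:: c]]/(subst_iter phi (n + n0) c) in h2.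
  have [l []] := infix_word_factor (infix_trans (infix_trans h1 h2) hc).
  rewrite size_word_factor => l1' l2 /word_factor_eq hl.
  have := hl m (leqnn _); have := hl 0%N (ltn0Sn _); rewrite !addr0 => -> ->.
  have [j [jB ->]] : exists j : nat, (j < B + B)%N /\ l = i + j%:Z.
    by move: l1' l2; clear; exists `|(l - i)%R|%N; lia.
  by apply: hper; apply: leq_trans hB.
have [w [[hw _] nper]] := phi_aperiodic.
by apply: nper; exists m%:Z; split; [lia | move=> t; apply: per].
Qed.

End Primitive.

(** * Recognizability *)

Section Recognizability.
Variables (R : realType) (d : nat) (phi : substitution d) (om : 'I_d -> R) (lam : R).
Hypotheses (phi_primitive : primitive phi) (phi_aperiodic : aperiodic phi).
Hypothesis om_gt0 : forall a, 0 < om a.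
Hypothesis om_eigen : forall a, \sum_(b <- phi a) om b = lam * om a.
Implicit Types (x y z : int -> 'I_d) (v : R).
Local Notation tpos := (tpos om).
Local Notation allowed_biinf := (allowed_biinf phi).

Lemma tpos_locate x v : exists i, tpos x i <= v < tpos x (i + 1).
Proof.
have [m [_ [m0 _ hm _]]] := finite_bounds om_gt0.
by apply: (@cum_locate _ _ m) => // z; apply: real_archi.
Qed.

Definition tile_at x v : int := xget 0 [set i | tpos x i <= v < tpos x (i + 1)].

Lemma tile_atP x v : tpos x (tile_at x v) <= v < tpos x (tile_at x v + 1).
Proof.
by rewrite /tile_at; case: xgetP => [i _ //|no]; have [i /no] := tpos_locate x v.
Qed.

(* The bi-infinite word x, placed on the line with its tile 0 starting at 0,  *)
(* is encoded by the function giving at each point the label of the tile      *)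
(* there and the offset inside that tile.                                     *)
Definition state x v : 'I_d * R := (x (tile_at x v), v - tpos x (tile_at x v)).

Lemma tile_at_eq x v i : tpos x i <= v < tpos x (i + 1) -> tile_at x v = i.
Proof. by move=> h; apply: cum_locate_unique (tile_atP x v) h => j. Qed.

Lemma stateE x v i : tpos x i <= v < tpos x (i + 1) -> state x v = (x i, v - tpos x i).
Proof. by move=> h; rewrite /state (tile_at_eq h). Qed.

Lemma state_tpos x i : state x (tpos x i) = (x i, 0).
Proof. by rewrite (@stateE _ _ i) ?subrr // tposS lexx ltrDl om_gt0. Qed.

Lemma state_shift k x v : state (wshift k x) v = state x (v + tpos x k).
Proof.
have h := tile_atP (wshift k x) v.
rewrite (stateE h); rewrite !tpos_shift in h *; rewrite addrAC in h.
rewrite (@stateE x _ (tile_at (wshift k x) v + k)); last first.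
  by rewrite -lerBlDr -ltrBrDr.
by rewrite /wshift opprB addrA addrAC.
Qed.

Lemma agree_tpos a b x y : a <= 0 <= b -> agree_on a b x y ->
  forall i, a <= i <= b -> tpos x i = tpos y i.
Proof. by move=> ab e i; apply: eq_cum_on ab _ => j /e ->. Qed.

Lemma agree_state a b x y v : a <= 0 <= b -> agree_on a b x y ->
  tpos x a <= v < tpos x b -> state x v = state y v.
Proof.
move=> ab e /andP[va vb]; have /andP[h1 h2] := tile_atP x v.
have := le_lt_trans va h2; have := le_lt_trans h1 vb; rewrite !tpos_lt // => ib ai.
have hr : a <= tile_at x v < b by move: ib ai; clear; lia.
have hr' : a <= tile_at x v <= b by move: ib ai; clear; lia.
have hr'' : a <= tile_at x v + 1 <= b by move: ib ai; clear; lia.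
rewrite [RHS](@stateE y v (tile_at x v)); last first.
  by rewrite -!(agree_tpos ab e) // h1 h2.
by rewrite /state e // (agree_tpos ab e).
Qed.

(** The action of phi on states ([state_wsub]). Only the block of the current letter is looked at,
    so it can be computed on a constant word. *)
Definition inflate (s : 'I_d * R) : 'I_d * R := state (wsub phi (fun _ => s.1)) (lam * s.2).

Lemma state_wsub x v : state (wsub phi x) (lam * v) = inflate (state x v).
Proof.
have /andP[h1 h2] := tile_atP x v.
have l0 := lam_gt0 phi_aperiodic om_gt0 om_eigen.
rewrite /inflate [state x v]/state /=; set i := tile_at x v in h1 h2 *.
rewrite (_ : lam * v = lam * (v - tpos x i) + tpos (wsub phi x) (wpos phi x i)); last first.
  by rewrite (tpos_sub om_eigen) mulrBr subrK.
rewrite -state_shift -wsub_shift.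
have e0 : agree_on 0 1 (wshift i x) (fun _ => x i).
  by move=> j hj; rewrite /wshift (_ : j = 0) ?add0r //; lia.
have h01 : (0 : int) <= 0 <= (1 : int) by [].
have h01' : wpos phi (wshift i x) 0 <= 0 <= wpos phi (wshift i x) 1 by rewrite wpos0 wpos1 lexx lez_nat.
apply: agree_state h01' (agree_wsub h01 e0) _.
rewrite !(tpos_sub om_eigen) tpos0 mulr0 mulr_ge0 ?subr_ge0 ?(ltW l0) //=.
by rewrite ltr_pM2l // big_ord1 /wshift add0r ltrBlDl -tposS.
Qed.

Lemma state_iter n x v :
  state (iter n (wsub phi) x) (lam ^+ n * v) = iter n inflate (state x v).
Proof.
elim: n v => [|n ih] v; first by rewrite mul1r.
by rewrite /= exprS -mulrA state_wsub ih.
Qed.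

Lemma state_inj x y : (forall v, state x v = state y v) -> x = y.
Proof.
move=> h; have ht i : tpos x i = tpos y i.
  elim/int_step_ind: i => [|i ih|i ih]; first by rewrite !tpos0.
    by have := h (tpos x i); rewrite {2}ih !state_tpos !tposS ih => -[->].
  (* Whichever of the two left endpoints is larger, this point lies in tile [i] of both words. *)
  pose v := Num.max (tpos x i) (tpos y i).
  have hx : tpos x i <= v < tpos x (i + 1).
    by rewrite le_max lexx gt_max {2}ih !tpos_lt // ltrDl.
  have hy : tpos y i <= v < tpos y (i + 1).
    by rewrite le_max lexx orbT gt_max -{1}ih !tpos_lt // ltrDl.
  by have := h v; rewrite (stateE hx) (stateE hy) => -[_ /addrI/oppr_inj].
by apply/funext => i; have := h (tpos x i); rewrite {2}ht !state_tpos => -[].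
Qed.

(** A local period v > 0 carries tile starts to tile starts. If it moves the first start in range by
    q tiles, it moves the following ones by q tiles too, so the word has period q along K q letters,
    against [no_long_powers]. *)
Lemma no_short_periods : exists c : R, 0 < c /\ forall x v r t, allowed_biinf x ->
  `|v| < c * r -> (forall w, `|w| <= r -> state x (t + w) = state x (t + w + v)) ->
  v = 0.
Proof.
have [m [M [m0 M0 hm hM]]] := finite_bounds om_gt0.
have [K hK] := no_long_powers phi_primitive phi_aperiodic om_gt0 om_eigen.
(* The q tiles spanning v have length at least [m] each, and K q tiles have length at most [M] each;
   v < c r makes the latter fit within radius r. *)
pose c := m / (M * K.+1%:R); have c0 : 0 < c by rewrite divr_gt0 // mulr_gt0.
exists c; split=> //.
suff main x v r t : allowed_biinf x -> 0 < v -> v < c * r ->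
    (forall w, `|w| <= r -> state x (t + w) = state x (t + w + v)) -> False.
  move=> x v r t hx hv h; have [v0|v0|//] := ltgtP v 0; last first.
    by case: (main x v r t hx v0 (le_lt_trans (ler_norm _) hv) h).
  case: (main x (- v) r (t + v) hx); rewrite ?oppr_gt0 //.
    by apply: le_lt_trans hv; rewrite -normrN ler_norm.
  by move=> w /h e; rewrite addrAC -e; congr state; ring.
move=> hx v0 hv h; have r0 : 0 < r by rewrite -(pmulr_rgt0 _ c0) (lt_trans v0).
pose i := tile_at x (t - r) + 1; have /andP[h1 h2] := tile_atP x (t - r).
have hstep j : t - r <= tpos x j <= t + r ->
    exists j', tpos x j' = tpos x j + v /\ x j' = x j.
  move=> hj; have := h (tpos x j - t); rewrite [t + _]addrC subrK => e.
  have {}e : state x (tpos x j) = state x (tpos x j + v).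
    by apply: e; rewrite ler_norml; apply/andP; split; lra.
  exists (tile_at x (tpos x j + v)); move: e; rewrite state_tpos /state => -[-> e].
  by split=> //; apply/eqP; rewrite eq_sym -subr_eq0 -e.
have hi1 : tpos x i <= t - r + M by rewrite tposS lerD.
have vm : v * (M * K.+1%:R) < m * r.
  by rewrite -ltr_pdivlMr ?mulr_gt0 // mulrAC.
have mv : m <= v.
  have := h 0; rewrite normr0 addr0 => /(_ (ltW r0)) [_ e].
  have {}e : tpos x (tile_at x (t + v)) = tpos x (tile_at x t) + v.
    by move: e; lra.
  have : tile_at x t < tile_at x (t + v) by rewrite -(tpos_lt om_gt0 x) e ltrDl.
  rewrite -lezD1 -(tpos_le om_gt0 x) tposS e lerD2l => h3.
  exact: le_trans (hm _) h3.
have hMr : M < r.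
  rewrite -(ltr_pM2l m0); apply: le_lt_trans vm; apply: ler_pM; rewrite ?(ltW m0) ?(ltW M0) //.
  by rewrite ler_peMr ?(ltW M0) // ler1n.
have hrange (q : nat) j : (j < K * q)%N -> m * q%:R <= v ->
    t - r <= tpos x (i + j%:Z) <= t + r.
  move=> jq mq.
  have hu : tpos x (i + j%:Z) <= t - r + M + M * j%:R.
    have := @cum_upper _ (fun i => om (x i)) M i j (fun i => hM (x i)).
    by rewrite -/(tpos x) -mulr_natr; move: hi1; lra.
  have hl : tpos x i <= tpos x (i + j%:Z) by rewrite tpos_le // lerDl.
  have hMj : M * j%:R + M <= r.
    rewrite -[X in _ + X]mulr1 -mulrDr natr1.
    rewrite -(ler_pM2l m0); apply: le_trans (ltW vm).
    apply: le_trans (_ : m * (M * (K * q)%:R) <= _).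
      by rewrite !ler_pM2l // ler_nat.
    rewrite natrM (_ : m * (M * (K%:R * q%:R)) = (m * q%:R) * (M * K%:R)); last by ring.
    apply: ler_pM; rewrite ?mulr_ge0 ?(ltW M0) ?(ltW m0) //.
    by rewrite ler_pM2l // ler_nat.
  by move: hu hl hMj h2; rewrite -/i => *; apply/andP; split; lra.
have hi0 : t - r <= tpos x i <= t + r.
  by move: hi1 h2 hMr r0; rewrite -/i => *; apply/andP; split; lra.
have [j1 [hj1 xj1]] := hstep i hi0.
have ij1 : i < j1 by rewrite -(tpos_lt om_gt0 x) hj1 ltrDl.
have [q q0 ej1] := int_lt_addP ij1.
rewrite {}ej1 in hj1 xj1.
have hq : m * q%:R <= v.
  have := @cum_lower _ (fun i => om (x i)) m i q (fun i => hm (x i)).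
  by rewrite -/(tpos x) -mulr_natr hj1; lra.
apply: (hK x q i hx q0).
suff hall j : (j < K * q)%N -> tpos x (i + j%:Z + q%:Z) = tpos x (i + j%:Z) + v /\
    x (i + j%:Z + q%:Z) = x (i + j%:Z) by move=> j /hall[].
elim: j => [_|j ih hj]; first by rewrite addr0.
have [ih1 ih2] := ih (ltnW hj).
have ea : i + j.+1%:Z = i + j%:Z + 1 by rewrite -addn1 PoszD addrA.
have et : tpos x (i + j.+1%:Z + q%:Z) = tpos x (i + j.+1%:Z) + v.
  by rewrite ea addrAC !tposS ih1 ih2 addrAC.
split=> //; have [j' [hj' <-]] := hstep _ (hrange _ _ hj hq).
by congr x; apply: (cum_inj (w := fun i => om (x i))) => //; rewrite -/(tpos x) et hj'.
Qed.

(** An n-fold desubstitution recentred so that [v0] corresponds to the point at offset [a] in tile 0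
    of [A]; a bounded window of [A] then governs a neighbourhood of that point. *)
Lemma inflate_preimage n x v0 : allowed_biinf x ->
  exists A a, [/\ allowed_biinf A, 0 <= a < om (A 0) &
    forall v, state x (lam ^+ n * v + v0) = iter n inflate (state A (v + a))].
Proof.
have l0 := lam_gt0 phi_aperiodic om_gt0 om_eigen.
move=> hx; have [z [k [hz ->]]] := desubstitution_spow n hx.
pose b := (v0 + tpos (wsub (spow phi n) z) k) / lam ^+ n.
have /andP[h1 h2] := tile_atP z b.
exists (wshift (tile_at z b) z), (b - tpos z (tile_at z b)); split.
- exact: allowed_shift.
- by rewrite subr_ge0 h1 ltrBlDl /wshift add0r -tposS.
- move=> v; rewrite !state_shift // addrA subrK.
  rewrite -state_iter -wsub_spow mulrDr.
  congr state; rewrite /b [_ / _]mulrC mulrA mulfV ?mul1r ?addrA //.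
  by rewrite expf_neq0 // gt_eqF.
Qed.

Definition window n x : {ffun 'I_(n + n) -> 'I_d} := [ffun j : 'I_(n + n) => x (j%:Z - n%:Z)].

Lemma window_eq n x y : window n x = window n y -> agree_on (- n%:Z) n%:Z x y.
Proof.
move=> e i hi; have hj : (`|(i + n%:Z)%R| < n + n)%N by lia.
have := congr1 (fun f : {ffun 'I_(n + n) -> 'I_d} => f (Ordinal hj)) e.
rewrite !ffunE /= (_ : _ - _ = i) //; lia.
Qed.

Lemma window_state m n x y v : (forall a, m <= om a) -> `|v| < m * n%:R ->
  window n x = window n y -> state x v = state y v.
Proof.
move=> hm; rewrite ltr_norml => /andP[v1 v2] /window_eq e.
have h0 : - n%:Z <= 0 <= n%:Z by lia.
apply: (agree_state h0 e).
have := @cum_lower _ (fun i => om (x i)) m (- n%:Z) n (fun i => hm (x i)).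
have := @cum_lower _ (fun i => om (x i)) m 0 n (fun i => hm (x i)).
rewrite -/(tpos x) addNr add0r tpos0 -mulr_natr subr0 sub0r => h1 h2.
by rewrite (lt_le_trans v2 h1) andbT ltW // -ltrN2 (lt_le_trans _ h2) // ltrNl.
Qed.

Lemma pigeonhole_nat (T : finType) (f : nat -> T) : exists p q, (p < q)%N /\ f p = f q.
Proof.
have fT : frequently (fun _ => True) by move=> M; exists M.
have [a ha] := frequently_and_eq f fT.
have [p _ [_ hp]] := ha 0%N; have [q pq [_ hq]] := ha p.+1.
by exists p, q; rewrite hp hq.
Qed.

(* If the images of two tilings agree, take p-fold preimages near a point for *)
(* every p; for two values p < q these have the same local structure up to    *)
(* small translations e, e'.  Comparing the two resulting descriptions of the *)
(* common image on a large interval, absence of short periods gives e = e',   *)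
(* so near that point both tilings are translates by the same amount of       *)
(* (q-p)-fold images, which agree as already one-fold images do.              *)
Lemma state_wsub_inj x y u : allowed_biinf x -> allowed_biinf y ->
  (forall v, state (wsub phi x) v = state (wsub phi y) (v + lam * u)) ->
  forall v, state x v = state y (v + u).
Proof.
move=> hx hy hxy v0.
have l0 := lam_gt0 phi_aperiodic om_gt0 om_eigen.
have [c [c0 hc]] := no_short_periods.
have [m [M [m0 M0 hm hM]]] := finite_bounds om_gt0.
have /choice[A /choice[a hA]] := fun n => inflate_preimage n v0 hx.
have /choice[B /choice[b hB]] := fun n => inflate_preimage n (v0 + u) hy.
(* Offsets in a common bin differ by less than [eps], so that |e' - e| < 2 eps = c, the threshold of
   [no_short_periods]. *)
pose eps := c / 2; have eps0 : 0 < eps by rewrite divr_gt0.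
have [nb hnb] := real_archi (M / eps) (@ltr01 R).
(* A window of radius [n] determines the states within distance M + 1 of 0: an offset of at most [M]
   plus a displacement of at most 1. *)
have [n hn] := real_archi (M + 1) m0.
have binP (t s : R) : 0 <= t < s -> s <= M -> (Num.truncn (t / eps) < nb.+1)%N.
  move=> /andP[t0 ts] sM; rewrite ltnS.
  have hte : 0 <= t / eps by rewrite divr_ge0 // ltW.
  rewrite -(ler_nat R); apply: le_trans (ltW hnb).
  apply: le_trans (_ : t / eps <= _); first by have /andP[] := truncn_itv hte.
  by rewrite ler_pM2r ?invr_gt0 // (le_trans (ltW ts)).
have binA p : (Num.truncn (a p / eps) < nb.+1)%N.
  by have [_ h _] := hA p; apply: binP h (hM _).
have binB p : (Num.truncn (b p / eps) < nb.+1)%N.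
  by have [_ h _] := hB p; apply: binP h (hM _).
have bin_close (s t : R) : 0 <= s -> 0 <= t ->
    Num.truncn (s / eps) = Num.truncn (t / eps) -> `|s - t| < eps.
  move=> s0 t0 e.
  have /andP[h1 h2] : (Num.truncn (s / eps))%:R <= s / eps < (Num.truncn (s / eps)).+1%:R.
    by apply: truncn_itv; rewrite divr_ge0 // ltW.
  have /andP[h3 h4] : (Num.truncn (t / eps))%:R <= t / eps < (Num.truncn (t / eps)).+1%:R.
    by apply: truncn_itv; rewrite divr_ge0 // ltW.
  rewrite -[eps]mul1r -ltr_pdivrMr // -{1}(gtr0_norm eps0) -normf_div mulrBl.
  rewrite -natr1 e in h1 h2; rewrite -natr1 in h4.
  by rewrite ltr_norml; apply/andP; split; lra.
pose data p := (window n (A p), window n (B p), Ordinal (binA p), Ordinal (binB p)).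
have [p [q [pq [eA eB /bin_close ea /bin_close eb]]]] := pigeonhole_nat data.
have [hAp /andP[ap0 apM] sAp] := hA p; have [hAq /andP[aq0 aqM] sAq] := hA q.
have [hBp /andP[bp0 bpM] sBp] := hB p; have [hBq /andP[bq0 bqM] sBq] := hB q.
have {}ea := ea ap0 aq0; have {}eb := eb bp0 bq0.
have near (X Y : int -> 'I_d) v t s : window n X = window n Y -> `|v| <= 1 -> 0 <= t < s -> s <= M ->
    state Y (v + t) = state X (v + t).
  move=> e v1 /andP[t0 ts] sM; apply: (window_state hm) (esym e).
  rewrite mulr_natr; apply: le_lt_trans hn; apply: le_trans (ler_normD _ _) _.
  by rewrite addrC lerD // ger0_norm // (le_trans (ltW ts)).
have nearA v : `|v| <= 1 -> state (A q) (v + a q) = state (A p) (v + (a q - a p) + a p).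
  move=> v1; rewrite addrA subrK; apply: near eA v1 _ (hM (A q 0)).
  by rewrite aq0.
have nearB v : `|v| <= 1 -> state (B q) (v + b q) = state (B p) (v + (b q - b p) + b p).
  move=> v1; rewrite addrA subrK; apply: near eB v1 _ (hM (B q 0)).
  by rewrite bq0.
set e := a q - a p in nearA; set e' := b q - b p in nearB.
have [r er] : exists r, q = (r.+1 + p)%N
  by exists (q - p).-1; rewrite prednK ?subn_gt0 // subnK // ltnW.
have xq v : `|v| <= 1 -> state x (lam ^+ q * v + v0)
    = iter r.+1 inflate (state x (lam ^+ p * (v + e) + v0)).
  by move=> v1; rewrite sAq nearA // sAp -iterD -er.
have yq v : `|v| <= 1 -> state y (lam ^+ q * v + (v0 + u))
    = iter r.+1 inflate (state y (lam ^+ p * (v + e') + (v0 + u))).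
  by move=> v1; rewrite sBq nearB // sBp -iterD -er.
have infl_xy v : inflate (state y (v + u)) = inflate (state x v).
  by rewrite -!state_wsub hxy mulrDr.
have ee : e = e'.
  have L0 : 0 < lam ^+ q.+1 by rewrite exprn_gt0.
  (* The descriptions of [x] and [y] are pushed to this common image, where [infl_xy] replaces [y]
     by [x]; comparing them gives the period lam^(q+1) (e' - e) on an interval of radius
     lam^(q+1). *)
  pose Y := iter r.+2 (wsub phi) x; pose t0 := lam ^+ r.+2 * v0 + lam ^+ q.+1 * e.
  have hY : allowed_biinf Y.
    by rewrite /Y -wsub_spow; apply: allowed_spow.
  have eY w : `|w| <= 1 ->
      state Y (t0 + lam ^+ q.+1 * w) = state Y (t0 + lam ^+ q.+1 * w + lam ^+ q.+1 * (e' - e)).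
    move=> w1.
    have e1 f : lam ^+ r.+2 * (lam ^+ p * (w + f) + v0)
        = lam ^+ r.+2 * v0 + lam ^+ q.+1 * (w + f).
      by rewrite mulrDr mulrA -exprD addSn -er [LHS]addrC.
    have : inflate (state x (lam ^+ q * w + v0)) = inflate (state y (lam ^+ q * w + v0 + u)).
      by rewrite infl_xy.
    have itS s : inflate (iter r.+1 inflate s) = iter r.+1 inflate (inflate s).
      by rewrite -iterS iterSr.
    rewrite (xq _ w1) -addrA (yq _ w1).
    rewrite (itS (state y _)).
    rewrite [_ + (v0 + u)]addrA infl_xy.
    have imgY s : inflate (iter r.+1 inflate (state x s)) = state Y (lam ^+ r.+2 * s).
      by rewrite -iterS -state_iter.
    rewrite -(itS (state x (lam ^+ p * (w + e') + v0))) !imgY.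
    rewrite (e1 e) (e1 e') => e2.
    rewrite (_ : t0 + _ = lam ^+ r.+2 * v0 + lam ^+ q.+1 * (w + e)); last first.
      by rewrite /t0; ring.
    by rewrite e2; congr state; ring.
  have := hc Y (lam ^+ q.+1 * (e' - e)) (lam ^+ q.+1) t0 hY.
  rewrite normrM (gtr0_norm L0) mulrC ltr_pM2r // => h.
  suff /eqP : lam ^+ q.+1 * (e' - e) = 0.
    by rewrite mulf_eq0 gt_eqF //= subr_eq0 => /eqP ->.
  apply: h.
    have : `|e' - e| < eps + eps.
      apply: le_lt_trans (ler_normB _ _) _.
      by rewrite ltrD // distrC.
    by rewrite -mulr2n -mulr_natr /eps divfK.
  move=> w hw; have := eY (w / lam ^+ q.+1); rewrite mulrCA mulfV ?gt_eqF // mulr1.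
  by apply; rewrite normf_div (gtr0_norm L0) ler_pdivrMr // mul1r.
have h0 : `|0 : R| <= 1 by rewrite normr0.
have := xq 0 h0; have := yq 0 h0; rewrite mulr0 !add0r => -> ->.
by rewrite 2!iterSr [_ + (v0 + u)]addrA infl_xy ee.
Qed.

(** By [state_wsub_inj], [y] and [y'] differ by the translation (s' - s) / lam. It takes the point s
    / lam of tile 0 of [y] to the point s' / lam of tile 0 of [y']; equal offsets in these tiles
    give s = s'. *)
Lemma recognizable y y' (k k' : nat) : allowed_biinf y -> allowed_biinf y' ->
  (k < size (phi (y 0)))%N -> (k' < size (phi (y' 0)))%N ->
  wshift k%:Z (wsub phi y) = wshift k'%:Z (wsub phi y') -> y = y' /\ k = k'.
Proof.
move=> hy hy' hk hk' e.
have l0 := lam_gt0 phi_aperiodic om_gt0 om_eigen.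
pose s := tpos (wsub phi y) k%:Z; pose s' := tpos (wsub phi y') k'%:Z.
have sb z (j : nat) : (j < size (phi (z 0)))%N -> 0 <= tpos (wsub phi z) j%:Z / lam < om (z 0).
  move=> hj; have h0 := tpos_sub om_eigen z 0; have h1 := tpos_sub om_eigen z 1.
  rewrite wpos0 tpos0 in h0.
  have e1 : tpos z 1 = om (z 0) by rewrite -[1]add0r tposS tpos0 add0r.
  apply/andP; split.
    by rewrite divr_ge0 ?(ltW l0) // -(tpos0 om (wsub phi z)) tpos_le.
  by rewrite ltr_pdivrMr // mulrC -e1 -h1 wpos1 tpos_lt // ltz_nat.
have st v : state (wsub phi y) v = state (wsub phi y') (v + lam * ((s' - s) / lam)).
  rewrite mulrC divfK ?gt_eqF //.
  have := congr1 (fun z => state z (v - s)) e.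
  rewrite !state_shift // -/s -/s' subrK => ->.
  by congr state; ring.
have := state_wsub_inj hy hy' st => st'.
have e1 : tpos y 1 = om (y 0) by rewrite -[1]add0r tposS tpos0 add0r.
have e1' : tpos y' 1 = om (y' 0) by rewrite -[1]add0r tposS tpos0 add0r.
have := st' (s / lam); rewrite -mulrDl addrC subrK.
rewrite (stateE (i := 0)); last by rewrite tpos0 add0r e1 sb.
rewrite (stateE (i := 0)); last by rewrite tpos0 add0r e1' sb.
rewrite !tpos0 !subr0 => -[_ /(mulIf (lt0r_neq0 _))].
rewrite invr_gt0 => /(_ l0) ss.
have yy : y = y'.
  by apply: state_inj => v; rewrite st' ss subrr mul0r addr0.
split=> //; move: ss; rewrite /s /s' yy => /(cum_inj (w := fun i => om (wsub phi y' i))) h.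
by have [] := h (fun _ => om_gt0 _).
Qed.

(* Compactness makes the desubstitution of recognizable continuous. *)
Lemma recognizable_local n : exists N : nat, forall y y' (k k' : nat),
  allowed_biinf y -> allowed_biinf y' ->
  (k < size (phi (y 0)))%N -> (k' < size (phi (y' 0)))%N ->
  agree_on (- N%:Z) N%:Z (wshift k%:Z (wsub phi y)) (wshift k'%:Z (wsub phi y')) ->
  k = k' /\ agree_on (- n%:Z) n%:Z y y'.
Proof.
apply: contrapT => no.
pose bad N (t : (int -> 'I_d) * (int -> 'I_d) * nat * nat) :=
  let: (y, y', k, k') := t in
  [/\ allowed_biinf y, allowed_biinf y', (k < size (phi (y 0)))%N /\ (k' < size (phi (y' 0)))%N,
  agree_on (- N%:Z) N%:Z (wshift k%:Z (wsub phi y)) (wshift k'%:Z (wsub phi y')) &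
  ~ (k = k' /\ agree_on (- n%:Z) n%:Z y y')].
have /choice[t ht] : forall N, exists t, bad N t.
  move=> N; apply: contrapT => h; apply: no; exists N => y y' k k' h1 h2 h3 h4 h5.
  by apply: contrapT => h6; apply: h; exists (y, y', k, k').
have [K hK] := size_subst_bounded phi.
have bk N : ((t N).1.2 < K.+1)%N.
  have := ht N; case: (t N) => [[[y y'] k] k'] [_ _ [h _] _ _] /=.
  by rewrite ltnS (leq_trans (ltnW h)).
have bk' N : ((t N).2 < K.+1)%N.
  have := ht N; case: (t N) => [[[y y'] k] k'] [_ _ [_ h] _ _] /=.
  by rewrite ltnS (leq_trans (ltnW h)).
have [z hz] := frequently_window
  (fun N i => ((t N).1.1.1 i, (t N).1.1.2 i, Ordinal (bk N), Ordinal (bk' N))).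
pose y i := (z i).1.1.1; pose y' i := (z i).1.1.2.
pose k : nat := (z 0).1.2; pose k' : nat := (z 0).2.
have hz' (q : nat) M : exists N Y Y', [/\ (M <= N)%N, bad N (Y, Y', k, k'),
    agree_on (- q.+1%:Z) q.+1%:Z Y y & agree_on (- q.+1%:Z) q.+1%:Z Y' y'].
  have [N MN e] := hz q.+1 M; have := ht N.
  have := e 0 ltac:(lia); rewrite /k /k' => <- /=.
  rewrite (surjective_pairing (t N)) (surjective_pairing (t N).1) (surjective_pairing (t N).1.1) /=.
  move=> hb; exists N, (t N).1.1.1, (t N).1.1.2; split=> // i hi.
    by rewrite /y -e.
  by rewrite /y' -e.
have hy : allowed_biinf y.
  apply: allowed_closed => q; have [N [Y [Y' [_ [h _ _ _ _] e _]]]] := hz' q 0%N.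
  by exists Y => // i hi; apply: e; lia.
have hy' : allowed_biinf y'.
  apply: allowed_closed => q; have [N [Y [Y' [_ [_ h _ _ _] _ e]]]] := hz' q 0%N.
  by exists Y' => // i hi; apply: e; lia.
have [N0 [Y0 [Y0' [_ [_ _ [hk hk'] _ _] e0 e0']]]] := hz' 0%N 0%N.
rewrite e0 // in hk; rewrite e0' // in hk'.
have kK : (k <= K)%N := leq_trans (ltnW hk) (hK _).
have kK' : (k' <= K)%N := leq_trans (ltnW hk') (hK _).
have img Z Z' q j : agree_on (- q.+1%:Z) q.+1%:Z Z Z' -> - q.+1%:Z <= j < q.+1%:Z ->
    wsub phi Z j = wsub phi Z' j.
  move=> e hj; have h0 : - q.+1%:Z <= 0 <= q.+1%:Z by lia.
  apply: (agree_wsub h0 e).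
  have := wpos_grow phi Z 0 q.+1; have := wpos_grow phi Z (- q.+1%:Z) q.+1.
  by rewrite addNr !wpos0 !add0r; move: hj; lia.
have [yy kk] : y = y' /\ k = k'.
  apply: recognizable => //; apply/funext => j.
  have [N [Y [Y' [hN [_ _ _ e _] e1 e2]]]] := hz' (`|j| + K)%N (`|j| + K).+1%N.
  rewrite /wshift -(img Y y (`|j| + K)%N) //; last by lia.
  rewrite -(img Y' y' (`|j| + K)%N) //; last by lia.
  by apply: e; lia.
have [N [Y [Y' [_ [_ _ _ _ h] e1 e2]]]] := hz' n 0%N.
by apply: h; split=> // i hi; rewrite e1 ?e2 ?yy //; lia.
Qed.

(** The continuous inverse of (y, k) |-> shift^k phi(y), in the form needed to invert tower sums. *)
Lemma desubstitution_map : exists (ry : (int -> 'I_d) -> int -> 'I_d) (rk : (int -> 'I_d) -> nat),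
  [/\ forall x, allowed_biinf x -> [/\ allowed_biinf (ry x),
        (rk x < size (phi (ry x 0)))%N & x = wshift (rk x)%:Z (wsub phi (ry x))],
      forall y (k : nat), allowed_biinf y -> (k < size (phi (y 0)))%N ->
        ry (wshift k%:Z (wsub phi y)) = y /\ rk (wshift k%:Z (wsub phi y)) = k &
      forall n : nat, exists N : nat, forall x x', allowed_biinf x -> allowed_biinf x' ->
        agree_on (- N%:Z) N%:Z x x' -> rk x = rk x' /\ agree_on (- n%:Z) n%:Z (ry x) (ry x')].
Proof.
have /choice[r hr] : forall x, exists t : (int -> 'I_d) * nat, allowed_biinf x ->
    [/\ allowed_biinf t.1, (t.2 < size (phi (t.1 0)))%N & x = wshift t.2%:Z (wsub phi t.1)].
  move=> x; have [hx|hx] := pselect (allowed_biinf x).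
    by have [y [k hyk]] := desubstitution hx; exists (y, k).
  by exists (x, 0%N).
exists (fun x => (r x).1), (fun x => (r x).2); split=> //.
- move=> y k hy hk; set x := wshift _ _.
  have hx : allowed_biinf x by apply/allowed_shift/allowed_wsub.
  have [h1 h2 h3] := hr x hx.
  by have [-> ->] := recognizable h1 hy h2 hk (esym h3).
- move=> n; have [N hN] := recognizable_local n.
  exists N => x x' hx hx' e; have [h1 h2 h3] := hr x hx; have [h1' h2' h3'] := hr x' hx'.
  by apply: hN => //; rewrite -h3 -h3'.
Qed.

End Recognizability.

(** * Coinvariants of the subshift *)

Section Coinvariants.
Variables (d : nat) (phi : substitution d).
Local Notation allowed_biinf := (allowed_biinf phi).
Local Notation fn := ((int -> 'I_d) -> int).
Implicit Types (x y z : int -> 'I_d) (f g B : fn).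

(** Continuity of an integer function on the compact subshift, which amounts to a uniform window. *)
Definition loc_const f := exists n : nat, forall x y, allowed_biinf x -> allowed_biinf y ->
  agree_on (- n%:Z) n%:Z x y -> f x = f y.

Definition cohomologous f g := exists2 B, loc_const B &
  forall x, allowed_biinf x -> f x - g x = B (wshift 1 x) - B x.

(** The Birkhoff sum of [f] at psi(x) along the block of x_0. *)
Definition tower_sum (psi : substitution d) f : fn :=
  fun x => cum (fun i => f (wshift i (wsub psi x))) (wpos psi x 1).

Lemma agree_onW (a b a' b' : int) x y : a' <= a -> b <= b' ->
  agree_on a' b' x y -> agree_on a b x y.
Proof. by move=> h1 h2 e i /andP[h3 h4]; apply: e; rewrite (le_trans h1) ?(lt_le_trans h4). Qed.

Lemma loc_constB f g : loc_const f -> loc_const g -> loc_const (fun x => f x - g x).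
Proof.
move=> [n hn] [m hm]; exists (n + m)%N => x y hx hy e.
by rewrite (hn x y) 1?(hm x y) //; apply: agree_onW e; lia.
Qed.

Lemma loc_const_cst (c : int) : loc_const (fun _ => c).
Proof. by exists 0%N. Qed.

Lemma loc_constN f : loc_const f -> loc_const (fun x => - f x).
Proof.
move=> h; have := loc_constB (loc_const_cst 0) h.
by congr loc_const; apply/funext => x; rewrite sub0r.
Qed.

Lemma loc_constD f g : loc_const f -> loc_const g -> loc_const (fun x => f x + g x).
Proof.
move=> h /loc_constN h'; have := loc_constB h h'.
by congr loc_const; apply/funext => x; rewrite opprK.
Qed.

Lemma loc_const_shift f k : loc_const f -> loc_const (fun x => f (wshift k x)).
Proof.
move=> [n hn]; exists (n + `|k|)%N => x y hx hy e; apply: hn; try exact: allowed_shift.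
by move=> i hi; apply: e; lia.
Qed.

Lemma agree_wsub_sym psi n x y : agree_on (- n%:Z) n%:Z x y ->
  agree_on (- n%:Z) n%:Z (wsub psi x) (wsub psi y).
Proof.
move=> e; have h0 : - n%:Z <= 0 <= n%:Z by lia.
apply: agree_onW (agree_wsub h0 e).
  by have := wpos_grow psi x (- n%:Z) n; rewrite addNr wpos0; lia.
by have := wpos_grow psi x 0 n; rewrite !add0r wpos0; lia.
Qed.

Lemma loc_const_sub f N : loc_const f -> loc_const (fun x => f (wsub (spow phi N) x)).
Proof.
move=> [n hn]; exists n => x y hx hy e.
by apply: hn; [exact: allowed_spow|exact: allowed_spow|exact: agree_wsub_sym].
Qed.

Lemma cohomologousxx f : cohomologous f f.
Proof. by exists (fun _ => 0) => [|x _]; [exact: loc_const_cst|rewrite !subrr]. Qed.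

Lemma cohomologousB f g f' g' : cohomologous f g -> cohomologous f' g' ->
  cohomologous (fun x => f x - f' x) (fun x => g x - g' x).
Proof.
move=> [B hB e] [B' hB' e']; exists (fun x => B x - B' x); first exact: loc_constB.
by move=> x hx; have := e x hx; have := e' x hx; lia.
Qed.

Lemma cohomologous_sym f g : cohomologous f g -> cohomologous g f.
Proof.
move=> [B hB e]; exists (fun x => - B x); first exact: loc_constN.
by move=> x hx; have := e x hx; lia.
Qed.

Lemma cohomologous_trans f g h : cohomologous f g -> cohomologous g h -> cohomologous f h.
Proof.
move=> [B hB e] [B' hB' e']; exists (fun x => B x + B' x); first exact: loc_constD.
by move=> x hx; have := e x hx; have := e' x hx; lia.
Qed.

Lemma eq_cohomologous f g : (forall x, allowed_biinf x -> f x = g x) -> cohomologous f g.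
Proof.
move=> e; exists (fun _ => 0); first exact: loc_const_cst.
by move=> x hx; rewrite e // !subrr.
Qed.

Lemma cohomologous0 f : cohomologous f (fun _ => 0) <->
  exists2 B, loc_const B & forall x, allowed_biinf x -> f x = B (wshift 1 x) - B x.
Proof.
by split=> -[B hB e]; exists B => // x hx; have := e x hx; rewrite subr0.
Qed.

Lemma cohomologous_sub0 f g : cohomologous (fun x => f x - g x) (fun _ => 0) <-> cohomologous f g.
Proof.
by split=> -[B hB e]; exists B => // x hx; have := e x hx; rewrite subr0.
Qed.

Lemma cum_coboundary B x k : cum (fun i => B (wshift 1 (wshift i x)) - B (wshift i x)) k
  = B (wshift k x) - B x.
Proof.
rewrite -[in RHS](wshift0 x) wshiftD addr0 -(cum_telescope (fun i => B (wshift i x))).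
by apply: eq_cum => i; rewrite wshiftD [1 + i]addrC.
Qed.

Lemma cum_tower psi f x k :
  cum (fun i => tower_sum psi f (wshift i x)) k
    = cum (fun j => f (wshift j (wsub psi x))) (wpos psi x k).
Proof.
apply/esym; move: k; apply: (cum_unique (F := fun k => cum _ (wpos psi x k))) => [|k].
  by rewrite wpos0 cum0.
rewrite /tower_sum wsub_shift wpos_shift [1 + k]addrC.
rewrite [X in _ = _ + X](eq_cum (w' := fun i => f (wshift (i + wpos psi x k) (wsub psi x)))); last first.
  by move=> i /=; rewrite wshiftD.
rewrite (cum_shift (fun i => f (wshift i (wsub psi x)))) subrK.
by rewrite [RHS]addrC subrK.
Qed.

Lemma iter_tower N f x : iter N (tower_sum phi) f x = tower_sum (spow phi N) f x.
Proof.
elim: N f => [|N ih] f.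
  by rewrite /tower_sum wpos_spow0 wsub_spow -[1]add0r cumS cum0 wshift0 !add0r.
rewrite iterSr ih [RHS]/tower_sum (wsub_spow phi N.+1 x) iterS -(wsub_spow phi N x).
by rewrite (spow_sub phi N x).2 -(cum_tower phi f).
Qed.

Lemma towerB psi f g : tower_sum psi (fun x => f x - g x) = (fun x => tower_sum psi f x - tower_sum psi g x).
Proof. by apply/funext => x; rewrite /tower_sum cumB. Qed.

Lemma tower0 psi : tower_sum psi (fun _ => 0) = (fun _ => 0).
Proof.
by apply/funext => x; rewrite /tower_sum -(@cum_unique _ (fun _ => 0) (fun _ => 0)).
Qed.

Lemma eq_tower psi f g x : (forall z, allowed_biinf z -> f z = g z) ->
  allowed_biinf (wsub psi x) -> tower_sum psi f x = tower_sum psi g x.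
Proof. by move=> e h; apply: eq_cum => i; apply/e/allowed_shift. Qed.

Lemma agree_tower psi n f x y :
  (forall x y, allowed_biinf x -> allowed_biinf y -> agree_on (- n%:Z) n%:Z x y -> f x = f y) ->
  allowed_biinf (wsub psi x) -> allowed_biinf (wsub psi y) ->
  agree_on (- n.+1%:Z) n.+1%:Z x y -> tower_sum psi f x = tower_sum psi f y.
Proof.
move=> hf hx hy e; rewrite /tower_sum.
have h0 : - n.+1%:Z <= 0 <= n.+1%:Z by lia.
have h1 := wpos_grow psi x (- n.+1%:Z) n.+1; rewrite addNr wpos0 in h1.
have h2 := wpos_grow psi x 1 n.
rewrite -(agree_wpos psi h0 e); last by lia.
have hp : 0 <= wpos psi x 1 by rewrite wpos1.
apply: (eq_cum_on (a := 0) (b := wpos psi x 1)); [by rewrite lexx| |by rewrite lexx hp].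
move=> j hj; apply: hf; try exact: allowed_shift.
move=> i hi; rewrite /wshift; apply: (agree_wsub h0 e).
rewrite (_ : n.+1%:Z = 1 + n%:Z) in h1 *; last by lia.
have ar (a b c k l m : int) : a + (1 + m) <= 0 -> b + m <= c -> 0 <= k < b -> - m <= l < m ->
    a <= l + k < c by clear; lia.
exact: ar h1 h2 hj hi.
Qed.

Lemma loc_const_tower f : loc_const f -> loc_const (tower_sum phi f).
Proof.
move=> [n hn]; exists n.+1 => x y hx hy e.
by apply: agree_tower e => //; exact: allowed_wsub.
Qed.

Lemma cohomologous_tower f g : cohomologous f g -> cohomologous (tower_sum phi f) (tower_sum phi g).
Proof.
move=> /cohomologous_sub0/cohomologous0[B hB e]; apply/cohomologous_sub0/cohomologous0.
exists (fun x => B (wsub phi x)).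
  have := loc_const_sub 1 hB; congr loc_const; apply/funext => x.
  by rewrite wsub_spow.
move=> x hx; rewrite -[LHS]/((fun x => tower_sum phi f x - tower_sum phi g x) x) -towerB.
have hx' := allowed_wsub hx.
rewrite (eq_tower (g := fun z => B (wshift 1 z) - B z)) //.
by rewrite /tower_sum cum_coboundary wsub_shift.
Qed.

Lemma cohomologous_iter_tower n f g : cohomologous f g ->
  cohomologous (iter n (tower_sum phi) f) (iter n (tower_sum phi) g).
Proof. by move=> h; elim: n => //= n; apply: cohomologous_tower. Qed.

Lemma iter_towerB n f g : iter n (tower_sum phi) (fun x => f x - g x)
  = (fun x => iter n (tower_sum phi) f x - iter n (tower_sum phi) g x).
Proof. by elim: n => //= n ->; rewrite towerB. Qed.

Section Recognizable.
Variables (ry : (int -> 'I_d) -> int -> 'I_d) (rk : (int -> 'I_d) -> nat).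
Hypotheses (rP : forall x, allowed_biinf x -> [/\ allowed_biinf (ry x),
        (rk x < size (phi (ry x 0)))%N & x = wshift (rk x)%:Z (wsub phi (ry x))])
  (rE : forall y (k : nat), allowed_biinf y -> (k < size (phi (y 0)))%N ->
        ry (wshift k%:Z (wsub phi y)) = y /\ rk (wshift k%:Z (wsub phi y)) = k)
  (r_loc : forall n : nat, exists N : nat, forall x x', allowed_biinf x -> allowed_biinf x' ->
        agree_on (- N%:Z) N%:Z x x' -> rk x = rk x' /\ agree_on (- n%:Z) n%:Z (ry x) (ry x')).

(** The primitive of [f] is [b] at the base of the tower plus the partial sum of [f] up to the
    height of [x]. It is locally constant because desubstitution is continuous. *)
Lemma tower_inj f : loc_const f -> cohomologous (tower_sum phi f) (fun _ => 0) ->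
  cohomologous f (fun _ => 0).
Proof.
move=> hf /cohomologous0[b hb e]; apply/cohomologous0.
exists (fun x => b (ry x) + cum (fun j => f (wshift j (wsub phi (ry x)))) (rk x)%:Z).
  move: hf hb => [n hn] [n' hn']; have [K hK] := size_subst_bounded phi.
  have [N hN] := r_loc (n + n' + K)%N; exists N => x x' hx hx' /(hN _ _ hx hx')[ek ey].
  have [h1 h2 h3] := rP hx; have [h1' h2' h3'] := rP hx'.
  congr (_ + _); first by apply: hn' => //; apply: agree_onW ey; lia.
  rewrite -ek; apply: (eq_cum_on (a := 0) (b := (rk x)%:Z)); rewrite ?lexx ?lez_nat //.
  move=> j hj; apply: hn; try by apply/allowed_shift/allowed_wsub.
  have hk : (rk x <= K)%N := leq_trans (ltnW h2) (hK _).
  move=> i hi; rewrite /wshift; apply: (agree_wsub_sym phi ey).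
  have ar (p q r s : nat) (l m : int) : 0 <= m < s%:Z -> (s <= r)%N -> - p%:Z <= l < p%:Z ->
    - (p + q + r)%:Z <= l + m < (p + q + r)%:Z by clear; lia.
  exact: ar hj hk hi.
move=> x hx; have [hy hk ex] := rP hx; set y := ry x in hy hk ex *; set k := rk x in hk ex *.
have hfx : f x = f (wshift k (wsub phi y)) by rewrite -ex.
have es : wshift 1 x = wshift (k.+1)%:Z (wsub phi y).
  by rewrite [in LHS]ex wshiftD -add1n PoszD.
(* Either the shift stays in the same block, and the partial sum gains f x, or it enters the next
   block, and the equation for the tower sum applies. *)
have [hk1|hk1] := ltnP k.+1 (size (phi (y 0))).
  rewrite es; have [-> ->] := rE hy hk1.
  by rewrite -addn1 PoszD cumS -hfx; ring.
have ek : (k.+1)%:Z = wpos phi y 1 by rewrite wpos1; congr Posz; apply/eqP; rewrite eqn_leq hk.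
have e1 : wshift 1 x = wshift 0%N%:Z (wsub phi (wshift 1 y)).
  by rewrite es ek wsub_shift wshift0.
have hy1 : allowed_biinf (wshift 1 y) := allowed_shift (k := 1) hy.
rewrite e1; have [-> ->] := rE hy1 (size_subst_gt0 phi _).
have := e y hy; rewrite /tower_sum -ek -addn1 PoszD cumS -hfx cum0.
by move: (cum _ _) => t; lia.
Qed.

Lemma iter_tower_inj n f : loc_const f ->
  cohomologous (iter n (tower_sum phi) f) (fun _ => 0) -> cohomologous f (fun _ => 0).
Proof.
elim: n f => // n ih f hf; rewrite iterSr => /ih h.
by apply: tower_inj => //; apply/h/loc_const_tower.
Qed.

(** The whole value of [g] is placed on the first letter of each block. *)
Lemma tower_surj g : loc_const g ->
  exists2 f, loc_const f & forall x, allowed_biinf x -> tower_sum phi f x = g x.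
Proof.
move=> [n hn]; exists (fun x => if rk x == 0%N then g (ry x) else 0).
  have [N hN] := r_loc n; exists N => x x' hx hx' /(hN _ _ hx hx')[-> ey].
  have [h1 _ _] := rP hx; have [h1' _ _] := rP hx'.
  by rewrite (hn _ _ h1 h1' ey).
move=> y hy; rewrite /tower_sum wpos1.
have := size_subst_gt0 phi (y 0); case es : (size _) => [//|m] _.
rewrite /cum big_ord_recl big1 => [|j _].
  have [-> ->] := rE hy (size_subst_gt0 phi (y 0)).
  by rewrite eqxx addr0.
have [||_ ->] := rE (y := y) (k := lift ord0 j) => //.
by rewrite es ltn_ord.
Qed.

Lemma iter_tower_surj n g : loc_const g ->
  exists2 f, loc_const f & forall x, allowed_biinf x -> iter n (tower_sum phi) f x = g x.
Proof.
elim: n g => [|n ih] g hg; first by exists g.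
have [f hf ef] := tower_surj hg; have [h hh eh] := ih f hf.
exists h => // x hx; rewrite iterS -ef //.
by apply: eq_tower => //; exact: allowed_wsub.
Qed.

End Recognizable.
End Coinvariants.

(** * Cellular cochains of the transition complex *)

Section Cells.
Variables (d : nat) (phi : substitution d).
Local Notation allowed_biinf := (allowed_biinf phi).
Local Notation fn := ((int -> 'I_d) -> int).
Local Notation ind := (tower_sum phi).
Local Notation "f ~~ g" := (cohomologous phi f g) (at level 70).
Implicit Types (x y z : int -> 'I_d) (f g B : fn) (u s t : 'I_d -> int) (v : 'I_d * 'I_d -> int).
Hypothesis phi_grows : forall k, exists N, forall n a, (N <= n)%N ->
  (k <= size (subst_iter phi n a))%N.
Hypothesis pairs_occur : forall e, e \in S_edges phi ->
  exists x, [/\ allowed_biinf x, x (- 1) = e.1 & x 0 = e.2].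
Hypothesis letters_occur : forall a, exists x, allowed_biinf x /\ x 0 = a.

(** A 1-cochain of K, with values [u] on the edges e_a and [v] on the edges e_ab, evaluated along
    one step of the word. *)
Definition cell u v : fn := fun x => u (x 0) + v (x (- 1), x 0).

(** The contribution of the letters and inner pairs of phi(a): the pair entering the block, which on
    the constant word is S_map (a, a), is removed. *)
Definition pull u v : 'I_d -> int := fun a => ind (cell u v) (fun _ => a) - v (S_map phi (a, a)).

Definition transpose u : 'I_d -> int := fun a => \sum_(b <- phi a) u b.

Lemma wsub_S_map x : (wsub phi x (- 1), wsub phi x 0) = S_map phi (x (- 1), x 0).
Proof.
congr (_, _).
  have hs := size_subst_gt0 phi (x (- 1)).
  have ep : wpos phi x (- 1) = - (size (phi (x (- 1))))%:Z.
    have := wposS phi x (- 1); rewrite addNr wpos0 => /eqP.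
    by rewrite eq_sym addr_eq0 => /eqP.
  have hk : ((size (phi (x (- 1)%R))).-1 < size (phi (x (- 1)%R)))%N by rewrite prednK.
  have := wsubE (x (- 1)) hk; rewrite ep nth_last => <-.
  by congr (wsub phi x); move: hs; case: (size _) => // n _; lia.
have := wsubE (x 0) (size_subst_gt0 phi (x 0)).
by rewrite wpos0 addr0 nth0.
Qed.

(** In the sum over phi(x_0) only the entering pair sees x_{-1}, and this pair is the [S_map] of
    (x_{-1}, x_0). *)
Lemma tower_cell u v : ind (cell u v) = cell (pull u v) (v \o S_map phi).
Proof.
apply/funext => x; rewrite /cell /pull /= -(wsub_S_map x) -(wsub_S_map (fun _ => x 0)); set a := x 0.
suff h : ind (cell u v) x - v (wsub phi x (- 1), wsub phi x 0) =
    ind (cell u v) (fun _ => a) - v (wsub phi (fun _ => a) (- 1), wsub phi (fun _ => a) 0).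
  by rewrite -h subrK.
have e0 : agree_on 0 1 x (fun _ => a) by move=> i hi; rewrite (_ : i = 0) //; lia.
have h01 : (0 : int) <= 0 <= (1 : int) by [].
have := agree_wsub (psi := phi) h01 e0; rewrite wpos0 wpos1.
rewrite /tower_sum !wpos1 -/a; case: (size _) (size_subst_gt0 phi a) => // n _ e.
have F w : cum (fun i => cell u v (wshift i w)) n.+1%:Z - v (w (- 1), w 0)
    = u (w 0) + \sum_(j < n) (u (w (j.+1)%:Z) + v (w j%:Z, w (j.+1)%:Z)).
  rewrite /cum big_ord_recl /cell /wshift !add0r addr0 addrAC addrK; congr (_ + _).
  apply: eq_bigr => j _; rewrite /bump /= add0r; congr (_ + v (w _, _)).
  by rewrite /bump leq0n; lia.
rewrite !F e //; congr (_ + _); apply: eq_bigr => j _.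
by have jn := ltn_ord j; rewrite !e //; lia.
Qed.

Definition push n v : 'I_d * 'I_d -> int := v \o iter n (S_map phi).

Lemma iter_tower_cell n u v : exists u', iter n ind (cell u v) = cell u' (push n v).
Proof.
elim: n => [|n [u' ih]]; first by exists u.
exists (pull u' (push n v)); rewrite iterS ih tower_cell; congr cell.
by apply/funext => e; rewrite /push /= -iterSr.
Qed.

Lemma sum_word_factor u x n : \sum_(b <- word_factor x 0 n) u b = \sum_(j < n) u (x j%:Z).
Proof.
elim: n => [|n ih]; first by rewrite big_nil big_ord0.
by rewrite -addn1 word_factor_cat big_cat ih /= big_seq1 addn1 big_ord_recr /= add0r addr0.
Qed.

Lemma pull0 u : pull u (fun _ => 0) = transpose u.
Proof.
apply/funext => a; rewrite /pull subr0 /tower_sum wpos1 /transpose.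
have hb : word_factor (wsub phi (fun _ => a)) 0 (size (phi a)) = phi a.
  by have := wsub_block phi (fun _ => a) 0; rewrite wpos0.
rewrite -[in RHS]hb sum_word_factor.
by apply: eq_bigr => j _; rewrite /cell addr0 /wshift.
Qed.

Lemma iter_tower_cell0 n u :
  iter n ind (cell u (fun _ => 0)) = cell (iter n transpose u) (fun _ => 0).
Proof. by elim: n => // n ih; rewrite iterS ih tower_cell pull0. Qed.

Lemma letter_function (F : fn) :
  (forall x y, allowed_biinf x -> allowed_biinf y -> x (- 1) = y (- 1) -> F x = F y) ->
  exists s, forall x, allowed_biinf x -> F x = s (x (- 1)).
Proof.
move=> hF; exists (fun a : 'I_d => F (xget (fun _ : int => a)
  [set x : int -> 'I_d | allowed_biinf x /\ x (- 1) = a])).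
by move=> x hx; case: xgetP => [y _ [hy e]|/(_ x)[] //]; apply: hF.
Qed.

Lemma pair_function (F : fn) :
  (forall x y, allowed_biinf x -> allowed_biinf y ->
    x (- 1) = y (- 1) -> x 0 = y 0 -> F x = F y) ->
  exists v, forall x, allowed_biinf x -> F x = v (x (- 1), x 0).
Proof.
move=> hF; exists (fun e : 'I_d * 'I_d => F (xget (fun _ : int => e.1)
  [set x : int -> 'I_d | [/\ allowed_biinf x, x (- 1) = e.1 & x 0 = e.2]])).
by move=> x hx; case: xgetP => [y _ [hy e e']|/(_ x)[] //]; apply: hF.
Qed.

Lemma cohomologous_shift f n : loc_const phi f -> f ~~ (fun x => f (wshift (- n%:Z) x)).
Proof.
move=> hf; elim: n => [|n ih].
  by apply: eq_cohomologous => x _; rewrite wshift0.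
apply: cohomologous_trans ih _.
exists (fun x => f (wshift (- n.+1%:Z) x)); first exact: loc_const_shift.
by move=> x _; rewrite wshiftD (_ : - n.+1%:Z + 1 = - n%:Z) //; lia.
Qed.

Lemma pair_block_agree N n x y : (forall a, n <= size (subst_iter phi N a))%N ->
  allowed_biinf x -> allowed_biinf y -> x (- 1) = y (- 1) ->
  agree_on (- n%:Z) 0 (wsub (spow phi N) x) (wsub (spow phi N) y).
Proof.
move=> hn hx hy e.
have e0 : agree_on (- 1) 0 x y by move=> i hi; rewrite (_ : i = - 1) //; lia.
have h01 : (- 1 : int) <= 0 <= (0 : int) by [].
apply: agree_onW (agree_wsub h01 e0); last by rewrite wpos0.
have := wposS (spow phi N) x (- 1); rewrite addNr wpos0 /=.
by have := hn (x (- 1)); lia.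
Qed.

(** Shifted by n, [f] reads only the coordinates in [-2n, 0). Once blocks of phi^N have at least 2n
    letters, its sum over phi^N(x_0) reads only the blocks of x_{-1} and x_0. *)
Lemma exists_pair_cochain f : loc_const phi f ->
  exists N v, iter N ind f ~~ cell (fun _ => 0) v.
Proof.
move=> hf; have [n hn] := hf; have [N hN] := phi_grows (n + n)%N.
pose f' x := f (wshift (- n%:Z) x).
have [|v hv] := @pair_function (iter N ind f').
  move=> x y hx hy e1 e0; rewrite !iter_tower /tower_sum.
  have ep : wpos (spow phi N) y 1 = wpos (spow phi N) x 1 by rewrite !wpos1 e0.
  rewrite ep; have eL := pair_block_agree (fun a => hN N a (leqnn N)) hx hy e1.
  have e01 : agree_on 0 1 x y by move=> i hi; rewrite (_ : i = 0) //; lia.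
  have h01 : (0 : int) <= 0 <= (1 : int) by [].
  have eR := agree_wsub (psi := spow phi N) h01 e01; rewrite wpos0 in eR.
  apply: (eq_cum_on (a := 0) (b := wpos (spow phi N) x 1)); rewrite ?lexx ?wpos1 ?lez_nat //.
  rewrite -wpos1 => j hj; apply: hn; try exact/allowed_shift/allowed_shift/allowed_spow.
  move=> i hi; rewrite !wshiftD /wshift.
  have [h|h] := ltP (i + (- n%:Z + j)) 0; [apply: eL | apply: eR].
    by move: h hi hj; clear; move=> *; lia.
  by move: h hi hj; move: (wpos _ _ _) => L; clear; move=> *; lia.
exists N, v; apply: cohomologous_trans (eq_cohomologous _); last first.
  by move=> x hx; rewrite /cell add0r -hv.
exact/cohomologous_iter_tower/cohomologous_shift.
Qed.

(** Telescoping over n steps writes B x as [B] at shift^(-n) x plus values of the cochain, all of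
    which read negative coordinates. *)
Lemma primitive_depends_on_past u v B (n : nat) :
  (forall x y, allowed_biinf x -> allowed_biinf y -> agree_on (- n%:Z) n%:Z x y -> B x = B y) ->
  (forall x, allowed_biinf x -> cell u v x = B (wshift 1 x) - B x) ->
  forall x y, allowed_biinf x -> allowed_biinf y -> agree_on (- (n + n).+1%:Z) 0 x y -> B x = B y.
Proof.
move=> hn hB x y hx hy e.
have D k z : allowed_biinf z -> B z = B (wshift (- k%:Z) z)
    + \sum_(j < k) cell u v (wshift (- j.+1%:Z) z).
  move=> hz; elim: k => [|k ih]; first by rewrite big_ord0 addr0 wshift0.
  rewrite big_ord_recr /= hB; last exact: allowed_shift.
  rewrite wshiftD (_ : 1 + - k.+1%:Z = - k%:Z); last by lia.
  by rewrite {1}ih; ring.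
rewrite (D n x) // (D n y) //; congr (_ + _).
  apply: hn; try exact: allowed_shift.
  by move=> i hi; apply: e; move: hi; clear; lia.
apply: eq_bigr => j _; rewrite /cell /wshift.
by have jn := ltn_ord j; rewrite !e //; move: jn; clear; lia.
Qed.

(** [B] reads a bounded past, so B o phi^n is a function [s] of x_{-1} alone for n large. Then [s]
    is the potential at the ends of the edges e_a, and s - u' the one at their origins. *)
Lemma cell_coboundary u v : cell u v ~~ (fun _ => 0) ->
  exists N, forall n, (N <= n)%N -> exists u' s t,
    [/\ iter n ind (cell u v) = cell u' (push n v),
        forall e, e \in S_edges phi -> push n v e = t e.2 - s e.1 &
        forall a, u' a = s a - t a].
Proof.
move=> /cohomologous0[B [m hm] hB]; have [N hN] := phi_grows (m + m).+1.
exists N => n Nn; have [u' eu'] := iter_tower_cell n u v; exists u'.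
have [|s hs] := @letter_function (fun y => B (wsub (spow phi n) y)).
  move=> x y hx hy e.
  apply: (primitive_depends_on_past hm hB); try exact: allowed_spow.
  by apply: pair_block_agree => // a; apply: hN.
exists s, (fun b => s b - u' b); split=> //; last by move=> a; rewrite opprB addrC subrK.
move=> e /pairs_occur[x [hx e1 e2]].
have := congr1 (fun f => f x) eu'; rewrite iter_tower.
rewrite (eq_tower (phi := phi) (g := fun z => B (wshift 1 z) - B z)) //; last exact: allowed_spow.
rewrite /tower_sum cum_coboundary -wsub_shift (hs _ hx) (hs _ (allowed_shift (k := 1) hx)).
rewrite /wshift addNr /cell e1 e2 -surjective_pairing.
by move: (push n v e) => q; lia.
Qed.

Lemma vertex_coboundary u v s t :
  (forall e, e \in S_edges phi -> v e = t e.2 - s e.1) -> (forall a, u a = s a - t a) ->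
  cell u v ~~ (fun _ => 0).
Proof.
move=> hv hu; apply/cohomologous0; exists (fun x => s (x (- 1))).
  by exists 1%N => x y _ _ e; rewrite e.
move=> x hx; rewrite /cell hu hv /=; first by rewrite /wshift addNr; ring.
rewrite inE; apply/asboolP; have := hx (- 1) 2; rewrite /word_factor /mkseq /=.
by rewrite addr0 addNr.
Qed.

End Cells.

Lemma sum_count (V : nmodType) (T : finType) (w : seq T) (u : T -> V) :
  \sum_(b <- w) u b = \sum_i u i *+ count_mem i w.
Proof.
elim: w => [|a w ih]; first by rewrite big_nil big1.
rewrite big_cons ih /= [RHS](eq_bigr (fun i => u i *+ (a == i) + u i *+ count_mem i w)).
  rewrite big_split /=; congr (_ + _).
  rewrite (bigD1 a) //= eqxx big1 ?addr0 // => i ia.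
  by rewrite eq_sym (negbTE ia).
by move=> i _; rewrite mulrnDr.
Qed.

(** * The quotient matrix and the graph of eventual pairs *)

Section Components.
Variables (d : nat) (phi : substitution d) (p : nat) (C : 'I_p -> {set S_vertex d}) (P : 'M[int]_d).
Hypotheses (C_components : component_enum phi C) (P_basis : basis_extension C P).
Hypothesis succ_ex : forall a, exists b, (a, b) \in S_edges phi.
Hypothesis pred_ex : forall b, exists a, (a, b) \in S_edges phi.
Local Notation S_adj := (S_adj phi).

Lemma S_adj_sym : symmetric S_adj.
Proof. by case=> a [b|b]. Qed.

Lemma S_vertices_full v : v \in S_vertices phi.
Proof.
case: v => a; rewrite inE; apply/orP.
  by left; have [b hb] := succ_ex a; apply/imsetP; exists (a, b).
by right; have [b hb] := pred_ex a; apply/imsetP; exists (b, a).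
Qed.

Lemma connect_equivalence : {in S_vertices phi & &, equivalence_rel (connect S_adj)}.
Proof.
have cs := sym_connect_sym S_adj_sym.
move=> u v w _ _ _; split; first exact: connect0.
by move=> uv; exact: (same_connect cs uv).
Qed.

Lemma component_ex v : exists i, v \in C i.
Proof.
have hp := equivalence_partitionP connect_equivalence; have [_ hC] := C_components.
have hv : v \in finset.cover (S_components phi).
  by rewrite (cover_partition hp) S_vertices_full.
have := pblock_mem hv; rewrite {2}hC => /imsetP[i _ e].
by exists i; rewrite -e mem_pblock.
Qed.

Lemma component_connect i v w : v \in C i -> (w \in C i) = connect S_adj v w.
Proof.
move=> hv; have hp := equivalence_partitionP connect_equivalence; have [_ hC] := C_components.
have Ci : C i \in S_components phi by rewrite hC; apply: imset_f.
have [_ ht _] := and3P hp.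
rewrite -(def_pblock ht Ci hv).
by rewrite (pblock_equivalence_partition connect_equivalence) // S_vertices_full.
Qed.

Lemma component_unique i j v : v \in C i -> v \in C j -> i = j.
Proof.
move=> hi hj; have [Cinj _] := C_components; apply: Cinj; apply/setP => w.
by rewrite (component_connect _ hi) (component_connect _ hj).
Qed.

(** The coboundaries, on the edges e_a, of vertex functions constant on the components of S: [s] is
    the value where e_a terminates, [t] where it originates. The lemmas below identify them with the
    span of the w_i, i < p. *)
Definition vertex_cut (y : 'cV[int]_d) := exists s t : 'I_d -> int,
  (forall e, e \in S_edges phi -> t e.2 = s e.1) /\ forall a, y a 0 = s a - t a.

Lemma cut0 : vertex_cut 0.
Proof. by exists (fun _ => 0), (fun _ => 0); split=> // a; rewrite mxE subrr. Qed.

Lemma cutD y y' : vertex_cut y -> vertex_cut y' -> vertex_cut (y + y').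
Proof.
move=> [s [t [h1 h2]]] [s' [t' [h1' h2']]].
exists (fun a => s a + s' a), (fun a => t a + t' a); split=> [e he|a].
  by rewrite h1 ?h1'.
by rewrite mxE h2 h2'; ring.
Qed.

Lemma cutZ c y : vertex_cut y -> vertex_cut (c *: y).
Proof.
move=> [s [t [h1 h2]]].
exists (fun a => c * s a), (fun a => c * t a); split=> [e he|a]; first by rewrite h1.
by rewrite mxE h2; ring.
Qed.

Lemma cut_component_vec i : vertex_cut (component_vec C i).
Proof.
exists (fun a => (inl a \in C i)%:R), (fun b => (inr b \in C i)%:R); split; last first.
  by move=> a; rewrite mxE.
move=> [a b] he /=; congr (_%:R); congr nat_of_bool.
have hab : connect S_adj (inl a) (inr b) by apply: connect1.
apply/idP/idP => h.
  by rewrite (component_connect _ h) (sym_connect_sym S_adj_sym).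
by rewrite (component_connect _ h).
Qed.

(** The class modulo w_1, ..., w_(p-1), in the coordinates of the basis [P]; [quotient_lift] is a
    section of it. *)
Definition quotient_proj (y : 'cV[int]_d) : 'cV[int]_(d - p.-1) :=
  \col_i (invmx P *m y) (A1_index i) 0.

Definition quotient_lift (x : 'cV[int]_(d - p.-1)) : 'cV[int]_d :=
  P *m \col_k \sum_i x i 0 *+ (k == A1_index i).

Lemma quotient_projB y y' : quotient_proj (y - y') = quotient_proj y - quotient_proj y'.
Proof. by apply/matrixP => i j; rewrite /quotient_proj mulmxBr !mxE. Qed.

Lemma quotient_liftB x x' : quotient_lift (x - x') = quotient_lift x - quotient_lift x'.
Proof.
rewrite /quotient_lift -mulmxBr; congr (_ *m _); apply/matrixP => k j; rewrite !mxE.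
by rewrite -sumrB; apply: eq_bigr => i _; rewrite !mxE mulrnBl.
Qed.

Lemma A1_index_inj : injective (@A1_index d p).
Proof. by move=> i j /(congr1 val) /= /addnI /val_inj. Qed.

Lemma quotient_liftK : cancel quotient_lift quotient_proj.
Proof.
have [_ uP _] := P_basis; move=> x; apply/colP => i.
rewrite mxE mulmxA mulVmx // mul1mx mxE (bigD1 i) //= eqxx mulr1n big1 ?addr0 // => j ji.
by rewrite (inj_eq A1_index_inj) eq_sym (negbTE ji).
Qed.

Lemma A1_mx_quotient x :
  A1_mx phi p P *m x = quotient_proj ((subst_mx phi)^T *m quotient_lift x).
Proof.
apply/colP => i; rewrite /quotient_proj /quotient_lift /A1_mx !mulmxA.
rewrite !mxE; set M := _ *m P.
rewrite [RHS](eq_bigr (fun k => \sum_j M (A1_index i) k * (x j 0 *+ (k == A1_index j)))); last first.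
  by move=> k _; rewrite [X in _ * X]mxE mulr_sumr.
rewrite exchange_big /=; apply: eq_bigr => j _; rewrite [in LHS]mxE.
rewrite (bigD1 (A1_index j)) //= eqxx mulr1n big1 ?addr0 // => k kj.
by rewrite (negbTE kj) mulr0n mulr0.
Qed.

Lemma quotient_proj_eq0_cut y : quotient_proj y = 0 -> vertex_cut y.
Proof.
have [pd uP hP] := P_basis.
move=> h; have -> : y = \sum_k (invmx P *m y) k 0 *: col k P.
  rewrite -[LHS](mulKVmx uP); apply/colP => a; rewrite mxE summxE.
  by apply: eq_bigr => k _; rewrite !mxE mulrC.
elim/big_ind: _ => [|u v hu hv|k _]; [exact: cut0 | exact: cutD |].
have [kp|kp] := ltnP k p.-1.
  have kp' : (k < p)%N by apply: leq_trans kp (leq_pred p).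
  rewrite (hP (Ordinal kp')) //; apply/cutZ/cut_component_vec.
have hk : (k - p.-1 < d - p.-1)%N by rewrite ltn_sub2r // (leq_ltn_trans kp).
have := congr1 (fun z : 'cV[int]_(d - p.-1) => z (Ordinal hk) 0) h; rewrite mxE [RHS]mxE.
rewrite (_ : A1_index _ = k); last by apply: val_inj; rewrite /= subnKC.
by move=> ->; rewrite scale0r; exact: cut0.
Qed.

(** A function constant on components makes [y] a combination of all w_1, ..., w_p. These add up to
    0, as each e_a has one origin and one end, so w_p can be eliminated. *)
Lemma cut_quotient_proj_eq0 y : vertex_cut y -> quotient_proj y = 0.
Proof.
have [pd uP hP] := P_basis; move=> [s [t [hst hy]]].
pose sg (v : S_vertex d) := match v with inl a => s a | inr b => t b end.
have sg_connect v w : connect S_adj v w -> sg v = sg w.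
  move=> /connectP[q hq ->]; elim: q v hq => //= u q ih v /andP[vu /ih <-].
  by case: v u vu => a [b|b] //= /hst.
pose c i := if [pick v in C i] is Some v then sg v else 0.
have hc i v : v \in C i -> c i = sg v.
  rewrite /c => hv; case: pickP => [w hw|/(_ v)]; last by rewrite hv.
  by apply: sg_connect; rewrite -(component_connect _ hw).
have sgE v : sg v = \sum_i c i * (v \in C i)%:R.
  have [i hi] := component_ex v; rewrite (bigD1 i) //= hi mulr1 (hc i v hi).
  rewrite big1 ?addr0 // => j ji; case: (boolP (v \in C j)) => hj; last by rewrite mulr0.
  by rewrite (component_unique hi hj) eqxx in ji.
have one v : \sum_i (v \in C i)%:R = 1 :> int.
  have [i hi] := component_ex v; rewrite (bigD1 i) //= hi.
  rewrite big1 ?addr0 // => j ji; case: (boolP (v \in C j)) => hj //.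
  by rewrite (component_unique hi hj) eqxx in ji.
have yE m : y = \sum_i (c i - m) *: component_vec C i.
  apply/colP => a; rewrite hy summxE.
  rewrite -[s a]/(sg (inl a)) -[t a]/(sg (inr a)) !sgE -sumrB.
  have z : \sum_i m * ((inl a \in C i)%:R - (inr a \in C i)%:R) = 0.
    by rewrite -mulr_sumr sumrB !one subrr mulr0.
  rewrite -[LHS]subr0 -[X in _ - X]z -sumrB; apply: eq_bigr => i _.
  by rewrite !mxE; ring.
(* The value on the last component; subtracting it everywhere kills the coefficient of w_p. *)
pose m := if [pick i : 'I_p | p.-1 <= i]%N is Some i then c i else 0.
apply/colP => j; rewrite mxE (yE m) mulmx_sumr summxE big1 ?mxE // => i _.
rewrite -scalemxAr mxE.
have [ip|ip] := ltnP i p.-1.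
  have id : (i < d)%N := leq_trans ip pd.
  rewrite -(hP i (Ordinal id)) // colE mulmxA mulVmx // mul1mx mxE eqxx andbT.
  rewrite (_ : (_ == _) = false) ?mulr0 //.
  apply/negbTE/eqP => /(congr1 val) /= e.
  by rewrite -e ltnNge leq_addr in ip.
rewrite /m; case: pickP => [k kp|/(_ i)]; last by rewrite ip.
suff -> : i = k by rewrite subrr mul0r.
by apply: val_inj; have := ltn_ord i; have := ltn_ord k; move: ip kp => /=; lia.
Qed.

Lemma transpose_mx (y : 'cV[int]_d) a :
  ((subst_mx phi)^T *m y) a 0 = transpose phi (fun b => y b 0) a.
Proof.
rewrite /transpose sum_count mxE; apply: eq_bigr => i _.
by rewrite !mxE -mulr_natl natz.
Qed.
End Components.

(** * Smith normal form and the cohomology of a finite graph *)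

Section TorsionFree.
Variables (m n : nat) (M : 'M[int]_(m, n)).
Hypothesis M_torsion_free : forall (k : int) x w, k != 0 -> k *: x = M *m w ->
  exists w' : 'cV[int]_n, x = M *m w'.

(** When the cokernel is torsion free, the nonzero invariant factors are units, so the coordinates
    beyond the rank span a complement of the image. *)
Lemma torsion_free_splitting l : l = (m - \rank (map_mx intr M : 'M[rat]_(m, n)))%N ->
  exists kappa : 'cV[int]_l -> 'cV[int]_m,
  [/\ forall z z', kappa (z - z') = kappa z - kappa z',
      forall v, exists z w, v = kappa z + M *m w &
      forall z w, kappa z = M *m w -> z = 0].
Proof.
have [L uL [Q uQ [ds ds_sorted eM]]] := int_Smith_normal_form M.
set D := (\matrix_(i, j) _) in eM.
have [r [hr0 hr1 rm rn]] : exists r : nat, [/\ forall i : nat, (i < r)%N -> ds`_i != 0,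
    forall (i : 'I_m) (j : 'I_n), (r <= i)%N -> ds`_i *+ (i == j :> nat) = 0, (r <= m)%N & (r <= n)%N].
  pose r0 := find (pred1 0) ds.
  have h1 i : (i < r0)%N -> ds`_i != 0 by move=> h; have := before_find 0 h => /= ->.
  have h2 i : (r0 <= i)%N -> ds`_i = 0.
    move=> hi; have [hs|hs] := ltnP i (size ds); last by rewrite nth_default.
    have hr0 : (r0 < size ds)%N by apply: leq_ltn_trans hs.
    have e0 : ds`_r0 = 0 by have /(nth_find 0)/eqP : has (pred1 0) ds by rewrite has_find.
    move: hi; rewrite leq_eqVlt => /orP[/eqP <- //|hi].
    have := sorted_ltn_nth (fun y x z => @dvdz_trans y x z) 0 ds_sorted r0 i hr0 hs hi.
    by rewrite e0 dvd0z => /eqP.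
  (* The list [ds] may extend beyond the diagonal of the matrix, hence the minimum with both
     dimensions. *)
  exists (minn r0 (minn m n)); split.
  - by move=> i; rewrite leq_min => /andP[/h1].
  - move=> i j; rewrite !geq_min => /orP[/h2 ->|/orP[]]; first by rewrite mul0rn.
      by rewrite leqNgt ltn_ord.
    move=> hi; rewrite (_ : (_ == _) = false) //; apply/negbTE/eqP => e.
    by rewrite e leqNgt ltn_ord in hi.
  - by rewrite geq_min geq_min leqnn orbT.
  - by rewrite geq_min geq_min leqnn !orbT.
have rankM : \rank (map_mx intr M : 'M[rat]_(m, n)) = r.
  rewrite eM !map_mxM mxrankMfree; last first.
    by rewrite row_free_unit unitmxE det_map_mx rmorph_unit // -unitmxE.
  rewrite eqmxMfull; last first.
    by rewrite row_full_unit unitmxE det_map_mx rmorph_unit // -unitmxE.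
  pose dd : 'rV[rat]_m := \row_i (if (i < r)%N then (ds`_i)%:~R else 1).
  have -> : map_mx intr D = diag_mx dd *m pid_mx r :> 'M[rat]_(m, n).
    apply/matrixP => i j; rewrite mul_diag_mx !mxE.
    have [ir|ir] := ltnP i r; first by rewrite andbT; case: eqP => _; rewrite ?mulr1 ?mulr0.
    by rewrite hr1 // andbF mulr0.
  rewrite eqmxMfull ?rank_pid_mx // row_full_unit unitmxE det_diag unitfE.
  apply/prodf_neq0 => i _; rewrite mxE; case: ifP => // /hr0.
  by rewrite intr_eq0.
rewrite rankM => el.
have Dw (w : 'cV[int]_n) (i : 'I_m) (j : 'I_n) : i = j :> nat -> (D *m w) i 0 = ds`_i * w j 0.
  move=> ij; rewrite mxE (bigD1 j) //= mxE ij eqxx mulr1n big1 ?addr0 // => k kj.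
  by rewrite mxE (_ : (_ == _) = false) ?mulr0n ?mul0r //; apply/negbTE; rewrite ij eq_sym.
have Dw0 (w : 'cV[int]_n) (i : 'I_m) : (r <= i)%N -> (D *m w) i 0 = 0.
  by move=> ri; rewrite mxE big1 // => j _; rewrite mxE hr1 // mul0r.
(* The image contains ds_i times the i-th vector of the adapted basis, hence by torsion-freeness
   that vector itself. *)
have ds_unit (i : 'I_m) : (i < r)%N -> ds`_i \is a GRing.unit.
  move=> ir; have hin : (i < n)%N := leq_trans ir rn.
  pose j : 'I_n := Ordinal hin.
  have [w hw] : exists w, L *m (delta_mx i 0 : 'cV[int]_m) = M *m w.
    apply: (@M_torsion_free ds`_i _ (invmx Q *m delta_mx j 0)); first exact: hr0.
    rewrite eM -!mulmxA (mulmxA Q) mulmxV // mul1mx scalemxAr; congr (_ *m _).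
    apply/colP => k; rewrite !mxE (bigD1 j) //= !mxE !eqxx !andbT big1 ?addr0 ?mulr1; last first.
      by move=> q qj; rewrite !mxE (negbTE qj) mulr0.
    by case: (k =P i) => [->|/eqP ki]; rewrite /= ?eqxx ?mulr1 // mulr0 (negbTE (ki : k != i :> nat)).
  have : delta_mx i 0 = D *m (Q *m w).
    by apply: (can_inj (mulKmx uL)); rewrite hw eM !mulmxA.
  move=> /(congr1 (fun z : 'cV[int]_m => z i 0)); rewrite (Dw _ i j) // mxE !eqxx => e.
  by apply/unitrP; exists ((Q *m w) j 0); rewrite mulrC -e.
pose e (z : 'cV[int]_l) : 'cV[int]_m := \col_k \sum_i z i 0 *+ (k == (r + i)%N :> nat).
exists (fun z => L *m e z).
have eE z (k : 'I_m) (i : 'I_l) : k = (r + i)%N :> nat -> e z k 0 = z i 0.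
  move=> ki; rewrite mxE (bigD1 i) //= ki eqxx mulr1n big1 ?addr0 // => j ji.
  by rewrite eqn_add2l (_ : (_ == _) = false) ?mulr0n //; apply/negbTE; rewrite eq_sym.
split.
- move=> z z'; rewrite -mulmxBr; congr (_ *m _); apply/colP => k; rewrite !mxE -sumrB.
  by apply: eq_bigr => i _; rewrite !mxE mulrnBl.
- move=> v; pose y := invmx L *m v.
  have ev : v = L *m y by rewrite mulKVmx.
  clearbody y.
  have idx (i : 'I_l) : (r + i < m)%N by rewrite -ltn_subRL -el.
  have idn (j : 'I_n) : (j < r)%N -> (j < m)%N by move=> jr; apply: leq_trans jr rm.
  pose z : 'cV[int]_l := \col_i y (Ordinal (idx i)) 0.
  pose w : 'cV[int]_n := \col_j \sum_(i : 'I_m | i == j :> nat) (if (i < r)%N then (ds`_i)^-1 * y i 0 else 0).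
  exists z, (invmx Q *m w).
  rewrite eM -!mulmxA (mulmxA Q) mulmxV // mul1mx -mulmxDr.
  rewrite ev; congr (_ *m _); apply/colP => k; rewrite [RHS]mxE.
  have [kr|kr] := ltnP k r.
    have kn : (k < n)%N := leq_trans kr rn.
    have ez0 : e z k 0 = 0.
      rewrite /e mxE big1 // => i _; rewrite (_ : (k == (r + i)%N :> nat) = false) //.
      by apply/negbTE; rewrite neq_ltn ltn_addr.
    rewrite (Dw _ k (Ordinal kn)) // ez0 add0r /w mxE.
    rewrite (bigD1 k) //= kr big1 ?addr0 => [|i /andP[/eqP ik]].
      by rewrite mulrA mulrV ?mul1r // ds_unit.
    by rewrite -val_eqE /= ik eqxx.
  rewrite Dw0 // addr0.
  have hk : (k - r < l)%N by rewrite el ltn_sub2r // (leq_ltn_trans kr).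
  rewrite (eE _ _ (Ordinal hk)) ?subnKC // mxE; congr (y _ _); apply: val_inj => /=.
  by rewrite subnKC.
- move=> z w; rewrite eM -!mulmxA => /(can_inj (mulKmx uL)) ez; apply/colP => i.
  have idx : (r + i < m)%N by rewrite -ltn_subRL -el.
  have := congr1 (fun t : 'cV[int]_m => t (Ordinal idx) 0) ez.
  by rewrite (eE _ _ i) // Dw0 ?leq_addr // mxE.
Qed.

End TorsionFree.

Section GraphSplitting.
Variables (d : nat) (E : {set 'I_d * 'I_d}).

Definition incidence : 'M[int]_(#|E|, d + d) :=
  \matrix_(k < #|E|)
    row_mx (- delta_mx 0 (enum_val k).1) (delta_mx 0 (enum_val k).2).

Lemma map_incidence : map_mx intr incidence = boundary_mx E :> 'M[rat]__.
Proof.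
apply/matrixP => k j; rewrite !mxE; case: (fintype.split j) => i; rewrite !mxE ?rmorphN ?rmorph_nat //.
Qed.

Lemma incidence_mul (w : 'cV[int]_(d + d)) k :
  (incidence *m w) k 0 = w (rshift d (enum_val k).2) 0 - w (lshift d (enum_val k).1) 0.
Proof.
rewrite mxE big_split_ord /= addrC; congr (_ + _).
  rewrite (bigD1 (enum_val k).2) //= big1 ?addr0.
    by rewrite mxE row_mxEr mxE !eqxx mul1r.
  by move=> i ik; rewrite mxE row_mxEr mxE (negbTE ik) mul0r.
rewrite (bigD1 (enum_val k).1) //= big1 ?addr0.
  by rewrite mxE row_mxEl !mxE !eqxx mulN1r.
by move=> i ik; rewrite mxE row_mxEl !mxE (negbTE ik) oppr0 mul0r.
Qed.

(* If k divides the differences of a potential along all edges, it divides    *)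
(* its differences inside each connected component, so subtracting a          *)
(* constant on each component the potential can be divided by k.              *)
Lemma incidence_torsion_free (k : int) (x : 'cV[int]_#|E|) (w : 'cV[int]_(d + d)) : k != 0 -> k *: x = incidence *m w ->
  exists w', x = incidence *m w'.
Proof.
move=> k0 e.
pose adj : rel (S_vertex d) := fun u v => match u, v with
  | inl a, inr b | inr b, inl a => (a, b) \in E | _, _ => false end.
have adj_sym : connect_sym adj by apply: sym_connect_sym; case=> a [b|b].
pose sg (v : S_vertex d) := match v with inl a => w (lshift d a) 0 | inr b => w (rshift d b) 0 end.
have he a b : (a, b) \in E -> (k %| sg (inr b) - sg (inl a))%Z.
  move=> ab; have ev : enum_val (enum_rank_in ab (a, b)) = (a, b) by apply: enum_rankK_in.
  have := congr1 (fun y : 'cV[int]_#|E| => y (enum_rank_in ab (a, b)) 0) e.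
  by rewrite incidence_mul ev mxE /= => <-; apply: dvdz_mulr.
have dvd_connect u v : connect adj u v -> (k %| sg v - sg u)%Z.
  move=> /connectP[q hq ->]; elim: q u hq => [|y q ih] u /=; first by rewrite subrr dvdz0.
  move=> /andP[uy /ih h]; rewrite -(subrKA (sg y)); apply: rpredD => //.
  case: u y uy {h ih} => a [b|b] //= /he // h.
  by rewrite -opprB rpredN.
pose sg' v := ((sg v - sg (fingraph.root adj v)) %/ k)%Z.
have hsg' v : sg v = sg (fingraph.root adj v) + sg' v * k.
  rewrite /sg' divzK; first by rewrite [RHS]addrC subrK.
  by apply: dvd_connect; rewrite adj_sym connect_root.
exists (col_mx (\col_a sg' (inl a)) (\col_b sg' (inr b))).
apply/colP => i; rewrite incidence_mul col_mxEu col_mxEd !mxE.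
apply: (mulIf k0); rewrite mulrBl.
have := congr1 (fun y : 'cV[int]_#|E| => y i 0) e; rewrite incidence_mul mxE mulrC => ->.
set a := (enum_val i).1; set b := (enum_val i).2.
rewrite -[w (rshift _ _) _]/(sg (inr b)) -[w (lshift _ _) _]/(sg (inl a)).
rewrite (hsg' (inr b)) (hsg' (inl a)).
have ab : connect adj (inl a) (inr b).
  by apply: connect1; rewrite /= /a /b -surjective_pairing; apply: enum_valP.
have -> : fingraph.root adj (inl a) = fingraph.root adj (inr b) by apply/eqP; rewrite root_connect.
by rewrite opprD addrACA subrr add0r.
Qed.

(** H^1 of the graph is the cokernel of the incidence matrix, free by [incidence_torsion_free];
    [kappa] lifts it to edge functions. *)
Lemma graph_splitting l : l = \rank (kermx (boundary_mx E)) ->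
  exists kappa : 'cV[int]_l -> 'I_d * 'I_d -> int,
  [/\ forall z z' e, kappa (z - z') e = kappa z e - kappa z' e,
      forall v, exists z s t, forall e, e \in E -> v e = kappa z e + (t e.2 - s e.1) &
      forall z s t, (forall e, e \in E -> kappa z e = t e.2 - s e.1) -> z = 0].
Proof.
rewrite mxrank_ker -map_incidence => /(torsion_free_splitting incidence_torsion_free).
move=> [K [KB K_ex K_inj]].
pose kappa z e := \sum_k K z k 0 *+ (enum_val k == e :> 'I_d * 'I_d).
have kE z k : kappa z (enum_val k) = K z k 0.
  rewrite /kappa (bigD1 k) //= eqxx mulr1n big1 ?addr0 // => i ik.
  by rewrite (inj_eq enum_val_inj) (negbTE ik).
exists kappa; split.
- move=> z z' e; rewrite /kappa -sumrB; apply: eq_bigr => k _.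
  by rewrite KB !mxE mulrnBl.
- move=> v; have [z [w h]] := K_ex (\col_k v (enum_val k)).
  exists z, (fun a => w (lshift d a) 0), (fun b => w (rshift d b) 0) => e he.
  rewrite -(enum_rankK_in he he) kE -incidence_mul.
  by have := congr1 (fun y : 'cV[int]_#|E| => y (enum_rank_in he e) 0) h; rewrite !mxE.
- move=> z s t h; apply: (K_inj z (col_mx (\col_a s a) (\col_b t b))).
  apply/colP => k; rewrite incidence_mul col_mxEu col_mxEd !mxE -kE h //.
  exact: enum_valP.
Qed.

End GraphSplitting.

(** Iterates on a finite set are eventually periodic; a multiple of the period beyond the preperiod
    is idempotent. *)
Lemma iter_idempotent (T : finType) (g : T -> T) :
  exists2 m, (0 < m)%N & forall k x, iter (m * k.+1) g x = iter m g x.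
Proof.
have [p [q [pq e]]] := pigeonhole_nat (fun n => [ffun x => iter n g x]).
have {}e x : iter p g x = iter q g x.
  by have := congr1 (fun f : {ffun T -> T} => f x) e; rewrite !ffunE.
pose c := (q - p)%N; have c0 : (0 < c)%N by rewrite subn_gt0.
have step n x : (p <= n)%N -> iter (n + c) g x = iter n g x.
  move=> pn; rewrite -(subnK pn) -addnA iterD [in RHS]iterD; congr iter.
  by rewrite /c subnKC ?e // ltnW.
have steps k n x : (p <= n)%N -> iter (n + c * k) g x = iter n g x.
  move=> pn; elim: k => [|k ih]; first by rewrite muln0 addn0.
  by rewrite mulnS (addnC c) addnA step ?ih // (leq_trans pn) ?leq_addr.
exists (c * p.+1)%N; first by rewrite muln_gt0 c0.
move=> k x; rewrite mulnS -mulnA steps //.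
by apply: leq_trans (leqnSn p) _; rewrite leq_pmull.
Qed.

Lemma mx_dirlim_shift n (M : 'M[int]_n) (i k : nat) (x : 'cV[int]_n) :
  @dirlim_inj (mx_system M) i x = @dirlim_inj (mx_system M) (i + k)%N (iter k (mulmx M) x).
Proof.
rewrite -(@dirlim_inj_map (mx_system M) i (i + k)%N (leq_addr k i) x); congr dirlim_inj.
by rewrite /= /mx_step addKn.
Qed.

Lemma mx_dirlim_eq0 n (M : 'M[int]_n) (i : nat) (x : 'cV[int]_n) :
  @dirlim_inj (mx_system M) i x = 0 <-> exists k, iter k (mulmx M) x = 0.
Proof.
split=> [|[k e]]; last first.
  by rewrite (mx_dirlim_shift M i k) e; exact: dirlim_inj0.
move=> /dirlim_injE[k [hx [hy e]]]; exists (k - i)%N.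
by rewrite -[LHS]/(ds_map (d := mx_system M) hx x) e raddf0.
Qed.

(** * The coinvariants as a direct limit *)

Section CoinvariantsLimit.
Variables (d : nat) (phi : substitution d) (p : nat) (C : 'I_p -> {set S_vertex d}) (P : 'M[int]_d).
Hypotheses (C_components : component_enum phi C) (P_basis : basis_extension C P).
Hypothesis phi_grows : forall k, exists N, forall n a, (N <= n)%N ->
  (k <= size (subst_iter phi n a))%N.
Hypothesis pairs_occur : forall e, e \in S_edges phi ->
  exists x, [/\ allowed_biinf phi x, x (- 1) = e.1 & x 0 = e.2].
Hypothesis letters_occur : forall a, exists x, allowed_biinf phi x /\ x 0 = a.
Variables (ry : (int -> 'I_d) -> int -> 'I_d) (rk : (int -> 'I_d) -> nat).
Hypotheses (rP : forall x, allowed_biinf phi x -> [/\ allowed_biinf phi (ry x),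
        (rk x < size (phi (ry x 0)))%N & x = wshift (rk x)%:Z (wsub phi (ry x))])
  (rE : forall y (k : nat), allowed_biinf phi y -> (k < size (phi (y 0)))%N ->
        ry (wshift k%:Z (wsub phi y)) = y /\ rk (wshift k%:Z (wsub phi y)) = k)
  (r_loc : forall n : nat, exists N : nat, forall x x', allowed_biinf phi x -> allowed_biinf phi x' ->
        agree_on (- N%:Z) N%:Z x x' -> rk x = rk x' /\ agree_on (- n%:Z) n%:Z (ry x) (ry x')).
Local Notation fn := ((int -> 'I_d) -> int).
Local Notation ind := (tower_sum phi).
Local Notation "f ~~ g" := (cohomologous phi f g) (at level 70).
Local Notation g := (S_map phi).
Local Notation A1 := (A1_mx phi p P).
Local Notation proj := (quotient_proj p P).
Local Notation lift := (quotient_lift (p := p) P).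
Local Notation vertex_cut := (vertex_cut phi).
Local Notation colfun y := (fun a => (y : 'cV[int]_d) a 0).

Lemma pair_edge x i : allowed_biinf phi x -> (x i, x (i + 1)) \in S_edges phi.
Proof.
move=> hx; rewrite inE; apply/asboolP; have := hx i 2; rewrite /word_factor /mkseq /=.
by rewrite addr0.
Qed.

Lemma succ_ex a : exists b, (a, b) \in S_edges phi.
Proof. by have [x [hx <-]] := letters_occur a; exists (x 1); have := pair_edge 0 hx. Qed.

Lemma pred_ex b : exists a, (a, b) \in S_edges phi.
Proof.
have [x [hx <-]] := letters_occur b; exists (x (- 1)).
by have := pair_edge (- 1) hx; rewrite addNr.
Qed.

Lemma S_map_edge e : e \in S_edges phi -> g e \in S_edges phi.
Proof.
case: e => a b; rewrite inE => /asboolP h; rewrite inE; apply/asboolP; rewrite /S_map /=.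
have := allowed_subst_ext h; rewrite /subst_ext /= cats0; apply: allowed_infix.
have := subst_nonempty phi a; case/lastP: (phi a) => // w c _.
have := subst_nonempty phi b; case: (phi b) => // c' w' _.
by rewrite last_rcons /=; apply/infixP; exists w, w'; rewrite cat_rcons.
Qed.

Lemma iter_S_map n e : iter n g e =
  (iter n (fun a => last a (phi a)) e.1, iter n (fun b => head b (phi b)) e.2).
Proof. by elim: n => [|n ih]; [case: e | rewrite !iterS ih]. Qed.

Lemma iter_S_map_edge n e : e \in S_edges phi -> iter n g e \in S_edges phi.
Proof. by move=> he; elim: n => // n ih; rewrite iterS S_map_edge. Qed.

Lemma ER_sub_S e : e \in ER_edges phi -> e \in S_edges phi.
Proof. by rewrite inE => /asboolP/(_ 0%N). Qed.

Lemma iter_imset n (A : {set 'I_d * 'I_d}) e :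
  reflect (exists2 e', e' \in A & e = iter n g e')
    (e \in iter n (fun E : {set 'I_d * 'I_d} => g @: E)%SET A).
Proof.
apply: (iffP idP).
  elim: n e => [|n ih] e /=; first by exists e.
  by move=> /imsetP[e1 /ih[e' he' ->] ->]; exists e'.
move=> [e' he' ->]; elim: n => // n ih; rewrite !iterS.
exact: imset_f.
Qed.

Section Idempotent.
Variable m : nat.
Hypothesis m_gt0 : (0 < m)%N.
Hypothesis g_idem : forall k e, iter (m * k.+1) g e = iter m g e.

(** Idempotence puts g^m(e) in the image of every g^n. Together with [ER_fixed], g^m retracts the
    edges of S onto those of ER. *)
Lemma iter_S_map_ER e : e \in S_edges phi -> iter m g e \in ER_edges phi.
Proof.
move=> he; rewrite inE; apply/asboolP => n; apply/iter_imset.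
exists (iter (m * n.+1 - n) g e); first exact: iter_S_map_edge.
rewrite -iterD subnKC ?g_idem //.
by apply: leq_trans (leqnSn n) _; rewrite leq_pmull.
Qed.

Lemma ER_fixed e : e \in ER_edges phi -> iter m g e = e.
Proof.
rewrite inE => /asboolP/(_ m)/iter_imset[e' _ ->].
by rewrite -iterD addnn -mul2n mulnC g_idem.
Qed.

(** The potentials telescope along phi(a), whose inner pairs are edges of S; only its first and last
    letters remain. Hence A^t acts on the quotient, as A_1. *)
Lemma cut_transpose y : vertex_cut y -> vertex_cut ((subst_mx phi)^T *m y).
Proof.
move=> [s [t [h1 h2]]].
exists (fun a => s (last a (phi a))), (fun b => t (head b (phi b))); split.
  by move=> e /S_map_edge/h1.
move=> a; rewrite transpose_mx /transpose.
have := subst_nonempty phi a; have : allowed phi (phi a).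
  by apply/allowedP; exists 1%N, a; rewrite /subst_iter /= /subst_ext /= cats0; apply: infix_refl.
case: (phi a) => // b w hw _ /=.
elim: w b hw => [|c w ih] b hw; first by rewrite big_seq1 h2.
rewrite big_cons ih.
  rewrite h2 /= (h1 (b, c)) /=; first by ring.
  rewrite inE; apply/asboolP; apply: allowed_infix hw.
  by apply/infixP; exists [::], w.
by apply: allowed_infix hw; apply/infixP; exists [:: b], [::]; rewrite cats0.
Qed.

Lemma cut_cohomologous y : vertex_cut y -> cell (colfun y) (fun _ => 0) ~~ (fun _ => 0).
Proof.
move=> [s [t [h1 h2]]]; apply: vertex_coboundary h2 => e he.
by rewrite h1 // subrr.
Qed.

Lemma proj_eq_cohomologous y y' : proj y = proj y' ->
  cell (colfun y) (fun _ => 0) ~~ cell (colfun y') (fun _ => 0).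
Proof.
move=> e; apply/cohomologous_sub0.
have /cut_cohomologous : vertex_cut (y - y').
  apply: (quotient_proj_eq0_cut C_components P_basis succ_ex pred_ex).
  by rewrite quotient_projB e subrr.
by apply: cohomologous_trans; apply: eq_cohomologous => x _; rewrite /cell !mxE; ring.
Qed.

Lemma transpose_colfun y : transpose phi (colfun y) = colfun ((subst_mx phi)^T *m y).
Proof. by apply/funext => a; rewrite transpose_mx. Qed.

Lemma iter_transpose_colfun k y :
  iter k (transpose phi) (colfun y) = colfun (iter k (mulmx (subst_mx phi)^T) y).
Proof. by elim: k => // k ih; rewrite !iterS ih transpose_colfun. Qed.

Lemma iter_tower_lift k x : iter k ind (cell (colfun (lift x)) (fun _ => 0))
  ~~ cell (colfun (lift (iter k (mulmx A1) x))) (fun _ => 0).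
Proof.
elim: k => [|k ih]; first exact: cohomologousxx.
rewrite iterS; apply: cohomologous_trans (cohomologous_tower ih) _.
rewrite tower_cell pull0 transpose_colfun; apply: proj_eq_cohomologous.
by rewrite -A1_mx_quotient (quotient_liftK P_basis) iterS.
Qed.

Lemma proj_iter_transpose k y :
  proj (iter k (mulmx (subst_mx phi)^T) y) = iter k (mulmx A1) (proj y).
Proof.
elim: k => // k ih; rewrite !iterS -ih; set w := iter _ _ _.
rewrite A1_mx_quotient; apply/eqP; rewrite -subr_eq0 -quotient_projB -mulmxBr; apply/eqP.
apply: (cut_quotient_proj_eq0 C_components P_basis succ_ex pred_ex).
apply/cut_transpose/(quotient_proj_eq0_cut C_components P_basis succ_ex pred_ex).
by rewrite quotient_projB (quotient_liftK P_basis) subrr.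
Qed.

(** After enough tower sums the cochain bounds on K; its pair part is 0, so the potentials agree
    along S and the letter part is a cut. *)
Lemma lift_cohomologous0 x : cell (colfun (lift x)) (fun _ => 0) ~~ (fun _ => 0) ->
  exists N, iter N (mulmx A1) x = 0.
Proof.
move=> /(cell_coboundary phi_grows pairs_occur)[N /(_ N (leqnn N))[u' [s [t [eu hst hu]]]]].
exists N; rewrite -[x](quotient_liftK P_basis) -proj_iter_transpose.
apply: (cut_quotient_proj_eq0 C_components P_basis succ_ex pred_ex).
exists s, t; split=> [e he|a].
  by have := hst e he; rewrite /push /= => h; apply/eqP; rewrite -subr_eq0 -h.
rewrite -hu; move: eu; rewrite iter_tower_cell0 iter_transpose_colfun.
by move=> /(congr1 (fun f => f (fun _ => a))); rewrite /cell /push /= !addr0.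
Qed.

Section Splitting.
Variables (l : nat) (kappa : 'cV[int]_l -> 'I_d * 'I_d -> int).
Hypotheses (kappaB : forall z z' e, kappa (z - z') e = kappa z e - kappa z' e)
  (kappa_ex : forall v, exists z s t, forall e, e \in ER_edges phi ->
     v e = kappa z e + (t e.2 - s e.1))
  (kappa_inj : forall z s t, (forall e, e \in ER_edges phi -> kappa z e = t e.2 - s e.1) -> z = 0).

(** The representative of a class of H^1(ER), extended to S through the retraction g^m. *)
Definition cycle_fn (z : 'cV[int]_l) : fn := cell (fun _ => 0) (push phi m (kappa z)).

Lemma cycle_fnB z z' : cycle_fn (z - z') = (fun x => cycle_fn z x - cycle_fn z' x).
Proof. by apply/funext => x; rewrite /cycle_fn /cell /push /= kappaB; ring. Qed.

Lemma cycle_fn0 : cycle_fn 0 = (fun _ => 0).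
Proof.
apply/funext => x; rewrite -[X in cycle_fn X](subrr 0) cycle_fnB.
by rewrite subrr.
Qed.

Lemma loc_const_cell u v : loc_const phi (cell u v).
Proof. by exists 1%N => x y _ _ e; rewrite /cell !e. Qed.

(* The class of f in the coinvariants corresponds to the pair (xi, z): after  *)
(* removing the cycle part z, some iterated tower sum of f is given by a      *)
(* cochain on the letters only, and xi is the class of that cochain.          *)
Definition coinvariant_rel (f : fn) (xz : mx_dirlim A1 * 'cV[int]_l) : Prop :=
  exists n x, xz.1 = @dirlim_inj (mx_system A1) n x /\
    iter n ind (fun w => f w - cycle_fn xz.2 w) ~~ cell (colfun (lift x)) (fun _ => 0).

Lemma coinvariant_rel_shift n k x f :
  iter n ind f ~~ cell (colfun (lift x)) (fun _ => 0) ->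
  iter (n + k) ind f ~~ cell (colfun (lift (iter k (mulmx A1) x))) (fun _ => 0).
Proof.
move=> h; rewrite addnC iterD.
exact: cohomologous_trans (cohomologous_iter_tower k h) (iter_tower_lift k x).
Qed.

Lemma coinvariant_relB f f' xz xz' : coinvariant_rel f xz -> coinvariant_rel f' xz' ->
  coinvariant_rel (fun w => f w - f' w) (xz - xz').
Proof.
move=> [n [x [e h]]] [n' [x' [e' h']]].
exists (n + n')%N, (iter n' (mulmx A1) x - iter n (mulmx A1) x'); split.
  rewrite raddfB /= e e' (mx_dirlim_shift A1 n n' x) (mx_dirlim_shift A1 n' n x').
  rewrite (addnC n' n) dirlim_injD dirlim_injN; reflexivity.
have := cohomologousB (coinvariant_rel_shift n' h) (coinvariant_rel_shift n h').
rewrite (addnC n' n) -iter_towerB => hh.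
apply: cohomologous_trans (cohomologous_trans hh _).
  apply: cohomologous_iter_tower; apply: eq_cohomologous => w _.
  by rewrite raddfB /= cycle_fnB; ring.
by apply: eq_cohomologous => w _; rewrite /cell quotient_liftB !mxE; ring.
Qed.

(** Tower sums first make [f] a pair cochain and then pull it back until it is read on ER, where
    [kappa_ex] gives z. What is left of the pair part comes from vertices and is traded for the
    letter cochain [y]. *)
Lemma coinvariant_rel_total_l f : loc_const phi f -> exists xz, coinvariant_rel f xz.
Proof.
move=> hf; have [N [v hv]] := exists_pair_cochain phi_grows hf.
(* [n] is a multiple of m, so n further steps leave the pair part of the cycle function unchanged,
   and n >= N + m leaves r >= m steps to reach ER. *)
pose n := (m * N.+1)%N; pose r := (n - N)%N.
have Nn : (N + m <= n)%N by rewrite /n mulnS addnC leq_add2l leq_pmull.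
have mr : (m <= r)%N by rewrite leq_subRL // (leq_trans _ Nn) // leq_addr.
have [u1 eu1] := iter_tower_cell phi r (fun _ => 0) v.
pose v1 := push phi (r - m) v.
have [z [s [t hz]]] := kappa_ex v1.
have [u2 eu2] := iter_tower_cell phi n (fun _ => 0) (push phi m (kappa z)).
pose s' a := s (iter m (fun a => last a (phi a)) a).
pose t' b := t (iter m (fun b => head b (phi b)) b).
pose y : 'cV[int]_d := \col_a (u1 a - u2 a - (s' a - t' a)).
exists (@dirlim_inj (mx_system A1) n (proj y), z), n, (proj y); split=> //=.
have h1 : iter n ind f ~~ cell u1 (push phi r v).
  rewrite -eu1 (_ : n = r + N)%N; last by rewrite subnK // (leq_trans _ Nn) // leq_addr.
  by rewrite iterD; apply: cohomologous_iter_tower.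
have h2 : iter n ind (cycle_fn z) ~~ cell u2 (push phi n (push phi m (kappa z))).
  by rewrite /cycle_fn eu2; exact: cohomologousxx.
rewrite iter_towerB; apply: cohomologous_trans (cohomologousB h1 h2) _.
apply: cohomologous_trans (_ : cell (colfun y) (fun _ => 0) ~~ _); last first.
  by apply: proj_eq_cohomologous; rewrite (quotient_liftK P_basis).
pose V e := push phi r v e - push phi n (push phi m (kappa z)) e.
have hV e : e \in S_edges phi -> V e = t' e.2 - s' e.1.
  move=> he; rewrite /V /push /= -iterD.
  have -> : iter (m + n) g e = iter m g e by rewrite /n -mulnS g_idem.
  have -> : v (iter r g e) = v1 (iter m g e).
    by rewrite /v1 /push /= -iterD subnK.
  by rewrite hz ?iter_S_map_ER // {2 3}iter_S_map /=; rewrite /t' /s'; ring.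
have hc : cell (fun a => s' a - t' a) V ~~ (fun _ => 0) by apply: vertex_coboundary hV _.
have := cohomologousB (cohomologousxx phi (cell (fun a => u1 a - u2 a) V)) hc.
move=> hc'; apply: cohomologous_sym; apply: cohomologous_trans (cohomologous_trans hc' _).
  by apply: eq_cohomologous => w _; rewrite /cell mxE; ring.
by apply: eq_cohomologous => w _; rewrite /cell /V; ring.
Qed.

Lemma coinvariant_rel_total_r xz : exists2 f, loc_const phi f & coinvariant_rel f xz.
Proof.
case: xz => xi z; have [n [x ->]] := dirlim_surj xi.
have [f hf ef] := iter_tower_surj rP rE r_loc n
  (loc_const_cell (colfun (lift x)) (fun _ => 0)).
exists (fun w => f w + cycle_fn z w); first by apply: loc_constD => //; exact: loc_const_cell.
exists n, x; split=> //=.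
apply: cohomologous_trans (eq_cohomologous ef).
by apply: cohomologous_iter_tower; apply: eq_cohomologous => w _; rewrite addrK.
Qed.

Lemma coinvariant_rel_eq0r f : loc_const phi f -> coinvariant_rel f 0 -> f ~~ (fun _ => 0).
Proof.
move=> hf [n [x [/esym/mx_dirlim_eq0[k e] h]]].
have := coinvariant_rel_shift k h; rewrite e cycle_fn0 => h'.
apply: (iter_tower_inj rP rE r_loc (n := n + k) hf).
have e0 : quotient_lift (p := p) P 0 = 0.
  by rewrite -[X in quotient_lift _ X](subrr 0) quotient_liftB subrr.
apply: cohomologous_trans (cohomologous_trans h' _).
  by apply: cohomologous_iter_tower; apply: eq_cohomologous => w _; rewrite subr0.
by apply: eq_cohomologous => w _; rewrite /cell e0 mxE addr0.
Qed.

Lemma iter_tower0 n : iter n ind (fun _ => 0) = (fun _ => 0).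
Proof. by elim: n => // n ih; rewrite iterS ih tower0. Qed.

(** Up to letter terms the cycle part bounds on X, hence on K after more tower sums; read on ER it
    is [kappa z], so z = 0. The remaining letter cochain falls under [lift_cohomologous0]. *)
Lemma coinvariant_rel_eq0l f xz : f ~~ (fun _ => 0) -> coinvariant_rel f xz -> xz = 0.
Proof.
case: xz => xi z hf [n [x /= [-> h]]].
have [u2 eu2] := iter_tower_cell phi n (fun _ => 0) (push phi m (kappa z)).
pose u a := u2 a + lift x a 0.
have hu : cell u (push phi n (push phi m (kappa z))) ~~ (fun _ => 0).
  have h1 := cohomologous_iter_tower n hf.
  have := cohomologousB (cohomologousB h1 h)
    (cohomologousxx phi (fun w => - cell (colfun (lift x)) (fun _ => 0) w)).
  rewrite iter_towerB /cycle_fn eu2.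
  rewrite iter_tower0.
  move=> hh; apply: cohomologous_trans (cohomologous_trans hh _).
    by apply: eq_cohomologous => w _; rewrite /cell /u; ring.
  by apply: eq_cohomologous => w _; rewrite /cell; ring.
have [N hN] := cell_coboundary phi_grows pairs_occur hu.
(* N' >= N is such that n + N' is a multiple of m, so that the iterates fix the edges of ER. *)
pose K := (N + n).+1; pose N' := (m * K.+1 - n)%N.
have nK : (N + n <= m * K.+1)%N.
  by apply: leq_trans (leq_trans (leqnSn _) (leqnSn K)) _; rewrite leq_pmull.
have NN' : (N <= N')%N by rewrite leq_subRL ?(leq_trans _ nK) ?leq_addl // addnC.
have [u' [s [t [_ hst _]]]] := hN N' NN'.
have z0 : z = 0.
  apply: (kappa_inj (s := s) (t := t)) => e he; rewrite -hst ?ER_sub_S // /push /= -!iterD.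
  by rewrite -?addnA subnKC ?(leq_trans _ nK) ?leq_addl // -mulnS g_idem ER_fixed.
rewrite {}z0 in h hu *.
have h0 : cell (colfun (lift x)) (fun _ => 0) ~~ (fun _ => 0).
  apply: cohomologous_trans (cohomologous_trans (cohomologous_sym h) (cohomologous_iter_tower n _)) _.
    by rewrite cycle_fn0; apply: cohomologous_trans hf; apply: eq_cohomologous => w _; rewrite subr0.
  by rewrite iter_tower0; exact: cohomologousxx.
have [k hk] := lift_cohomologous0 h0.
by congr (_, _); apply/mx_dirlim_eq0; exists k.
Qed.

End Splitting.
End Idempotent.
End CoinvariantsLimit.

(** * Holonomies of Cech classes *)

Section Lifts.
Variables (R : realType) (d : nat) (phi : substitution d) (omega : 'rV[R]_d).
Hypothesis omega_gt0 : forall a, 0 < omega 0 a.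
Local Notation om := (fun a => omega 0 a).
Local Notation tpos := (tpos om).
Local Notation tiling := (tiling phi omega).
Implicit Types (x y : int -> 'I_d) (T : tiling) (s t : R).

(** A second tile ending before the first would lie inside it and share an interval with it; so the
    common part is [p', p + w], which must be one point. *)
Lemma tile_posS T i : tile_pos T (i + 1) = tile_pos T i + omega 0 (tile_label T i).
Proof.
have [z hz] := tile_meet T i.
have pp : tile_pos T i < tile_pos T (i + 1) by apply: tile_pos_incr; rewrite ltrDl.
move: hz pp; set p := tile_pos T i; set p' := tile_pos T (i + 1).
set w := omega 0 _; set w' := omega 0 (tile_label T (i + 1)) => hz pp.
have w0 : 0 < w by exact: omega_gt0.
have w0' : 0 < w' by exact: omega_gt0.
have inz v : p' <= v -> v <= p + w -> v <= p' + w' -> v = z.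
  move=> h1 h2 h3; have : [set z] v; last by [].
  rewrite -hz; split; rewrite /tile /= in_itv /= -/w -/w' ?h1 ?h2 ?h3 //.
  by rewrite andbT (le_trans (ltW pp)).
have [] : (tile omega p (tile_label T i) `&` tile omega p' (tile_label T (i + 1))) z by rewrite hz.
rewrite /tile /= !in_itv /= -/w -/w' => /andP[_ z1] /andP[z2 z3].
have e1 : p' = z by apply: inz; [exact: lexx | exact: le_trans z1 | rewrite lerDl ltW].
have [h|h] := leP (p + w) (p' + w').
  by rewrite e1 -(inz (p + w)) //; rewrite e1; exact: z1.
have e2 : p' + w' = z by apply: inz; [rewrite lerDl ltW | rewrite ltW | exact: lexx].
by move: w0'; rewrite -(ltrDl p') e2 -e1 ltxx.
Qed.

Lemma tile_posE T i : tile_pos T i = tpos (tile_label T) i + tile_pos T 0.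
Proof.
suff h : (fun i => tile_pos T i - tile_pos T 0) =1 tpos (tile_label T).
  by rewrite -h subrK.
by apply: cum_unique => [|j]; rewrite ?subrr // tile_posS addrAC.
Qed.

Lemma tile_pos_origin T : tile_pos T 0 <= 0 < tile_pos T 1.
Proof.
have [] := tile_origin T; rewrite /tile /= !in_itv /= => /andP[h1 h2] h3.
rewrite h1 /= ltNge; apply/negP => h4; apply: h3; rewrite h4 /=.
have e : tile_pos T 1 = tile_pos T 0 + omega 0 (tile_label T 0) by rewrite -tile_posS add0r.
by rewrite (le_trans h2) // -e lerDl ltW.
Qed.

(** [T] is the image of (x, s) under the quotient map from X x R: [x] laid out with its tile 0
    starting at -s. The shift [k] absorbs the indexing of [T] by the origin. *)
Definition lifts T x s := exists k, (forall i, tile_pos T i = tpos x (i + k) - s) /\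
  (forall i, tile_label T i = x (i + k)).

Lemma lifts_allowed T x s : lifts T x s -> allowed_biinf phi x.
Proof.
move=> [k [_ h]]; have -> : x = wshift (- k) (tile_label T).
  by apply/funext => i; rewrite /wshift h subrK.
exact/allowed_shift/tile_allowed.
Qed.

Lemma lifts_label T : lifts T (tile_label T) (- tile_pos T 0).
Proof. by exists 0; split=> i; rewrite addr0 ?opprK // tile_posE. Qed.

Lemma lifts_shift j T x s : lifts T x s -> lifts T (wshift j x) (s - tpos x j).
Proof.
move=> [k [h1 h2]]; exists (k - j); split=> i.
  by rewrite tpos_shift addrA subrK h1; ring.
by rewrite /wshift addrA subrK h2.
Qed.

Lemma lifts_inj T x y s t : lifts T x s -> lifts T y t ->
  exists k, y = wshift k x /\ t = s - tpos x k.
Proof.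
move=> [k [h1 h2]] [k' [h1' h2']]; exists (k - k'); split.
  by apply/funext => i; have := h2' (i - k'); rewrite subrK h2 /wshift => <-; congr x; ring.
have := h1' (- k'); rewrite addNr h1 tpos0 sub0r (addrC (- k')) => e.
by rewrite -[t]opprK -e opprB.
Qed.

Lemma lifts_fun T T' x s : lifts T x s -> lifts T' x s -> T = T'.
Proof.
move=> [k [h1 h2]] [k' [h1' h2']].
have loc (U : tiling) q : (forall i, tile_pos U i = tpos x (i + q) - s) -> tpos x q <= s < tpos x (q + 1).
  move=> h; have := tile_pos_origin U; rewrite !h add0r (addrC 1).
  by rewrite subr_le0 subr_gt0.
have ek : k = k'.
  by apply: (@cum_locate_unique _ (fun i => omega 0 (x i)) s); [move=> i; exact: omega_gt0|exact: (loc T)|exact: (loc T')].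
have ep : tile_pos T = tile_pos T' by apply/funext => i; rewrite h1 h1' ek.
have el : tile_label T = tile_label T' by apply/funext => i; rewrite h2 h2' ek.
move: ep el {h1 h2 h1' h2'}; case: T => p1 l1 a1 b1 c1 d1 e1; case: T' => p2 l2 a2 b2 c2 d2 e2 /= ep el.
by subst; congr Tiling; exact: Prop_irrelevance.
Qed.

Lemma lifts_ex x s : allowed_biinf phi x -> exists T, lifts T x s.
Proof.
move=> hx; have [k hk] := tpos_locate omega_gt0 x s.
pose z := wshift k x; pose q := s - tpos x k.
have hq : 0 <= q < omega 0 (z 0).
  by move: hk; rewrite /q /z /wshift add0r tposS subr_ge0 ltrBlDl.
have qS i : tpos z (i + 1) - q = tpos z i - q + omega 0 (z i) by rewrite tposS addrAC.
have incr : {homo (fun i => tpos z i - q) : i j / i < j}.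
  by move=> i j ij; rewrite ltrD2r tpos_lt.
have cov : \bigcup_(i : int) tile omega (tpos z i - q) (z i) = [set: R].
  apply/seteqP; split=> // v _; have [i /andP[h1 h2]] := tpos_locate omega_gt0 z (v + q).
  exists i => //; rewrite /tile /= in_itv /= lerBlDr h1 -qS lerBrDr; exact: ltW.
have meet i : exists v, tile omega (tpos z i - q) (z i) `&`
    tile omega (tpos z (i + 1) - q) (z (i + 1)) = [set v].
  exists (tpos z (i + 1) - q); apply/seteqP; split=> v; rewrite /tile /= !in_itv /=.
    move=> [/andP[_ h1] /andP[h2 _]]; apply/eqP; rewrite eq_le h2 andbT.
    by rewrite qS.
  move=> ->; split; apply/andP; split.
  - by rewrite qS lerDl ltW.
  - by rewrite qS.
  - by [].
  - by rewrite lerDl ltW.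
have orig : (tile omega (tpos z 0 - q) (z 0) `\` tile omega (tpos z 1 - q) (z 1)) 0.
  have /andP[h1 h2] := hq.
  have e1 : tpos z 1 = omega 0 (z 0) by rewrite -[1]add0r tposS tpos0 add0r.
  rewrite tpos0 e1 sub0r; split; rewrite /tile /= in_itv /=.
    by rewrite oppr_le0 h1 addrC subr_ge0 ltW.
  by move=> /andP[]; rewrite subr_le0 leNgt h2.
exists (Tiling incr cov meet orig (allowed_shift hx)); exists k; split=> i //=.
by rewrite /z tpos_shift /q opprB addrA subrK.
Qed.

Lemma tile_set_lifts T x s : lifts T x s ->
  tile_set T = range (fun i : int => (tpos x i - s, x i)).
Proof.
move=> [k [h1 h2]]; apply/seteqP; split=> _ [i _ <-].
  by exists (i + k) => //; rewrite h1 h2.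
by exists (i - k) => //; rewrite h1 h2 subrK.
Qed.

(** Continuity of (x, s) |-> T: enough tiles around index 0 cover the ball of radius 1 / delta. *)
Lemma close_of_lifts T x s (delta : R) : lifts T x s -> exists n : nat, forall y t T',
  agree_on (- n%:Z) n%:Z x y -> `|t - s| < delta -> lifts T' y t -> tiling_close delta T T'.
Proof.
move=> hT; have [m [_ [m0 _ hm _]]] := finite_bounds omega_gt0.
pose r := delta^-1.
have [n hn] := real_archi (r + `|s|) m0.
exists n => y t T' e ht hT'; exists (t - s); split=> //.
rewrite (tile_set_lifts hT) (tile_set_lifts hT').
have sub a b (x1 x2 : int -> 'I_d) : agree_on (- n%:Z) n%:Z x1 x2 -> a = s -> b = s ->
    tiling_patch omega r (range (fun i : int => (tpos x1 i - a, x1 i)))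
    `<=` tiling_patch omega r (range (fun i : int => (tpos x2 i - b, x2 i))).
  move=> e12 -> -> _ [[i _ <-] [v []]]; rewrite /tile /= !in_itv /= => /andP[h1 h2] /andP[h3 h4].
  have iup : i < n%:Z.
    rewrite ltNge; apply/negP => ni.
    have : tpos x1 n%:Z <= tpos x1 i by rewrite tpos_le.
    have := @cum_lower _ (fun i => omega 0 (x1 i)) m 0 n (fun i => hm (x1 i)).
    rewrite -/(tpos x1) tpos0 add0r subr0; have := ler_norm s; lra.
  have ilo : - n%:Z <= i.
    rewrite leNgt; apply/negP => ni.
    have : tpos x1 (i + 1) <= tpos x1 (- n%:Z) by rewrite tpos_le // lezD1.
    have := @cum_lower _ (fun i => omega 0 (x1 i)) m (- n%:Z) n (fun i => hm (x1 i)).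
    rewrite -/(tpos x1) addNr tpos0 tposS; have := ler_norm (- s); rewrite normrN; lra.
  have h0 : - n%:Z <= 0 <= n%:Z by clear; lia.
  have hi : - n%:Z <= i < n%:Z by rewrite ilo iup.
  have ei : x1 i = x2 i by apply: e12.
  have et : tpos x1 i = tpos x2 i by apply: (agree_tpos om h0 e12); rewrite ilo ltW.
  split; first by exists i => //; rewrite ei et.
  by exists v; split; rewrite /tile /= in_itv /= ?h1 ?h2 ?h3 ?h4.
have -> : translate (t - s) (range (fun i : int => (tpos y i - t, y i)))
    = range (fun i : int => (tpos y i - s, y i)).
  apply/seteqP; split=> [_ [_ [i _ <-] <-]|_ [i _ <-]] /=.
    by exists i => //; congr (_, _); ring.
  by exists (tpos y i - t, y i); [exists i | congr (_, _); rewrite /=; ring].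
apply/seteqP; split; apply: sub => // i hi; by rewrite e.
Qed.

(** Openness of (x, s) |-> T: closeness matches tile starts up to a translation. With [T']
    re-indexed from the tile matched to tile 0 of [x], the two words agree step by step in both
    directions. *)
Lemma lifts_of_close T x s n (eta : R) : lifts T x s -> 0 < eta ->
  exists delta : R, 0 < delta /\ forall T', tiling_close delta T T' ->
    exists y t, [/\ lifts T' y t, agree_on (- n%:Z) n%:Z x y & `|t - s| < eta].
Proof.
move=> hT eta0; have [_ [M [_ M0 _ hM]]] := finite_bounds omega_gt0.
pose rho := M *+ n + `|s| + 1.
have rho0 : 0 < rho by rewrite ltr_wpDl // addr_ge0 // mulrn_wge0 // ltW.
exists (Num.min eta rho^-1); split; first by rewrite lt_min eta0 invr_gt0.
set delta := Num.min _ _.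
have d0 : 0 < delta by rewrite lt_min eta0 invr_gt0.
have rd : rho <= delta^-1.
  by rewrite -[rho]invrK lef_pV2 ?posrE ?invr_gt0 // ge_min lexx orbT.
move=> T' [eps [heps hpatch]]; have hT' := lifts_label T'.
set y' := tile_label T' in hT'; set t' := - _ in hT'.
rewrite (tile_set_lifts hT) (tile_set_lifts hT') in hpatch.
have close i : - n%:Z <= i <= n%:Z ->
    exists j, tpos x i - s = tpos y' j - t' + eps /\ x i = y' j.
  move=> /andP[i1 i2].
  have : tiling_patch omega delta^-1 (range (fun i : int => (tpos x i - s, x i))) (tpos x i - s, x i).
    split; first by exists i.
    exists (tpos x i - s); split; rewrite /tile /= in_itv /=; first by rewrite lexx lerDl ltW.
    have up : tpos x i <= M *+ n.
      apply: le_trans (_ : tpos x n%:Z <= _); first by rewrite tpos_le.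
      have := @cum_upper _ (fun i => omega 0 (x i)) M 0 n (fun i => hM (x i)).
      by rewrite -/(tpos x) tpos0 add0r subr0.
    have lo : - (M *+ n) <= tpos x i.
      apply: le_trans (_ : tpos x (- n%:Z) <= _); last by rewrite tpos_le.
      have := @cum_upper _ (fun i => omega 0 (x i)) M (- n%:Z) n (fun i => hM (x i)).
      by rewrite -/(tpos x) addNr tpos0 sub0r lerNl.
    have := ler_norm s; have := ler_norm (- s); rewrite normrN.
    by move: up lo rd; rewrite /rho => *; apply/andP; split; lra.
  rewrite hpatch => -[[_ [j _ <-] /= [e1 e2]] _].
  by exists j.
have [j0 [e0 _]] := close 0 ltac:(clear; lia).
pose y := wshift j0 y'; pose t := t' - tpos y' j0.
have ts : t = s + eps by rewrite /t; move: e0; rewrite tpos0; lra.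
exists y, t; split.
- exact: lifts_shift.
- have close' i : - n%:Z <= i <= n%:Z -> exists j, tpos x i = tpos y j /\ x i = y j.
    move=> /close[j [e1 e2]]; exists (j - j0); rewrite /y tpos_shift /wshift !subrK; split=> //.
    by move: e1 ts; rewrite /t; lra.
  have tinj i j : tpos y i = tpos y j -> i = j.
    by apply: (cum_inj (w := fun i => omega 0 (y i))) => k; exact: omega_gt0.
  have up (k : nat) : (k <= n)%N -> tpos x k%:Z = tpos y k%:Z.
    elim: k => [_|k ih hk]; first by rewrite !tpos0.
    have {}ih := ih (ltnW hk).
    have [j [e1 e2]] := close' k%:Z ltac:(clear -hk; lia).
    have ej : j = k%:Z by apply: tinj; rewrite -e1.
    have -> : k.+1%:Z = k%:Z + 1 by clear; lia.
    by rewrite !tposS ih e2 ej.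
  have down (k : nat) : (k <= n)%N -> tpos x (- k%:Z) = tpos y (- k%:Z).
    elim: k => [_|k ih hk]; first by rewrite oppr0 !tpos0.
    have {}ih := ih (ltnW hk).
    have [j [e1 e2]] := close' (- k.+1%:Z) ltac:(clear -hk; lia).
    have ek : - k.+1%:Z + 1 = - k%:Z by clear; lia.
    have ej : j + 1 = - k%:Z by apply: tinj; rewrite tposS -e1 -e2 -ih -tposS ek.
    by rewrite e1 -[j](addrK 1) ej -ek addrK.
  move=> i /andP[i1 i2].
  have [j [e1 e2]] := close' i ltac:(rewrite i1 ltW //).
  rewrite e2; congr y; apply/esym/tinj; rewrite -e1.
  by case: i i1 i2 {e1 e2} => k k1 k2; [apply/esym/up | rewrite NegzE; apply/esym/down]; move: k1 k2; clear; lia.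
- by rewrite ts addrC addKr (lt_le_trans heps) // ge_min lexx.
Qed.

Lemma open_lifts (U : set tiling) T x s : open U -> U T -> lifts T x s ->
  exists (n : nat) (eta : R), 0 < eta /\ forall y t T', agree_on (- n%:Z) n%:Z x y ->
    `|t - s| < eta -> lifts T' y t -> U T'.
Proof.
move=> oU UT hT; have [delta [d0 hd]] := oU T UT.
have [n hn] := close_of_lifts delta hT.
by exists n, delta; split=> // y t T' e h h'; apply/hd/(hn y t).
Qed.

Lemma lifts_open (U : set tiling) :
  (forall T, U T -> exists x s (n : nat) (eta : R), [/\ lifts T x s, 0 < eta &
    forall y t T', agree_on (- n%:Z) n%:Z x y -> `|t - s| < eta -> lifts T' y t -> U T']) ->
  open U.
Proof.
move=> h; suff : tiling_open U by []; move=> T UT.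
have [x [s [n [eta [hT eta0 hU]]]]] := h T UT.
have [delta [d0 hd]] := lifts_of_close n hT eta0.
exists delta; split=> // T' /hd[y [t [h1 h2 h3]]].
exact: (hU y t).
Qed.

End Lifts.

(** * Compactness arguments on intervals and on the subshift *)

Lemma interval_induction (R : realType) (Q : R -> R -> Prop) :
  (forall p q r, p <= q -> q <= r -> Q p q -> Q q r -> Q p r) ->
  (forall s, exists2 eta, 0 < eta & forall p q, s - eta < p -> p <= q -> q < s + eta -> Q p q) ->
  forall p q, p <= q -> Q p q.
Proof.
move=> glue loc p q pq.
pose A := [set t | p <= t <= q /\ Q p t].
have Ap : A p.
  split; first by rewrite lexx.
  by have [eta e0 h] := loc p; apply: h; rewrite ?ltrBlDr ?ltrDl.
have supA : has_sup A.
  by split; [exists p | exists q => t [/andP[]]].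
have pS : p <= sup A by apply: sup_upper_bound.
have Sq : sup A <= q by apply: ge_sup; [exists p | move=> t [/andP[]]].
have [eta e0 h] := loc (sup A).
have [t [/andP[pt tq] Qpt] tS] := sup_adherent e0 supA.
have tsup : t <= sup A by apply: sup_upper_bound => //; split => //; rewrite pt.
have step r : t <= r -> r < sup A + eta -> Q p r.
  by move=> tr rS; apply: (glue p t r) => //; apply: h.
have [qS|qS] := ltP q (sup A + eta); first exact: step.
have hr : sup A < sup A + eta / 2 by rewrite ltrDl divr_gt0.
have : A (sup A + eta / 2).
  split; last by apply: step; [rewrite (le_trans tsup) // ltW | rewrite ltrD2l; lra].
  by rewrite (le_trans pS (ltW hr)); apply: le_trans qS; rewrite lerD2l; lra.
by move=> /(sup_upper_bound supA); rewrite leNgt hr.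
Qed.

Section Uniformity.
Variables (d : nat) (phi : substitution d).

(** Counterexamples for every window size would accumulate at an allowed word, whose own window size
    serves nearby. *)
Lemma allowed_uniform (Q : nat -> (int -> 'I_d) -> Prop) :
  (forall (n m : nat) x y, (n <= m)%N -> allowed_biinf phi x -> allowed_biinf phi y ->
    agree_on (- n%:Z) n%:Z x y -> Q n x -> Q m y) ->
  (forall x, allowed_biinf phi x -> exists n, Q n x) ->
  exists n, forall x, allowed_biinf phi x -> Q n x.
Proof.
move=> Qmono Qex; apply: contrapT => no.
have /choice[z hz] : forall N, exists x, allowed_biinf phi x /\ ~ Q N x.
  move=> N; apply: contrapT => h; apply: no; exists N => x hx.
  by apply: contrapT => h'; apply: h; exists x.
have [y hy] := frequently_window z.
have hay : allowed_biinf phi y.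
  by apply: allowed_closed => n; have [N _ e] := hy n 0%N; exists (z N) => //; case: (hz N).
have [n Qn] := Qex y hay; have [N nN e] := hy n n.
have [h1 h2] := hz N; apply: h2; apply: (Qmono n N y) => //.
by move=> i /e.
Qed.

Lemma loc_const_pointwise (f : (int -> 'I_d) -> int) :
  (forall x, allowed_biinf phi x -> exists n : nat, forall y, allowed_biinf phi y ->
    agree_on (- n%:Z) n%:Z x y -> f y = f x) -> loc_const phi f.
Proof.
move=> h.
have [|n hn] := @allowed_uniform (fun n x => forall y, allowed_biinf phi y ->
    agree_on (- n%:Z) n%:Z x y -> f y = f x) _ h.
  move=> n m x y nm hx hy e hQ z hz e'; rewrite (hQ y hy e) (hQ z hz) // => i hi.
  by rewrite e // e' //; move: nm hi; clear; lia.
by exists n => x y hx hy e; rewrite (hn x hx y).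
Qed.

End Uniformity.

(** * Primitives of Cech cocycles and their holonomies *)

Section Holonomy.
Variables (R : realType) (d : nat) (phi : substitution d) (omega : 'rV[R]_d).
Hypothesis omega_gt0 : forall a, 0 < omega 0 a.
Local Notation om := (fun a => omega 0 a).
Local Notation tpos := (tpos om).
Local Notation tiling := (tiling phi omega).
Local Notation lifts := (@lifts R d phi omega).
Local Notation word := (int -> 'I_d).
Implicit Types (x y : word) (T : tiling) (s t : R) (U : open_cover tiling)
  (u v w : set tiling) (S : set word) (b : word -> R -> set tiling -> int).

(* A primitive of the cochain c after pulling back to S x [p, q] along        *)
(* (x, s) |-> x - s; as S x [p, q] may be disconnected, b is only required to *)
(* be locally constant.                                                       *)
Definition trivializes U (c : cochain1 tiling) S (p q : R) b :=
  (forall u T x s, cover_mem U u -> lifts T x s -> u T -> S x -> p <= s <= q ->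
    exists (n : nat) (eta : R), 0 < eta /\ forall y t, S y ->
      agree_on (- n%:Z) n%:Z x y -> `|t - s| < eta -> p <= t <= q -> b y t u = b x s u) /\
  (forall u v T x s, cover_mem U u -> cover_mem U v -> lifts T x s -> u T -> v T ->
    S x -> p <= s <= q -> c u v = b x s v - b x s u).

Definition cylinder (n : nat) x : set word :=
  [set y | allowed_biinf phi y /\ agree_on (- n%:Z) n%:Z x y].

Lemma agree_onWn (n m : nat) x y : (n <= m)%N ->
  agree_on (- m%:Z) m%:Z x y -> agree_on (- n%:Z) n%:Z x y.
Proof. by move=> nm; apply: agree_onW; move: nm; clear; lia. Qed.

Lemma agree_on_sym (a a' : int) x y : agree_on a a' x y -> agree_on a a' y x.
Proof. by move=> e i /e. Qed.

Lemma agree_on_trans (a a' : int) x y z : agree_on a a' x y -> agree_on a a' y z -> agree_on a a' x z.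
Proof. by move=> e e' i hi; rewrite e ?e'. Qed.

Lemma cylinder_sub (n m : nat) x y : (n <= m)%N -> agree_on (- n%:Z) n%:Z x y ->
  cylinder m y `<=` cylinder n x.
Proof.
move=> nm e z [hz e']; split=> //.
by apply: agree_on_trans e _; apply: agree_onWn e'.
Qed.

Lemma cylinder_eq n x y : agree_on (- n%:Z) n%:Z x y -> cylinder n x = cylinder n y.
Proof.
move=> e; apply/seteqP; split; apply: cylinder_sub => //.
exact: agree_on_sym.
Qed.

Lemma cover_ex U T : exists2 u, cover_mem U u & u T.
Proof.
have : [set: tiling] T by [].
by rewrite -(cover_total U) => -[u hu uT]; exists u.
Qed.

Lemma trivializesS U c S S' p q b : S' `<=` S -> trivializes U c S p q b ->
  trivializes U c S' p q b.
Proof.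
move=> sS [h1 h2]; split.
  move=> u T x s hu hT uT /sS Sx hs; have [n [eta [e0 h]]] := h1 u T x s hu hT uT Sx hs.
  by exists n, eta; split=> // y t /sS; apply: h.
by move=> u v T x s hu hv hT uT vT /sS Sx hs; apply: (h2 u v T).
Qed.

(** A small box around (x, s) maps into a single member u0 of the cover, and c(u0, .) is a primitive
    there. *)
Lemma trivializes_local U (c : cocycle U) x s : allowed_biinf phi x ->
  exists n b, exists2 eta, 0 < eta & forall p q, s - eta < p -> q < s + eta ->
    trivializes U (val c) (cylinder n x) p q b.
Proof.
move=> hx; have [T hT] := lifts_ex omega_gt0 s hx; have [u0 hu0 uT] := cover_ex U T.
have [n [eta [e0 h]]] := open_lifts omega_gt0 (cover_open hu0) uT hT.
exists n, (fun _ _ u => val c u0 u), eta => // p q hp hq; split.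
  by move=> u T' y t *; exists 0%N, 1.
move=> u v T' y t hu hv hT' uT' vT' [_ e] /andP[pt tq].
have u0T' : u0 T'.
  by apply: h e _ hT'; rewrite ltr_norml; apply/andP; split; lra.
have /asboolP hc := cocycleP c.
have := hc u0 u v hu0 hu hv (ex_intro _ T' (conj (conj u0T' uT') vT')).
by rewrite /=; lra.
Qed.

(** At level q the primitives differ by [k y], independent of the member as both have coboundary
    [c], and locally constant in y; it is added to the second one. *)
Lemma trivializes_glue U c S (p q r : R) b1 b2 : S `<=` allowed_biinf phi ->
  p <= q -> q <= r ->
  trivializes U c S p q b1 -> trivializes U c S q r b2 -> exists b, trivializes U c S p r b.
Proof.
move=> SX pq qr [a1 d1] [a2 d2].
have qpq : p <= q <= q by rewrite pq lexx.
have qqr : q <= q <= r by rewrite qr lexx.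
have /choice[m hm] : forall y, exists m, S y -> cover_mem U m /\ exists2 T, lifts T y q & m T.
  move=> y; have [Sy|nSy] := pselect (S y); last by exists set0.
  have [T hT] := lifts_ex omega_gt0 q (SX _ Sy); have [u hu uT] := cover_ex U T.
  by exists u => _; split=> //; exists T.
pose k y := b1 y q (m y) - b2 y q (m y).
have kE y u T : S y -> cover_mem U u -> lifts T y q -> u T -> b1 y q u - b2 y q u = k y.
  move=> Sy hu hT uT; have [hmy [T' hT' mT']] := hm y Sy.
  rewrite (lifts_fun omega_gt0 hT' hT) in mT'.
  have := d1 (m y) u T y q hmy hu hT mT' uT Sy qpq.
  have := d2 (m y) u T y q hmy hu hT mT' uT Sy qqr.
  by rewrite /k => ->; move: (b1 _ _ _) (b1 _ _ _) (b2 _ _ _) (b2 _ _ _); clear; lia.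
have k_loc x : S x -> exists n : nat, forall y, S y -> agree_on (- n%:Z) n%:Z x y -> k y = k x.
  move=> Sx; have [hmx [T hT mT]] := hm x Sx.
  have [n1 [eta1 [e1 h1]]] := a1 _ _ _ _ hmx hT mT Sx qpq.
  have [n2 [eta2 [e2 h2]]] := a2 _ _ _ _ hmx hT mT Sx qqr.
  have [n3 [eta3 [e3 h3]]] := open_lifts omega_gt0 (cover_open hmx) mT hT.
  exists (n1 + n2 + n3)%N => y Sy e.
  have [T' hT'] := lifts_ex omega_gt0 q (SX _ Sy).
  have en1 : agree_on (- n1%:Z) n1%:Z x y by apply: agree_onWn e; clear; lia.
  have en2 : agree_on (- n2%:Z) n2%:Z x y by apply: agree_onWn e; clear; lia.
  have en3 : agree_on (- n3%:Z) n3%:Z x y by apply: agree_onWn e; clear; lia.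
  have mT' : m x T' by apply: (h3 y q T' en3) => //; rewrite subrr normr0.
  rewrite -(kE y (m x) T') // (h1 y q) ?subrr ?normr0 // (h2 y q) ?subrr ?normr0 //.
exists (fun y t u => if t <= q then b1 y t u else b2 y t u + k y); split; last first.
  move=> u v T x s hu hv hT uT vT Sx /andP[ps sr]; case: (leP s q) => sq.
    by rewrite (d1 u v T x s) // ps.
  rewrite (d2 u v T x s) // ?(ltW sq) //.
  by move: (b2 _ _ _) (b2 _ _ _) (k x); clear; lia.
move=> u T x s hu hT uT Sx /andP[ps sr].
have [nk hk] := k_loc x Sx.
case: (ltgtP s q) => sq.
- have hs : p <= s <= q by rewrite ps ltW.
  have [n [eta [e0 h]]] := a1 _ _ _ _ hu hT uT Sx hs.
  exists n, (Num.min eta (q - s)); split; first by rewrite lt_min e0 subr_gt0.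
  move=> y t Sy e; rewrite lt_min => /andP[te tq] /andP[pt tr].
  have tq' : t <= q by move: tq; rewrite ltr_norml => /andP[_]; lra.
  by rewrite tq'; apply: h => //; rewrite pt.
- have hs : q <= s <= r by rewrite sr ltW.
  have [n [eta [e0 h]]] := a2 _ _ _ _ hu hT uT Sx hs.
  exists (n + nk)%N, (Num.min eta (s - q)); split; first by rewrite lt_min e0 subr_gt0.
  move=> y t Sy e; rewrite lt_min => /andP[te tq] /andP[pt tr].
  have tq' : q < t by move: tq; rewrite ltr_norml => /andP[]; lra.
  rewrite leNgt tq' /= hk //; last by apply: agree_onWn e; clear; lia.
  congr (_ + _); apply: h => //; last by rewrite (ltW tq').
  by apply: agree_onWn e; clear; lia.
- rewrite {s}sq in hT ps sr *.
  have [n1 [eta1 [e1 h1]]] := a1 _ _ _ _ hu hT uT Sx qpq.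
  have [n2 [eta2 [e2 h2]]] := a2 _ _ _ _ hu hT uT Sx qqr.
  exists (n1 + n2 + nk)%N, (Num.min eta1 eta2); split; first by rewrite lt_min e1.
  move=> y t Sy e; rewrite lt_min => /andP[te1 te2] /andP[pt tr].
  case: (leP t q) => tq.
    by apply: h1 => //; [apply: agree_onWn e; clear; lia | rewrite pt].
  rewrite hk //; last by apply: agree_onWn e; clear; lia.
  rewrite -(kE x u T) // (h2 y t) //; first by rewrite addrC subrK.
    by apply: agree_onWn e; clear; lia.
  by rewrite (ltW tq).
Qed.

Lemma trivializes_ex U (c : cocycle U) (p q : R) : p <= q ->
  exists b, trivializes U (val c) (allowed_biinf phi) p q b.
Proof.
move=> pq.
have hx x : allowed_biinf phi x -> exists n b, trivializes U (val c) (cylinder n x) p q b.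
  move=> hx; move: p q pq; apply: interval_induction => [p q r pq qr [n [b h]] [n' [b' h']]|s].
    have [||| b'' h''] := @trivializes_glue U (val c) (cylinder (n + n') x) p q r b b' _ pq qr.
    - by move=> y [].
    - by apply: trivializesS h; apply: cylinder_sub => //; exact: leq_addr.
    - by apply: trivializesS h'; apply: cylinder_sub => //; exact: leq_addl.
    by exists (n + n')%N, b''.
  have [n [b [eta e0 h]]] := trivializes_local c s hx.
  by exists eta => // p q h1 _ h2; exists n, b; apply: h.
have [|n hn] := @allowed_uniform _ phi
    (fun n x => exists b, trivializes U (val c) (cylinder n x) p q b) _ hx.
  move=> n m x y nm _ _ e [b hb]; exists b; apply: trivializesS hb.
  exact: cylinder_sub.
(* Choosing per cylinder, and not per word, gives all words of a cylinder the same primitive. *)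
have /choice[B hB] : forall S, exists b, (exists b, trivializes U (val c) S p q b) ->
    trivializes U (val c) S p q b.
  move=> S; have [[b hb]|no] := pselect (exists b, trivializes U (val c) S p q b).
    by exists b.
  by exists (fun _ _ _ => 0) => /no.
have {}hB x : allowed_biinf phi x -> trivializes U (val c) (cylinder n x) p q (B (cylinder n x)).
  by move=> h; apply/hB/hn.
exists (fun y t u => B (cylinder n y) y t u); split.
  move=> u T x s hu hT uT Sx hs; have [h _] := hB x Sx.
  have Cx : cylinder n x x by [].
  have [n' [eta [e0 {}h]]] := h u T x s hu hT uT Cx hs.
  exists (n + n')%N, eta; split=> // y t Sy e ht hst.
  have en : agree_on (- n%:Z) n%:Z x y by apply: agree_onWn e; clear; lia.
  rewrite -(cylinder_eq en); apply: h => //.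
  by apply: agree_onWn e; clear; lia.
move=> u v T x s hu hv hT uT vT Sx hs; have [_ h] := hB x Sx.
exact: (h u v T).
Qed.

Variable M : R.
Hypothesis M_ge : forall a, omega 0 a <= M.

(** (x, omega of x_0) and (shift x, 0) lift the same tiling and both lie in the strip; [f] compares
    the primitive there. *)
Definition holonomy U (c : cochain1 tiling) b (f : word -> int) :=
  trivializes U c (allowed_biinf phi) 0 M b /\
  forall x T u, lifts T x (omega 0 (x 0)) -> cover_mem U u -> u T ->
    b (wshift 1 x) 0 u - b x (omega 0 (x 0)) u = f x.

Lemma om_in_range x : 0 <= omega 0 (x 0) <= M.
Proof. by rewrite M_ge andbT ltW. Qed.

Lemma zero_in_range x : (0 : R) <= 0 <= M.
Proof. by rewrite lexx (le_trans _ (M_ge (x 0))) // ltW. Qed.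

Lemma tpos1 x : tpos x 1 = omega 0 (x 0).
Proof. by rewrite -[1]add0r tposS tpos0 add0r. Qed.

Lemma lifts_next T x : lifts T x (omega 0 (x 0)) -> lifts T (wshift 1 x) 0.
Proof. by move=> /(lifts_shift 1); rewrite tpos1 subrr. Qed.

Lemma holonomy_ex U (c : cocycle U) : 0 <= M -> exists b f, loc_const phi f /\ holonomy U (val c) b f.
Proof.
move=> M0; have [b [hb1 hb2]] := trivializes_ex c M0.
have /choice[m hm] : forall x, exists m, allowed_biinf phi x ->
    cover_mem U m /\ exists2 T, lifts T x (omega 0 (x 0)) & m T.
  move=> x; have [hx|nx] := pselect (allowed_biinf phi x); last by exists set0.
  have [T hT] := lifts_ex omega_gt0 (omega 0 (x 0)) hx; have [u hu uT] := cover_ex U T.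
  by exists u => _; split=> //; exists T.
pose f x := b (wshift 1 x) 0 (m x) - b x (omega 0 (x 0)) (m x).
have fE x T u : lifts T x (omega 0 (x 0)) -> cover_mem U u -> u T ->
    b (wshift 1 x) 0 u - b x (omega 0 (x 0)) u = f x.
  move=> hT hu uT; have hx := lifts_allowed hT; have [hmx [T' hT' mT']] := hm x hx.
  rewrite (lifts_fun omega_gt0 hT' hT) in mT'.
  have := hb2 (m x) u T x _ hmx hu hT mT' uT hx (om_in_range x).
  have := hb2 (m x) u T _ _ hmx hu (lifts_next hT) mT' uT (allowed_shift hx) (zero_in_range x).
  by rewrite /f => ->; move: (b _ _ _) (b _ _ _) (b _ _ _) (b _ _ _); clear; lia.
exists b, f; split; last by split.
apply: loc_const_pointwise => x hx; have [hmx [T hT mT]] := hm x hx.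
have [n1 [eta1 [e1 h1]]] := hb1 _ _ _ _ hmx hT mT hx (om_in_range x).
have [n2 [eta2 [e2 h2]]] :=
  hb1 _ _ _ _ hmx (lifts_next hT) mT (allowed_shift hx) (zero_in_range x).
have [n3 [eta3 [e3 h3]]] := open_lifts omega_gt0 (cover_open hmx) mT hT.
exists (n1 + n2.+1 + n3)%N => y hy e.
have e0 : x 0 = y 0 by apply: e; clear; lia.
have [T' hT'] := lifts_ex omega_gt0 (omega 0 (y 0)) hy.
have en1 : agree_on (- n1%:Z) n1%:Z x y by apply: agree_onWn e; clear; lia.
have en2 : agree_on (- n2%:Z) n2%:Z (wshift 1 x) (wshift 1 y).
  by move=> i hi; apply: e; move: hi; clear; lia.
have en3 : agree_on (- n3%:Z) n3%:Z x y by apply: agree_onWn e; clear; lia.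
have mT' : m x T' by apply: (h3 y _ T' en3 _ hT'); rewrite -e0 subrr normr0.
rewrite -(fE y T' (m x)) // (h1 y) ?(om_in_range y) -?e0 ?subrr ?normr0 //.
by rewrite (h2 (wshift 1 y)) ?subrr ?normr0 ?(zero_in_range x) //; exact: allowed_shift.
Qed.

End Holonomy.

(** * A class vanishes exactly when its holonomy is a coboundary *)

Section CechRelation.
Variables (R : realType) (d : nat) (phi : substitution d) (omega : 'rV[R]_d).
Hypothesis omega_gt0 : forall a, 0 < omega 0 a.
Local Notation om := (fun a => omega 0 a).
Local Notation tpos := (tpos om).
Local Notation tiling := (tiling phi omega).
Local Notation lifts := (@lifts R d phi omega).
Local Notation word := (int -> 'I_d).
Implicit Types (x y : word) (T : tiling) (s t : R) (U : open_cover tiling)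
  (u v w : set tiling) (S : set word) (b : word -> R -> set tiling -> int).
Variable M : R.
Hypothesis M_ge : forall a, omega 0 a <= M.
Local Notation trivializes := (@trivializes R d phi omega).
Local Notation holonomy := (@holonomy R d phi omega M).

Definition cech_class U (c : cocycle U) : cech_H1 tiling :=
  @dirlim_inj (cech_system tiling) U (\pi_(nerve_H1 U) c)%qT.

Lemma cech_class_pullback U W (h : refines U W) (c : cocycle U) :
  cech_class (pullback h c) = cech_class c.
Proof.
rewrite /cech_class -nerve_H1_map_pi.
exact: (@dirlim_inj_map (cech_system tiling) U W h).
Qed.

Lemma cech_classB U (c c' : cocycle U) : cech_class (c - c') = cech_class c - cech_class c'.
Proof. by rewrite /cech_class raddfB dirlim_injD dirlim_injN. Qed.

Lemma cech_class_coboundary U (c : cocycle U) : is_coboundary U (val c) -> cech_class c = 0.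
Proof.
move=> h; rewrite /cech_class (_ : (\pi_(nerve_H1 U) c)%qT = 0) ?dirlim_inj0 //.
rewrite -[0](raddf0 (\pi_(nerve_H1 U))%qT); apply/nerve_H1_eq.
by rewrite subr0.
Qed.

Lemma cech_class_eq0 U (c : cocycle U) : cech_class c = 0 ->
  exists W (h : refines U W), is_coboundary W (val (pullback h c)).
Proof.
move=> /dirlim_injE[W [h [h' e]]]; exists W, h.
move: e; rewrite raddf0 [LHS]/= nerve_H1_map_pi => e.
have /nerve_H1_eq : (\pi_(nerve_H1 W) (pullback h c) = \pi_(nerve_H1 W) 0)%qT.
  by rewrite e raddf0.
by rewrite subr0.
Qed.

Definition cech_rel (alpha : cech_H1 tiling) (f : word -> int) :=
  exists U (c : cocycle U) b, alpha = cech_class c /\ holonomy U (val c) b f.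

Lemma holonomy_pullback U W (h : refines U W) (c : cocycle U) b f : holonomy U (val c) b f ->
  holonomy W (val (pullback h c)) (fun x s w => b x s (refinement_map U w)) f.
Proof.
move=> [[ha hb] hc]; split; first split.
- move=> u T x s hu hT uT; have [h1 h2] := refinement_mapP h hu.
  by apply: (ha _ T x s) => //; exact: h2.
- move=> u v T x s hu hv hT uT vT Sx hs.
  have [h1 h2] := refinement_mapP h hu; have [h1' h2'] := refinement_mapP h hv.
  by apply: (hb _ _ T) => //; [exact: h2 | exact: h2'].
- move=> x T u hT hu uT; have [h1 h2] := refinement_mapP h hu.
  by apply: (hc x T) => //; exact: h2.
Qed.

Lemma cech_relB alpha alpha' f f' : cech_rel alpha f -> cech_rel alpha' f' ->
  cech_rel (alpha - alpha') (fun x => f x - f' x).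
Proof.
move=> [U [c [b [-> h]]]] [U' [c' [b' [-> h']]]].
have [W [hW hW']] := refines_directed U U'.
have {b h} [b h] : exists b, holonomy W (val (pullback hW c)) b f.
  by eexists; exact: holonomy_pullback h.
have {b' h'} [b' h'] : exists b, holonomy W (val (pullback hW' c')) b f'.
  by eexists; exact: holonomy_pullback h'.
rewrite -(cech_class_pullback hW) -(cech_class_pullback hW') -cech_classB.
move: (pullback hW c) (pullback hW' c') h h' => {c hW} c {c' hW'} c'.
move=> [[ha hb] hc] [[ha' hb'] hc'].
exists W, (c - c'), (fun x s w => b x s w - b' x s w); split=> //; split; first split.
- move=> u T x s hu hT uT Sx hs.
  have [n [eta [e0 h]]] := ha u T x s hu hT uT Sx hs.
  have [n' [eta' [e0' h']]] := ha' u T x s hu hT uT Sx hs.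
  exists (n + n')%N, (Num.min eta eta'); split; first by rewrite lt_min e0.
  move=> y t Sy e; rewrite lt_min => /andP[t1 t2] ht.
  rewrite h ?h' //; first by apply: agree_onWn e; clear; lia.
  by apply: agree_onWn e; clear; lia.
- move=> u v T x s hu hv hT uT vT Sx hs.
  rewrite raddfB /= !fctE (hb u v T x s) // (hb' u v T x s) //.
  by ring.
- move=> x T u hT hu uT; rewrite -(hc x T u) // -(hc' x T u) //.
  by ring.
Qed.

(** b - beta does not depend on the member: it is a locally constant function h on the strip,
    constant in s by connectedness, and f is the coboundary of h(., 0). *)
Lemma holonomy_coboundary U (c : cochain1 tiling) b f : 0 <= M -> is_coboundary U c ->
  holonomy U c b f -> cohomologous phi f (fun _ => 0).
Proof.
move=> M0 [beta hbeta] [[ha hb] hc].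
have /choice[m hm] : forall xs : word * R, exists m, allowed_biinf phi xs.1 ->
    cover_mem U m /\ exists2 T, lifts T xs.1 xs.2 & m T.
  move=> [x s]; have [hx|nx] := pselect (allowed_biinf phi x); last by exists set0.
  have [T hT] := lifts_ex omega_gt0 s hx; have [u hu uT] := cover_ex U T.
  by exists u => _; split=> //; exists T.
pose h x s := b x s (m (x, s)) - beta (m (x, s)).
have hE x s T u : 0 <= s <= M -> lifts T x s -> cover_mem U u -> u T -> b x s u - beta u = h x s.
  move=> hs hT hu uT; have hx := lifts_allowed hT; have [hmx [T' hT' mT']] := hm (x, s) hx.
  rewrite (lifts_fun omega_gt0 hT' hT) in mT'.
  have := hb _ u T x s hmx hu hT mT' uT hx hs.
  rewrite hbeta //; last by exists T.
  by rewrite /h; move: (b _ _ _) (b _ _ _) (beta _) (beta _); clear; move=> *; lia.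
have h_loc x s : allowed_biinf phi x -> 0 <= s <= M -> exists (n : nat) (eta : R), 0 < eta /\
    forall y t, allowed_biinf phi y -> agree_on (- n%:Z) n%:Z x y -> `|t - s| < eta ->
      0 <= t <= M -> h y t = h x s.
  move=> hx hs; have [hmx [T hT mT]] := hm (x, s) hx.
  have [n [eta [e0 h1]]] := ha _ T x s hmx hT mT hx hs.
  have [n' [eta' [e0' h2]]] := open_lifts omega_gt0 (cover_open hmx) mT hT.
  exists (n + n')%N, (Num.min eta eta'); split; first by rewrite lt_min e0.
  move=> y t hy e; rewrite lt_min => /andP[t1 t2] ht.
  have [T' hT'] := lifts_ex omega_gt0 t hy.
  have en : agree_on (- n%:Z) n%:Z x y by apply: agree_onWn e; clear; lia.
  have en' : agree_on (- n'%:Z) n'%:Z x y by apply: agree_onWn e; clear; lia.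
  by rewrite -(hE y t T' (m (x, s))) ?h1 //; apply: (h2 y t T').
have h_const x s : allowed_biinf phi x -> 0 <= s <= M -> h x s = h x 0.
  move=> hx hs.
  (* Constancy on the part of [p, q] inside [0, M], since [interval_induction] asks for a local
     statement at every real point. *)
  pose Q (p q : R) := forall t t', p <= t <= q -> p <= t' <= q ->
    0 <= t <= M -> 0 <= t' <= M -> h x t = h x t'.
  have : Q 0 M; last by apply => //; rewrite lexx.
  move: M0; apply: (interval_induction (Q := Q)) => [p q r pq qr Qpq Qqr|s0].
    have cross t t' : p <= t <= q -> q <= t' <= r -> 0 <= t <= M -> 0 <= t' <= M -> h x t = h x t'.
      move=> /andP[t1 t2] /andP[t3 t4] /andP[t5 t6] /andP[t7 t8].
      have hq : 0 <= q <= M by rewrite (le_trans t5) //= (le_trans t3).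
      rewrite (Qpq t q) ?(Qqr q t') // ?t1 ?t2 ?t3 ?t4 ?t5 ?t6 ?t7 ?t8 ?lexx ?pq ?qr //.
    move=> t t' /andP[t1 t2] /andP[t3 t4] ht ht'.
    have [tq|tq] := leP t q; have [tq'|tq'] := leP t' q.
    - by apply: Qpq => //; rewrite ?t1 ?t3.
    - by apply: cross => //; rewrite ?t1 ?t4 ?(ltW tq').
    - by apply/esym/cross => //; rewrite ?t3 ?t2 ?(ltW tq).
    - by apply: Qqr => //; rewrite ?t2 ?t4 ?(ltW tq) ?(ltW tq').
  have [s00|s00] := ltP s0 0.
    exists (- s0); first by rewrite oppr_gt0.
    move=> p q _ _ hq t t' /andP[_ tq] _ /andP[t0 _]; move: hq; rewrite subrr => hq.
    by have := lt_le_trans hq (le_trans t0 tq); rewrite ltxx.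
  have [s0M|s0M] := ltP M s0.
    exists (s0 - M); first by rewrite subr_gt0.
    move=> p q hp _ _ t t' /andP[pt _] _ /andP[_ tM].
    have : M < M; last by rewrite ltxx.
    by move: hp pt tM; rewrite opprB addrC subrK => h1 h2 h3; apply: lt_le_trans (le_trans h2 h3).
  have [|n [eta [e0 hn]]] := h_loc x s0 hx; first by rewrite s00.
  exists eta => // p q hp pq hq t t' /andP[t1 t2] /andP[t3 t4] ht ht'.
  by rewrite (hn x t) ?(hn x t') // ltr_norml; apply/andP; split; lra.
apply/cohomologous0; exists (fun x => h x 0).
  apply: loc_const_pointwise => x hx.
  have [n [eta [e0 hn]]] := h_loc x 0 hx (zero_in_range omega_gt0 M_ge x).
  exists n => y hy e; apply: hn => //; first by rewrite subrr normr0.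
  exact: (zero_in_range omega_gt0 M_ge x).
move=> x hx; have [T hT] := lifts_ex omega_gt0 (omega 0 (x 0)) hx; have [u hu uT] := cover_ex U T.
have h0 := zero_in_range omega_gt0 M_ge x; have h1 := om_in_range omega_gt0 M_ge x.
rewrite -(hc x T u) // -(h_const x _ hx h1) -(hE _ _ _ _ h1 hT hu uT).
rewrite -(hE _ _ _ _ h0 (lifts_next hT) hu uT).
by ring.
Qed.

Lemma cech_rel_eq0l f : 0 <= M -> cech_rel 0 f -> cohomologous phi f (fun _ => 0).
Proof.
move=> M0 [U [c [b [/esym/cech_class_eq0[W [h hW]] hol]]]].
exact: holonomy_coboundary M0 hW (holonomy_pullback h hol).
Qed.

Lemma canonical_range T : 0 <= - tile_pos T 0 < omega 0 (tile_label T 0).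
Proof.
have := tile_pos_origin omega_gt0 T; rewrite oppr_ge0 -[1]add0r tile_posS // => /andP[-> h].
by rewrite ltrNl -subr_gt0 opprK.
Qed.

Lemma canonical_unique T y t : lifts T y t -> 0 <= t < omega 0 (y 0) ->
  y = tile_label T /\ t = - tile_pos T 0.
Proof.
move=> hT ht; have hT' := lifts_label omega_gt0 T; have h := canonical_range T.
have [k [e1 e2]] := lifts_inj hT' hT.
suff k0 : k = 0 by rewrite e1 e2 k0 wshift0 tpos0 subr0.
apply: (@cum_locate_unique _ (fun i => omega 0 (tile_label T i)) (- tile_pos T 0)) => //.
  move: ht; rewrite e2 e1 /wshift add0r -/(tpos _) => /andP[h1 h2].
  by rewrite -/(tpos _ _) -subr_ge0 h1 tposS -ltrBlDl.
by rewrite cumS cum0 add0r.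
Qed.

(** b - B takes equal values at the two lifts meeting at a tile boundary, so it descends to a
    locally constant function [bt] of the tiling with coboundary [c]. Cutting the cover along its
    level sets makes [c] a coboundary. *)
Lemma coboundary_holonomy U (c : cocycle U) b f : holonomy U (val c) b f ->
  cohomologous phi f (fun _ => 0) -> cech_class c = 0.
Proof.
move=> [[ha hb] hc] /cohomologous0[B [nB hB] hf].
have canM T : 0 <= - tile_pos T 0 <= M.
  by have /andP[-> h] := canonical_range T; rewrite (le_trans (ltW h)).
pose bt T u := b (tile_label T) (- tile_pos T 0) u - B (tile_label T).
have btc u v T : cover_mem U u -> cover_mem U v -> u T -> v T -> val c u v = bt T v - bt T u.
  move=> hu hv uT vT; have hT := lifts_label omega_gt0 T.
  rewrite (hb u v T _ _ hu hv hT uT vT (lifts_allowed hT) (canM T)) /bt.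
  by ring.
have bt_loc u T : cover_mem U u -> u T -> exists (n : nat) (eta : R), 0 < eta /\
    forall y t T', agree_on (- n%:Z) n%:Z (tile_label T) y -> `|t - - tile_pos T 0| < eta ->
      lifts T' y t -> bt T' u = bt T u.
  move=> hu uT; have hT := lifts_label omega_gt0 T; have hx := lifts_allowed hT.
  have /andP[s0 s1] := canonical_range T.
  rewrite /bt; move: hT hx s0 s1 (canM T).
  move: (tile_label T) (- tile_pos T 0) => x s hT hx s0 s1 hs.
  have [n1 [eta1 [e1 h1]]] := ha u T x s hu hT uT hx hs.
  have inside (eta : R) y t T' : eta <= eta1 -> eta <= omega 0 (x 0) - s ->
      agree_on (- (n1 + nB).+1%:Z) (n1 + nB).+1%:Z x y -> `|t - s| < eta -> lifts T' y t -> 0 <= t ->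
      b (tile_label T') (- tile_pos T' 0) u - B (tile_label T') = b x s u - B x.
    move=> l1 l2 e ht hT' t0.
    have ey : y 0 = x 0 by rewrite e //; clear; lia.
    have ht1 : t < omega 0 (y 0).
      by rewrite ey; move: (ltr_normlW ht) l2; clear; lra.
    have hr : 0 <= t < omega 0 (y 0) by rewrite t0.
    have [<- <-] := canonical_unique hT' hr.
    have hy := lifts_allowed hT'.
    rewrite (h1 y t) ?(hB x y) //.
    - by apply: agree_onWn e; clear; lia.
    - by apply: agree_onWn e; clear; lia.
    - exact: lt_le_trans l1.
    - by rewrite t0 (le_trans (ltW ht1)).
  (* If a tile starts exactly at the origin, nearby tilings may have their canonical lift near the
     end of the preceding tile; [jump] compares the values across. *)
  have [sgt|sle] := ltP 0 s.
    exists (n1 + nB).+1, (Num.min s (Num.min eta1 (omega 0 (x 0) - s))); split.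
      by rewrite !lt_min sgt e1 subr_gt0.
    move=> y t T' e; rewrite lt_min => /andP[ts ht] hT'.
    apply: inside e ht hT' _; rewrite ?ge_min ?lexx ?orbT //.
    by move: ts; rewrite ltr_norml => /andP[]; lra.
  have {sle s0} es : s = 0 by apply/eqP; rewrite eq_le sle.
  rewrite {s}es in hT s1 hs h1 inside *.
  pose x' := wshift (- 1) x.
  have hx' : allowed_biinf phi x' := allowed_shift hx.
  have tm1 z : tpos z (- 1) = - omega 0 (z (- 1)).
    have := tposS om z (- 1); rewrite addNr tpos0 => /eqP.
    by rewrite eq_sym addr_eq0 => /eqP.
  have x'0 : x' 0 = x (- 1) by rewrite /x' /wshift add0r.
  have hTx' : lifts T x' (omega 0 (x' 0)).
    by have := lifts_shift (- 1) hT; rewrite tm1 sub0r opprK x'0.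
  have [n2 [eta2 [e2 h2]]] := ha u T x' _ hu hTx' uT hx' (om_in_range omega_gt0 M_ge x').
  have jump : b x 0 u - B x = b x' (omega 0 (x' 0)) u - B x'.
    have := hc x' T u hTx' hu uT; rewrite hf //.
    rewrite (_ : wshift 1 x' = x); last by rewrite /x' wshiftD subrr wshift0.
    by move: (b _ _ _) (b _ _ _) (B _) (B _); clear; move=> *; lia.
  exists (n1 + n2 + nB).+2, (Num.min eta2 (Num.min (omega 0 (x' 0)) (Num.min eta1 (omega 0 (x 0) - 0)))); split.
    by rewrite !lt_min e2 e1 subr0 !omega_gt0.
  move=> y t T' e ht hT'; have [t0|t0] := leP 0 t.
    apply: inside hT' t0; last exact: ht.
    - by rewrite !ge_min lexx !orbT.
    - by rewrite !ge_min lexx !orbT.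
    - by apply: agree_onWn e; clear; lia.
  rewrite jump.
  have hT'' := lifts_shift (- 1) hT'; rewrite tm1 opprK in hT''.
  have ey : y (- 1) = x' 0 by rewrite x'0 e //; clear; lia.
  move: ht; rewrite !lt_min subr0 => /and3P[ht1 ht2 _].
  have {}ht2 : - omega 0 (x' 0) < t by move: ht2; rewrite ltr_norml => /andP[].
  have hr : 0 <= t + omega 0 (y (- 1)) < omega 0 (wshift (- 1) y 0).
    by rewrite /wshift add0r ey; move: ht2 t0; clear; lra.
  have [<- <-] := canonical_unique hT'' hr.
  have hy' := lifts_allowed hT''.
  rewrite (h2 (wshift (- 1) y)) ?(hB x' (wshift (- 1) y)) //.
  - by move=> i hi; apply: e; move: hi; clear; lia.
  - by move=> i hi; apply: e; move: hi; clear; lia.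
  - by rewrite ey addrK.
  - by have /andP[-> h] := hr; rewrite (le_trans (ltW h)).
pose mem w := exists2 u, cover_mem U u & exists k : int, w = [set T | u T /\ bt T u = k].
have mem_open w : mem w -> open w.
  move=> [u hu [k ->]]; apply: (lifts_open omega_gt0) => T [uT ek].
  have hT := lifts_label omega_gt0 T.
  have [n [eta [e0 h1]]] := bt_loc u T hu uT.
  have [n' [eta' [e0' h2]]] := open_lifts omega_gt0 (cover_open hu) uT hT.
  exists (tile_label T), (- tile_pos T 0), (n + n')%N, (Num.min eta eta'); split=> //.
    by rewrite lt_min e0.
  move=> y t T' e; rewrite lt_min => /andP[t1 t2] hT'; split.
    by apply: (h2 y t T') => //; apply: agree_onWn e; clear; lia.
  by rewrite (h1 y t T') //; apply: agree_onWn e; clear; lia.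
have mem_total : \bigcup_(w in mem) w = [set: tiling].
  apply/seteqP; split=> // T _; have [u hu uT] := cover_ex U T.
  by exists [set T' | u T' /\ bt T' u = bt T u] => //; exists u => //; exists (bt T u).
pose W := OpenCover mem_open mem_total.
have hW : refines U W by move=> w [u hu [k ->]]; exists u; split=> // T [].
rewrite -(cech_class_pullback hW); apply: cech_class_coboundary.
(* [w] is a level set of [bt] for some u, and passing from u to the chosen member adds a value of
   [c], which is constant. *)
have /choice[gam hgam] : forall w, exists k : int, mem w -> forall T, w T -> bt T (refinement_map U w) = k.
  move=> w; have [hw|nw] := pselect (mem w); last by exists 0.
  have [[T0 wT0]|nT] := pselect (exists T, w T); last first.
    by exists 0 => _ T wT; case: nT; exists T.
  exists (bt T0 (refinement_map U w)) => _ T wT.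
  have [rw sw] := refinement_mapP hW hw.
  have [u hu [k ew]] := hw.
  have [uT ekT] : u T /\ bt T u = k by have := wT; rewrite ew.
  have [uT0 ekT0] : u T0 /\ bt T0 u = k by have := wT0; rewrite ew.
  have := btc u _ T hu rw uT (sw _ wT); rewrite (btc u _ T0 hu rw uT0 (sw _ wT0)) ekT ekT0.
  by move: (bt _ _) (bt _ _); clear; move=> *; lia.
exists gam => u v hu hv [T [uT vT]].
have [ru su] := refinement_mapP hW hu; have [rv sv] := refinement_mapP hW hv.
rewrite [LHS](btc _ _ T ru rv (su _ uT) (sv _ vT)).
by rewrite (hgam u hu T uT) (hgam v hv T vT).
Qed.

Lemma cech_rel_eq0r alpha f : cech_rel alpha f -> cohomologous phi f (fun _ => 0) -> alpha = 0.
Proof. by move=> [U [c [b [-> h]]]] hf; apply: coboundary_holonomy h hf. Qed.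

End CechRelation.

(** * Realizing every locally constant function as a holonomy *)

Lemma center_difference (R : realFieldType) (eta M t a b s s' : R) :
  `|t - a - s| < eta -> `|t - b - s'| < eta -> 0 <= s <= M -> 0 <= s' <= M ->
  `|b - a| < M + 2 * eta.
Proof.
rewrite !ltr_norml => /andP[? ?] /andP[? ?] /andP[? ?] /andP[? ?].
by apply/andP; split; lra.
Qed.

Lemma center_difference2 (R : realFieldType) (eta m t t' a b a' b' s s' : R) : 4 * eta < m ->
  `|t - a - s| < eta -> `|t - b - s'| < eta -> `|t' - a' - s| < eta -> `|t' - b' - s'| < eta ->
  `|(b - a) - (b' - a')| < m.
Proof.
move=> ?; rewrite !ltr_norml => /andP[? ?] /andP[? ?] /andP[? ?] /andP[? ?].
by apply/andP; split; lra.
Qed.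

Section CechRelationSurjective.
Variables (R : realType) (d : nat) (phi : substitution d) (omega : 'rV[R]_d).
Hypothesis omega_gt0 : forall a, 0 < omega 0 a.
Local Notation om := (fun a => omega 0 a).
Local Notation tpos := (tpos om).
Local Notation tiling := (tiling phi omega).
Local Notation lifts := (@lifts R d phi omega).
Local Notation word := (int -> 'I_d).
Implicit Types (x y : word) (T : tiling) (s t : R) (u v w : set tiling).
Variables m M : R.
Hypotheses (m_gt0 : 0 < m) (m_le : forall a, m <= omega 0 a) (M_ge : forall a, omega 0 a <= M).

Lemma tpos_sep y j j' : `|tpos y j - tpos y j'| < m -> j = j'.
Proof.
have main i i' : i < i' -> `|tpos y i - tpos y i'| < m -> False.
  move=> ii' h; have : tpos y (i + 1) <= tpos y i' by rewrite tpos_le // lezD1.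
  rewrite tposS; have := m_le (y i); move: h; rewrite ltr_norml => /andP[]; lra.
move=> h; case: (ltgtP j j') => // jj; first by case: (main j j').
by case: (main j' j) => //; rewrite distrC.
Qed.

Lemma tpos_abs_lt y (j : int) (K : nat) : `|tpos y j| < m * K%:R -> (`|j| < K)%N.
Proof.
move=> h; rewrite -(ltr_nat R) -(ltr_pM2l m_gt0); apply: le_lt_trans h.
have hl i n := @cum_lower _ (fun i => omega 0 (y i)) m i n (fun i => m_le (y i)).
case: j => n.
  have := hl 0 n; rewrite -/(tpos y) tpos0 add0r subr0 absz_nat mulr_natr => h.
  exact: le_trans h (ler_norm _).
have := hl (Negz n) n.+1; rewrite -/(tpos y) NegzE addNr tpos0 sub0r abszN absz_nat mulr_natr => h.
by apply: le_trans h _; rewrite -normrN ler_norm.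
Qed.

Variables (f : word -> int) (n0 : nat).
Hypothesis f_window : forall x y, allowed_biinf phi x -> allowed_biinf phi y ->
  agree_on (- n0%:Z) n0%:Z x y -> f x = f y.
Variables (eta : R) (K : nat).
Hypotheses (eta_gt0 : 0 < eta) (eta_lt : 4 * eta < m) (K_gt : M + 2 * eta < m * K%:R).
Let N := (n0 + K).+1.

Definition birkhoff y (j : int) : int := cum (fun i => f (wshift i y)) j.

Lemma birkhoff_shift y k j : birkhoff (wshift k y) j = birkhoff y (j + k) - birkhoff y k.
Proof.
rewrite /birkhoff -cum_shift; apply: eq_cum => i; by rewrite wshiftD.
Qed.

Lemma birkhoff_agree y y' (j : int) (n : nat) : allowed_biinf phi y -> allowed_biinf phi y' ->
  (n0 + `|j| <= n)%N -> agree_on (- n%:Z) n%:Z y y' -> birkhoff y j = birkhoff y' j.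
Proof.
move=> hy hy' hn e.
apply: (eq_cum_on (a := - `|j|%N%:Z) (b := `|j|%N%:Z)); try by move: hn; clear; lia.
move=> i hi; apply: f_window; try exact: allowed_shift.
by move=> k hk; apply: e; move: hn hi hk; clear; lia.
Qed.

Lemma tpos_agree y y' (j : int) (n : nat) :
  (`|j| <= n)%N -> agree_on (- n%:Z) n%:Z y y' -> tpos y j = tpos y' j.
Proof.
move=> hn e; have h0 : - n%:Z <= 0 <= n%:Z by clear; lia.
by apply: (agree_tpos om h0 e); move: hn; clear; lia.
Qed.

(** Among the lifts (shift^j y, t - tpos y j) of one tiling, the one close to the centre [c]. *)
Definition near_center (c : word * R) y t j :=
  agree_on (- N%:Z) N%:Z c.1 (wshift j y) /\ `|t - tpos y j - c.2| < eta.

Definition small (c : word * R) u := 0 <= c.2 <= M /\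
  forall T, u T -> exists y t, [/\ lifts T y t, agree_on (- N%:Z) N%:Z c.1 y & `|t - c.2| < eta].

Lemma near_center_unique c y t j j' : near_center c y t j -> near_center c y t j' -> j = j'.
Proof.
move=> [_ h] [_ h']; apply: (@tpos_sep y).
rewrite (_ : _ - _ = (t - tpos y j' - c.2) - (t - tpos y j - c.2)); last by ring.
apply: le_lt_trans (ler_normB _ _) _; apply: lt_trans eta_lt.
by apply: lt_le_trans (ltrD h' h) _; move: eta_gt0 => ?; lra.
Qed.

Lemma near_center_ex c u T y t : small c u -> lifts T y t -> u T -> exists j, near_center c y t j.
Proof.
move=> [_ h] hT /h[y1 [t1 [hT1 e ht]]]; have [j [ey et]] := lifts_inj hT hT1.
by exists j; rewrite /near_center -ey -et.
Qed.

(** |jv - ju| < K, so the window around the first centre fixes the positions and the values of [f]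
    involved. The positions found in [y] and [y'] differ by less than the shortest tile, so the
    indices coincide. *)
Lemma birkhoff_const c c' y y' t t' ju jv ju' jv' : 0 <= c.2 <= M -> 0 <= c'.2 <= M ->
  allowed_biinf phi y -> allowed_biinf phi y' ->
  near_center c y t ju -> near_center c' y t jv ->
  near_center c y' t' ju' -> near_center c' y' t' jv' ->
  birkhoff y ju - birkhoff y jv = birkhoff y' ju' - birkhoff y' jv'.
Proof.
move=> /andP[c0 cM] /andP[c0' cM'] hy hy' [au tu] [_ tv] [au' tu'] [_ tv'].
pose z := wshift ju y; pose z' := wshift ju' y'.
have e : agree_on (- N%:Z) N%:Z z z'.
  exact: agree_on_trans (agree_on_sym au) au'.
have tz : tpos z (jv - ju) = tpos y jv - tpos y ju by rewrite tpos_shift subrK.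
have tz' : tpos z' (jv' - ju') = tpos y' jv' - tpos y' ju' by rewrite tpos_shift subrK.
have d1 : (`|jv - ju| < K)%N.
  apply: (@tpos_abs_lt z); apply: lt_trans K_gt; rewrite tz.
  by apply: center_difference tu tv _ _; apply/andP.
have t_eq : tpos z (jv - ju) = tpos z' (jv - ju).
  by apply: tpos_agree e; move: d1; rewrite /N; clear; lia.
have dd : jv - ju = jv' - ju'.
  apply: (@tpos_sep z'); rewrite -t_eq tz tz'.
  exact: center_difference2 eta_lt tu tv tu' tv'.
have s_eq : birkhoff z (jv - ju) = birkhoff z' (jv' - ju').
  rewrite -dd; apply: (birkhoff_agree (n := N)) e; try exact: allowed_shift.
  by move: d1; rewrite /N; clear; lia.
move: s_eq; rewrite !birkhoff_shift !subrK.
by move: (birkhoff _ _) (birkhoff _ _) (birkhoff _ _) (birkhoff _ _); clear; move=> *; lia.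
Qed.

Definition small_open u := open u /\ exists c, small c u.

Lemma small_open_total : \bigcup_(u in small_open) u = [set: tiling].
Proof.
apply/seteqP; split=> // T _.
have hT := lifts_label omega_gt0 T; have /andP[h0 h1] := canonical_range omega_gt0 T.
pose c := (tile_label T, - tile_pos T 0).
exists [set T' | exists y t, [/\ lifts T' y t, agree_on (- N%:Z) N%:Z c.1 y & `|t - c.2| < eta]].
  split; last by exists c; split=> //=; rewrite h0 (le_trans (ltW h1)).
  apply: (lifts_open omega_gt0) => T' [y [t [hT' e ht]]].
  exists y, t, N, (eta - `|t - c.2|); split=> //; first by rewrite subr_gt0.
  move=> y' t' T'' e' ht' hT''; exists y', t'; split=> //.
    exact: agree_on_trans e e'.
  have -> : t' - c.2 = (t' - t) + (t - c.2) by rewrite addrA subrK.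
  by apply: le_lt_trans (ler_normD _ _) _; rewrite -ltrBrDr.
by exists (tile_label T), (- tile_pos T 0); split=> //; rewrite /c /= subrr normr0.
Qed.

Lemma small_open_open u : small_open u -> open u. Proof. by case. Qed.

Definition small_cover := OpenCover small_open_open small_open_total.

(** The primitive is minus the Birkhoff sum of [f] from [y] to the lift near the centre of u; its
    differences are constant on overlaps by [birkhoff_const]. Shifting the base word drops the term
    f x from the sum, so the holonomy is [f]. *)
Lemma cech_rel_ex_small (w0 : word) : exists alpha, @cech_rel R d phi omega M alpha f.
Proof.
have /choice[ctr hctr] : forall u, exists c, small_open u -> small c u.
  move=> u; have [[ou [c hc]]|nu] := pselect (small_open u); first by exists c.
  by exists (w0, 0) => /nu.
pose J y t u : int := xget 0 [set j | near_center (ctr u) y t j].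
have JP T y t u : small_open u -> lifts T y t -> u T -> near_center (ctr u) y t (J y t u).
  move=> hu hT uT; have [j hj] := near_center_ex (hctr u hu) hT uT.
  by rewrite /J; case: xgetP => [j' _ //|/(_ j)].
have JE y t u j : near_center (ctr u) y t j -> J y t u = j.
  move=> hj; rewrite /J; case: xgetP => [j' _ hj'|/(_ j)//].
  exact: near_center_unique hj' hj.
pose b y t u : int := - birkhoff y (J y t u).
have b_const u v T y t T' y' t' : small_open u -> small_open v -> lifts T y t -> u T -> v T ->
    lifts T' y' t' -> u T' -> v T' -> b y t v - b y t u = b y' t' v - b y' t' u.
  move=> hu hv hT uT vT hT' uT' vT'.
  have := birkhoff_const (proj1 (hctr u hu)) (proj1 (hctr v hv))
    (lifts_allowed hT) (lifts_allowed hT') (JP _ _ _ _ hu hT uT) (JP _ _ _ _ hv hT vT)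
    (JP _ _ _ _ hu hT' uT') (JP _ _ _ _ hv hT' vT').
  by rewrite /b; move: (birkhoff _ _) (birkhoff _ _) (birkhoff _ _) (birkhoff _ _); clear; move=> *; lia.
have /choice[c0 hc0] : forall uv : set tiling * set tiling, exists k : int,
    small_open uv.1 -> small_open uv.2 -> forall T y t, lifts T y t -> uv.1 T -> uv.2 T ->
    k = b y t uv.2 - b y t uv.1.
  move=> [u v] /=.
  have [[T [uT vT]]|no] := pselect (exists T, u T /\ v T); last first.
    by exists 0 => _ _ T y t _ uT vT; case: no; exists T.
  exists (b (tile_label T) (- tile_pos T 0) v - b (tile_label T) (- tile_pos T 0) u).
  move=> hu hv T' y t hT' uT' vT'; apply: (b_const u v T _ _ T') => //.
  exact: lifts_label.
pose c : cochain1 tiling := fun u v => c0 (u, v).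
have cE u v T y t : small_open u -> small_open v -> lifts T y t -> u T -> v T ->
    c u v = b y t v - b y t u.
  by move=> hu hv hT uT vT; apply: (hc0 (u, v) hu hv T).
have cP : c \in cocycle_pred small_cover.
  apply/asboolP => u v w hu hv hw [T [[uT vT] wT]].
  have hT := lifts_label omega_gt0 T.
  rewrite (cE v w T _ _ hv hw hT vT wT) (cE u w T _ _ hu hw hT uT wT) (cE u v T _ _ hu hv hT uT vT).
  by ring.
exists (cech_class (Cocycle cP)), small_cover, (Cocycle cP), b; split=> //.
split; first split.
- move=> u T x s hu hT uT hx hs; have [ha ht] := JP T x s u hu hT uT.
  set j := J x s u in ha ht.
  exists (N + `|j| + n0)%N, (eta - `|s - tpos x j - (ctr u).2|); split; first by rewrite subr_gt0.
  move=> y t hy e hts _.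
  have ej : tpos x j = tpos y j by apply: tpos_agree e; clear; lia.
  have Jy : J y t u = j.
    apply: JE; split.
      apply: agree_on_trans ha _ => i hi; apply: e; move: hi; clear; lia.
    rewrite -ej (_ : t - _ - _ = (t - s) + (s - tpos x j - (ctr u).2)); last by ring.
    by apply: le_lt_trans (ler_normD _ _) _; rewrite -ltrBrDr.
  rewrite /b Jy -/j; congr (- _); apply/esym/(birkhoff_agree (n := N + `|j| + n0)) => //.
  by clear; lia.
- by move=> u v T x s hu hv hT uT vT hx hs; apply: (cE u v T).
- move=> x T u hT hu uT.
  have [ha ht] := JP T x _ u hu hT uT; set j := J x _ u in ha ht.
  have Jn : J (wshift 1 x) 0 u = j - 1.
    apply: JE; split; first by rewrite wshiftD subrK.
    by rewrite tpos_shift subrK tpos1 opprB addrA (addrC 0) addr0 in ht *.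
  rewrite /b Jn birkhoff_shift subrK -/j opprB opprK.
  rewrite [birkhoff x 1](_ : _ = f x); first by move: (birkhoff _ _) (f x); clear; move=> *; lia.
  by rewrite /birkhoff -[1]add0r cumS cum0 add0r wshift0.
Qed.

End CechRelationSurjective.

Theorem theorem4 (R : realType) (d : nat) (phi : substitution d)
    (lambda : R) (omega : 'rV[R]_d)
    (p : nat) (C : 'I_p -> {set S_vertex d}) (P : 'M[int]_d)
    (phi_primitive : primitive phi)
    (phi_aperiodic : aperiodic phi)
    (lambda_PF : perron_eigenvalue (subst_mx phi) lambda)
    (omega_gt0 : forall i, 0 < omega 0 i)
    (omega_eigen : omega *m map_mx intr (subst_mx phi) = lambda *: omega)
    (C_components : component_enum phi C)
    (P_basis : basis_extension C P) :
  group_isomorphic (cech_H1 (tiling phi omega))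
    (mx_dirlim (A1_mx phi p P) * 'cV[int]_(cycle_rank phi))%type.
Proof.
have om_eigen a : \sum_(b <- phi a) omega 0 b = lambda * omega 0 a.
  rewrite sum_count; have := congr1 (fun A : 'rV[R]_d => A 0 a) omega_eigen.
  by rewrite !mxE => <-; apply: eq_bigr => i _; rewrite !mxE mulr_natr.
have [ry [rk [rP rE r_loc]]] := desubstitution_map phi_primitive phi_aperiodic omega_gt0 om_eigen.
have grows := subst_iter_grows phi_primitive phi_aperiodic omega_gt0 om_eigen.
have pairs := exists_allowed_pair phi_primitive phi_aperiodic.
have letters := exists_allowed_letter phi_primitive phi_aperiodic.
have [m m_gt0 g_idem] := iter_idempotent (S_map phi).
have [kappa [kappaB kappa_ex kappa_inj]] := graph_splitting (erefl (cycle_rank phi)).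
have [om_m [om_M [m0 M0 hm hM]]] := finite_bounds omega_gt0.
have [w0 _] := phi_aperiodic.
pose rel2 := @coinvariant_rel d phi p P m _ kappa.
(* A class and a pair correspond when a common function [f] is a holonomy of the one and is
   described by the other. *)
apply: (@group_isomorphic_of_relation _ _ (fun alpha xz => exists f,
  [/\ loc_const phi f, cech_rel om_M alpha f & rel2 f xz])).
- move=> alpha alpha' xz xz' [f [h1 h2 h3]] [f' [h1' h2' h3']].
  exists (fun x => f x - f' x); split; first exact: loc_constB.
    exact: cech_relB.
  exact: (coinvariant_relB C_components P_basis).
- move=> alpha; have [U [c ->]] := dirlim_surj alpha; rewrite -[c]reprK.
  have [b [f [hf hol]]] := holonomy_ex omega_gt0 hM (repr c) (ltW M0).
  have [xz hxz] := coinvariant_rel_total_l C_components P_basis grows letters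
    m_gt0 g_idem kappa_ex hf.
  by exists xz, f; split=> //; exists U, (repr c), b.
- move=> xz; have [f hf hxz] := coinvariant_rel_total_r (P := P) rP rE r_loc m kappa xz.
  have [n0 hn0] := hf.
  pose eta := om_m / 5; have eta0 : 0 < eta by rewrite divr_gt0.
  have [K hK] := real_archi (om_M + 2 * eta) m0.
  have [||alpha halpha] := @cech_rel_ex_small R d phi omega omega_gt0 om_m om_M m0 hm hM f n0 hn0 eta K eta0 _ _ w0.
  - by rewrite /eta; lra.
  - by rewrite mulr_natr.
  by exists alpha, f.
- move=> xz [f [hf h1 h2]].
  apply: (coinvariant_rel_eq0l C_components P_basis grows pairs letters m_gt0 g_idem kappaB kappa_inj) h2.
  exact: (cech_rel_eq0l omega_gt0 hM (ltW M0) h1).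
- move=> alpha [f [hf h1 h2]].
  apply: (cech_rel_eq0r omega_gt0 hM h1).
  exact: (coinvariant_rel_eq0r C_components P_basis letters rP rE r_loc kappaB hf h2).
Qed.
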